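(* The action of $\mathrm{Mod}(\Sigma_2)$ on $\mathcal{M}^0(\Gamma_2)$ is not ergodic.
   Context: $\Sigma_2$ is a compact connected oriented surface of genus $2$ without boundary and $\Gamma_2=\pi_1(\Sigma_2)=\langle a_1,b_1,a_2,b_2\mid [a_1,b_1][a_2,b_2]\rangle$. A representation $\rho\in\mathrm{Hom}(\Gamma_2,\mathrm{PSL}_2(\mathbb{R}))$ is non-elementary if its image is Zariski dense in $\mathrm{PSL}_2(\mathbb{R})$. $\mathcal{M}(\Gamma_2)$ is the quotient of the set of non-elementary representations by conjugation by $\mathrm{PSL}_2(\mathbb{R})$; it is a smooth symplectic manifold of dimension $6$. The Euler class $\mathrm{eu}(\rho)\in\mathbb{Z}$ is obtained by choosing arbitrary lifts of $\rho(a_i),\rho(b_i)$ to the universal cover $\widetilde{\mathrm{PSL}}_2(\mathbb{R})$ and computing the product of commutators of these lifts corresponding to the relator; it lies in the kernel of $\widetilde{\mathrm{PSL}}_2(\mathbb{R})\to\mathrm{PSL}_2(\mathbb{R})$, identified with $\mathbb{Z}$. $\mathcal{M}^0(\Gamma_2)$ is the set of classes in $\mathcal{M}(\Gamma_2)$ with Euler class $0$. $\mathrm{Mod}(\Sigma_2)=\mathrm{Aut}^+(\Gamma_2)/\mathrm{Inn}(\Gamma_2)$, where $\mathrm{Aut}^+(\Gamma_2)$ is the group of automorphisms fixing the fundamental class in $H_2(\Gamma_2,\mathbb{Z})$, acts on $\mathcal{M}^0(\Gamma_2)$ by precomposition. Ergodicity is with respect to the Lebesgue measure class of the manifold (equivalently,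 that of the symplectic volume): the action is ergodic if every invariant measurable real-valued function is almost everywhere constant. *)

(* Defs.v *)
From HB Require Import structures.
From mathcomp Require Import all_boot all_order all_algebra.
From mathcomp Require Import all_classical all_reals all_analysis.
From mathcomp Require Import freeg.
From mathcomp Require Import ring.
From mathcomp Require mpoly.
Import numFieldNormedType.Exports.

Set Implicit Arguments.
Unset Strict Implicit.
Unset Printing Implicit Defensive.

Import Order.TTheory GRing.Theory Num.Theory.

Local Open Scope quotient_scope.
Local Open Scope classical_set_scope.
Local Open Scope ring_scope.

(** * Commutators and the surface relator *)

(* [x, y] = x y x^-1 y^-1; the library's [~ x, y] is x^-1 y^-1 x y. *)
Definition commutator (G : groupType) (x y : G) : G :=
  (x * y * x^-1 * y^-1)%g.

Definition surface_relator (G : groupType) (a1 b1 a2 b2 : G) : G :=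
  (commutator a1 b1 * commutator a2 b2)%g.

(** * The group Gamma_2 = < a1, b1, a2, b2 | [a1, b1] [a2, b2] > *)

Inductive generator := A1 | B1 | A2 | B2.

HB.instance Definition _ := gen_eqMixin generator.
HB.instance Definition _ := gen_choiceMixin generator.

(* The letter (x, true) stands for x and (x, false) for x^-1. *)
Definition letter : Type := (generator * bool)%type.
HB.instance Definition _ := Choice.on letter.

Definition word : Type := seq letter.
HB.instance Definition _ := Choice.on word.

Definition relator_word : word :=
  [:: (A1, true); (B1, true); (A1, false); (B1, false);
      (A2, true); (B2, true); (A2, false); (B2, false)].

Inductive word_eq : word -> word -> Prop :=
| word_eq_refl u : word_eq u u
| word_eq_sym u v : word_eq u v -> word_eq v u
| word_eq_trans u v w : word_eq u v -> word_eq v w -> word_eq u w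
| word_eq_cat u u' v v' :
    word_eq u u' -> word_eq v v' -> word_eq (u ++ v) (u' ++ v')
| word_eq_cancel x b : word_eq [:: (x, b); (x, ~~ b)] [::]
| word_eq_relator : word_eq relator_word [::].

Lemma word_eq_is_equiv :
  equiv_class_of (fun u v : word => `[< word_eq u v >]).
Proof.
split=> [u|u v|v u w].
- exact/asboolP/word_eq_refl.
- by apply/asboolP/asboolP => /word_eq_sym.
- move=> /asboolP uv /asboolP vw; apply/asboolP; exact: word_eq_trans uv vw.
Qed.
Definition word_equiv := EquivRelPack word_eq_is_equiv.

Definition Gamma2 : Type := {eq_quot word_equiv}.
HB.instance Definition _ := Choice.on Gamma2.
HB.instance Definition _ := Quotient.on Gamma2.
HB.instance Definition _ : EqQuotient _ word_equiv Gamma2 :=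
  EqQuotient.on Gamma2.

Lemma Gamma2_eqP (u v : word) : \pi_Gamma2 u = \pi_Gamma2 v <-> word_eq u v.
Proof.
split=> [/eqP|uv].
  by rewrite eqmodE => /asboolP.
by apply/eqP; rewrite eqmodE; apply/asboolP.
Qed.

Lemma word_eq_repr (u : word) : word_eq (repr (\pi_Gamma2 u)) u.
Proof. by apply/Gamma2_eqP; rewrite reprK. Qed.

Definition flip (l : letter) : letter := (l.1, ~~ l.2).
Definition inv_word (u : word) : word := rev (map flip u).

Lemma inv_wordK : involutive inv_word.
Proof.
move=> u; rewrite /inv_word map_rev revK -map_comp map_id_in // => -[x b] _.
by rewrite /flip /= negbK.
Qed.

Lemma word_eq_mulV u : word_eq (u ++ inv_word u) [::].
Proof.
elim: u => [|[x b] u IHu]; first exact: word_eq_refl.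
rewrite /inv_word /= rev_cons -cats1 catA -/(inv_word u).
apply: (word_eq_trans (v := [:: (x, b)] ++ [::] ++ [:: (x, ~~ b)])).
  rewrite -cat1s; apply: word_eq_cat; first exact: word_eq_refl.
  by apply: word_eq_cat; [exact: IHu|exact: word_eq_refl].
exact: word_eq_cancel.
Qed.

Lemma word_eq_inv u v : word_eq u v -> word_eq (inv_word u) (inv_word v).
Proof.
move=> uv; apply: (word_eq_trans (v := inv_word u ++ v ++ inv_word v)).
  rewrite -[X in word_eq X]cats0; apply: word_eq_cat; first exact: word_eq_refl.
  exact/word_eq_sym/word_eq_mulV.
rewrite catA -[X in word_eq _ X]cat0s; apply: word_eq_cat; last exact: word_eq_refl.
apply: (word_eq_trans (v := inv_word u ++ u)).
  by apply: word_eq_cat; [exact: word_eq_refl|exact: word_eq_sym].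
by rewrite -[X in _ ++ X]inv_wordK; exact: word_eq_mulV.
Qed.

Definition Gamma2_one : Gamma2 := \pi_Gamma2 [::].
Definition Gamma2_mul (x y : Gamma2) : Gamma2 := \pi_Gamma2 (repr x ++ repr y).
Definition Gamma2_inv (x : Gamma2) : Gamma2 := \pi_Gamma2 (inv_word (repr x)).

Lemma Gamma2_mulE (u v : word) :
  Gamma2_mul (\pi_Gamma2 u) (\pi_Gamma2 v) = \pi_Gamma2 (u ++ v).
Proof. by apply/Gamma2_eqP/word_eq_cat; exact: word_eq_repr. Qed.

Lemma Gamma2_invE (u : word) :
  Gamma2_inv (\pi_Gamma2 u) = \pi_Gamma2 (inv_word u).
Proof. by apply/Gamma2_eqP/word_eq_inv/word_eq_repr. Qed.

Lemma Gamma2_mulA : associative Gamma2_mul.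
Proof.
elim/quotW=> u; elim/quotW=> v; elim/quotW=> w.
by rewrite (Gamma2_mulE v) (Gamma2_mulE u) (Gamma2_mulE u) Gamma2_mulE catA.
Qed.

Lemma Gamma2_mul1 : left_id Gamma2_one Gamma2_mul.
Proof. by elim/quotW=> u; rewrite /Gamma2_one Gamma2_mulE. Qed.

Lemma Gamma2_mulr1 : right_id Gamma2_one Gamma2_mul.
Proof. by elim/quotW=> u; rewrite /Gamma2_one Gamma2_mulE cats0. Qed.

Lemma Gamma2_mulV : right_inverse Gamma2_one Gamma2_inv Gamma2_mul.
Proof.
elim/quotW=> u; rewrite Gamma2_invE Gamma2_mulE.
exact/Gamma2_eqP/word_eq_mulV.
Qed.

Lemma Gamma2_Vmul : left_inverse Gamma2_one Gamma2_inv Gamma2_mul.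
Proof.
elim/quotW=> u; rewrite Gamma2_invE Gamma2_mulE; apply/Gamma2_eqP.
by rewrite -[X in _ ++ X]inv_wordK; exact: word_eq_mulV.
Qed.

HB.instance Definition _ := isGroup.Build Gamma2
  Gamma2_mulA Gamma2_mul1 Gamma2_mulr1 Gamma2_Vmul Gamma2_mulV.

Definition gen (x : generator) : Gamma2 := \pi_Gamma2 [:: (x, true)].
Notation a1 := (gen A1).
Notation b1 := (gen B1).
Notation a2 := (gen A2).
Notation b2 := (gen B2).

Lemma gen_inv x : (gen x)^-1%g = \pi_Gamma2 [:: (x, false)].
Proof. exact: Gamma2_invE. Qed.

Lemma Gamma2_relation : surface_relator a1 b1 a2 b2 = 1%g.
Proof.
have mulE u v : \pi_Gamma2 (u ++ v) = (\pi_Gamma2 u * \pi_Gamma2 v)%g.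
  exact/esym/Gamma2_mulE.
transitivity (\pi_Gamma2 relator_word); last exact/Gamma2_eqP/word_eq_relator.
rewrite (_ : relator_word =
  ([:: (A1, true)] ++ [:: (B1, true)] ++ [:: (A1, false)] ++ [:: (B1, false)]) ++
  ([:: (A2, true)] ++ [:: (B2, true)] ++ [:: (A2, false)] ++ [:: (B2, false)])) //.
by rewrite !mulE -!gen_inv /surface_relator /commutator !mulgA.
Qed.

(** * H_2(Gamma_2, Z) (bar complex) and the mapping class group *)

(* Inhomogeneous bar complex with trivial coefficients: C_n is free on G^n. *)
Notation bar1 G := {freeg G / int}.
Notation bar2 G := {freeg (G * G) / int}.
Notation bar3 G := {freeg (G * G * G) / int}.

Definition bar_d2 (G : groupType) : bar2 G -> bar1 G :=
  fglift (fun p : G * G => (<< p.2 >> - << (p.1 * p.2)%g >> + << p.1 >> : bar1 G)).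

Definition bar_d3 (G : groupType) : bar3 G -> bar2 G :=
  fglift (fun p : G * G * G => let: (x, y, z) := p in
    (<< (y, z) >> - << ((x * y)%g, z) >> + << (x, (y * z)%g) >> - << (x, y) >>
       : bar2 G)).

Definition bar2_map (G H : groupType) (f : G -> H) : bar2 G -> bar2 H :=
  fglift (fun p : G * G => (<< (f p.1, f p.2) >> : bar2 H)).

HB.instance Definition _ (G : groupType) :=
  GRing.isZmodMorphism.Build _ _ (@bar_d2 G) (lift_is_additive _).
HB.instance Definition _ (G : groupType) :=
  GRing.isZmodMorphism.Build _ _ (@bar_d3 G) (lift_is_additive _).
HB.instance Definition _ (G H : groupType) (f : G -> H) :=
  GRing.isZmodMorphism.Build _ _ (bar2_map f) (lift_is_additive _).

Definition homologous (G : groupType) (c c' : bar2 G) : Prop :=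
  exists w : bar3 G, c - c' = bar_d3 w.

(* The 2-cycle sum_s [dr/ds | s], where r is the relator, s runs over the four
   generators and dr/ds is the Fox derivative. Its class is the fundamental
   class, a generator of H_2(Gamma_2, Z) = Z. *)
Definition fundamental_cycle : bar2 Gamma2 :=
  let c1 := commutator a1 b1 in
  let c2 := commutator a2 b2 in
  << (1%g, a1) >> + << (a1, b1) >>
  - << ((a1 * b1 * a1^-1)%g, a1) >> - << (c1, b1) >>
  + << (c1, a2) >> + << ((c1 * a2)%g, b2) >>
  - << ((c1 * (a2 * b2 * a2^-1))%g, a2) >> - << ((c1 * c2)%g, b2) >>.

Lemma fundamental_cycleP : bar_d2 fundamental_cycle = 0.
Proof.
have U1 (p : Gamma2 * Gamma2) : bar_d2 << p >> =
    << p.2 >> - << (p.1 * p.2)%g >> + << p.1 >> :> bar1 Gamma2.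
  by rewrite /bar_d2 liftU scale1r.
rewrite /fundamental_cycle; set c1 := commutator a1 b1; set c2 := commutator a2 b2.
rewrite !(raddfB, raddfD) /= !U1 /=.
have -> : (1 * a1 = a1)%g by rewrite mul1g.
have -> : (a1 * b1 * a1^-1 * a1 = a1 * b1)%g by rewrite mulgVK.
have -> : (c1 * b1 = a1 * b1 * a1^-1)%g by rewrite mulgVK.
have -> : (c1 * (a2 * b2 * a2^-1) * a2 = c1 * a2 * b2)%g.
  by rewrite -!mulgA mulVg mulg1.
have -> : (c1 * c2 * b2 = c1 * (a2 * b2 * a2^-1))%g.
  by rewrite -!mulgA mulVg mulg1.
have -> : (c1 * c2 = 1)%g by exact: Gamma2_relation.
apply/eqP/freeg_eqP => k; rewrite !(coeffB, coeffD, coeff0).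
ring.
Qed.

(* Aut^+(Gamma_2). *)
Record aut_plus := AutPlus {
  aut_fun :> UMagmaMorphism.type Gamma2 Gamma2;
  aut_bij : bijective aut_fun;
  aut_fundamental :
    homologous (bar2_map aut_fun fundamental_cycle) fundamental_cycle }.

HB.instance Definition _ := gen_eqMixin aut_plus.
HB.instance Definition _ := gen_choiceMixin aut_plus.

Definition inner_eq (phi psi : aut_plus) : Prop :=
  exists c : Gamma2, forall x, psi x = (c * phi x * c^-1)%g.

Lemma inner_eq_is_equiv :
  equiv_class_of (fun phi psi : aut_plus => `[< inner_eq phi psi >]).
Proof.
have sym phi psi : inner_eq phi psi -> inner_eq psi phi.
  by move=> [c cP]; exists c^-1%g => x; rewrite cP invgK !mulgA mulVg mul1g mulgVK.
split=> [phi|phi psi|psi phi chi].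
- by apply/asboolP; exists 1%g => x; rewrite mul1g invg1 mulg1.
- by apply/asboolP/asboolP => /sym.
- move=> /asboolP [c cP] /asboolP [d dP]; apply/asboolP; exists (d * c)%g => x.
  by rewrite dP cP invgM !mulgA.
Qed.
Definition inner_equiv := EquivRelPack inner_eq_is_equiv.

Definition Mod : Type := {eq_quot inner_equiv}.
HB.instance Definition _ := Choice.on Mod.
HB.instance Definition _ := Quotient.on Mod.
HB.instance Definition _ : EqQuotient _ inner_equiv Mod := EqQuotient.on Mod.

Lemma Mod_eqP (phi psi : aut_plus) :
  \pi_Mod phi = \pi_Mod psi <-> inner_eq phi psi.
Proof.
split=> [/eqP|e].
  by rewrite eqmodE => /asboolP.
by apply/eqP; rewrite eqmodE; apply/asboolP.
Qed.

(** * SL_2(R) and PSL_2(R) *)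

Definition SL2 (R : realType) : Type := set_type [set A : 'M[R]_2 | \det A = 1].
HB.instance Definition _ (R : realType) :=
  SubChoice.copy (SL2 R) (set_type [set A : 'M[R]_2 | \det A = 1]).
HB.instance Definition _ (R : realType) :=
  Topological.copy (SL2 R) (set_type [set A : 'M[R]_2 | \det A = 1]).

Section SL2.
Context {R : realType}.
Implicit Types s t : SL2 R.

Lemma SL2_det s : \det (val s) = 1.
Proof. exact: (set_valP s). Qed.

Lemma SL2_unit s : val s \in unitmx.
Proof. by rewrite unitmxE SL2_det unitr1. Qed.

Definition mkSL2 (A : 'M[R]_2) (dA : \det A = 1) : SL2 R := exist _ A (mem_set dA).

Lemma SL2_det1 : \det (1%:M : 'M[R]_2) = 1. Proof. exact: det1. Qed.
Lemma SL2_detM s t : \det (val s *m val t) = 1.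
Proof. by rewrite det_mulmx !SL2_det mulr1. Qed.
Lemma SL2_detV s : \det (invmx (val s)) = 1.
Proof. by rewrite det_inv SL2_det invr1. Qed.
Lemma SL2_detN s : \det (- val s) = 1.
Proof. by rewrite -scaleN1r detZ SL2_det mulr1 sqrrN expr1n. Qed.

Definition SL2_one := mkSL2 SL2_det1.
Definition SL2_mul s t := mkSL2 (SL2_detM s t).
Definition SL2_inv s := mkSL2 (SL2_detV s).

Lemma SL2_mulA : associative SL2_mul.
Proof. by move=> s t u; apply/val_inj; rewrite /= mulmxA. Qed.
Lemma SL2_mul1 : left_id SL2_one SL2_mul.
Proof. by move=> s; apply/val_inj; rewrite /= mul1mx. Qed.
Lemma SL2_mulr1 : right_id SL2_one SL2_mul.
Proof. by move=> s; apply/val_inj; rewrite /= mulmx1. Qed.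
Lemma SL2_mulV : right_inverse SL2_one SL2_inv SL2_mul.
Proof. by move=> s; apply/val_inj; rewrite /= mulmxV ?SL2_unit. Qed.
Lemma SL2_Vmul : left_inverse SL2_one SL2_inv SL2_mul.
Proof. by move=> s; apply/val_inj; rewrite /= mulVmx ?SL2_unit. Qed.

HB.instance Definition _ := isGroup.Build (SL2 R)
  SL2_mulA SL2_mul1 SL2_mulr1 SL2_Vmul SL2_mulV.

Definition pm_eq s t : Prop := val s = val t \/ val s = - val t.

Lemma pm_eq_is_equiv : equiv_class_of (fun s t => `[< pm_eq s t >]).
Proof.
have sym s t : pm_eq s t -> pm_eq t s.
  by rewrite /pm_eq => -[] ->; [left|right; rewrite opprK].
split=> [s|s t|t s u].
- by apply/asboolP; left.
- by apply/asboolP/asboolP => /sym.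
- move=> /asboolP st /asboolP tu; apply/asboolP; rewrite /pm_eq.
  by case: st => ->; case: tu => ->; rewrite ?opprK; [left|right|right|left].
Qed.
Definition pm_equiv := EquivRelPack pm_eq_is_equiv.

End SL2.

Definition PSL2 (R : realType) : Type :=
  quotient_topology {eq_quot @pm_equiv R}.
HB.instance Definition _ (R : realType) := Choice.on (PSL2 R).
HB.instance Definition _ (R : realType) := Quotient.on (PSL2 R).
HB.instance Definition _ (R : realType) := Topological.on (PSL2 R).

Section PSL2.
Context {R : realType}.
Implicit Types (s t : SL2 R) (g h : PSL2 R).

Definition psl2 s : PSL2 R := \pi_(PSL2 R) s.

Lemma psl2_eqP s t : psl2 s = psl2 t <-> pm_eq s t.
Proof.
have E : (psl2 s = psl2 t) =
    (\pi_{eq_quot @pm_equiv R} s = \pi_{eq_quot @pm_equiv R} t).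
  by rewrite /psl2 unlock.
rewrite E; split=> [/eqP|st].
  by rewrite eqmodE => /asboolP.
by apply/eqP; rewrite eqmodE; apply/asboolP.
Qed.

Lemma psl2_surj g : psl2 (repr g) = g.
Proof. exact: reprK. Qed.

Lemma pm_eq_repr s : pm_eq (repr (psl2 s)) s.
Proof. by apply/psl2_eqP; rewrite psl2_surj. Qed.

Definition PSL2_one : PSL2 R := psl2 1%g.
Definition PSL2_mul g h : PSL2 R := psl2 (repr g * repr h)%g.
Definition PSL2_inv g : PSL2 R := psl2 (repr g)^-1%g.

Lemma PSL2_mulE s t : PSL2_mul (psl2 s) (psl2 t) = psl2 (s * t)%g.
Proof.
apply/psl2_eqP; rewrite /pm_eq /=.
by case: (pm_eq_repr s) => ->; case: (pm_eq_repr t) => ->;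
  rewrite ?mulNmx ?mulmxN ?opprK; [left|right|right|left].
Qed.

Lemma PSL2_invE s : PSL2_inv (psl2 s) = psl2 s^-1%g.
Proof.
apply/psl2_eqP; rewrite /pm_eq /=.
case: (pm_eq_repr s) => ->; [by left|right].
by rewrite -scaleN1r invmxZ ?unitmxZ ?unitrN1 ?SL2_unit // invrN1 scaleN1r.
Qed.

Lemma PSL2_mulA : associative PSL2_mul.
Proof.
move=> g h k; rewrite -(psl2_surj g) -(psl2_surj h) -(psl2_surj k).
move: (repr g) (repr h) (repr k) => s t u.
by rewrite (PSL2_mulE t u) (PSL2_mulE s (t * u)%g) (PSL2_mulE s t)
  (PSL2_mulE (s * t)%g u) mulgA.
Qed.

Lemma PSL2_mul1 : left_id PSL2_one PSL2_mul.
Proof. by move=> g; rewrite -(psl2_surj g) PSL2_mulE mul1g. Qed.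

Lemma PSL2_mulr1 : right_id PSL2_one PSL2_mul.
Proof. by move=> g; rewrite -(psl2_surj g) PSL2_mulE mulg1. Qed.

Lemma PSL2_Vmul : left_inverse PSL2_one PSL2_inv PSL2_mul.
Proof. by move=> g; rewrite -(psl2_surj g) PSL2_invE PSL2_mulE mulVg. Qed.

Lemma PSL2_mulV : right_inverse PSL2_one PSL2_inv PSL2_mul.
Proof. by move=> g; rewrite -(psl2_surj g) PSL2_invE PSL2_mulE mulgV. Qed.

HB.instance Definition _ := isGroup.Build (PSL2 R)
  PSL2_mulA PSL2_mul1 PSL2_mulr1 PSL2_Vmul PSL2_mulV.

Lemma psl2M s t : psl2 (s * t)%g = (psl2 s * psl2 t)%g.
Proof. exact/esym/PSL2_mulE. Qed.

Lemma psl2V s : psl2 s^-1%g = (psl2 s)^-1%g.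
Proof. exact/esym/PSL2_invE. Qed.

(* The regular functions on the algebraic group PSL_2 = SL_2 / {1, -1} are the
   polynomial functions on SL_2 that are invariant under A |-> - A. *)
Definition entries (A : 'M[R]_2) : 'I_(2 * 2) -> R := fun i => mxvec A 0 i.

Definition zariski_dense (H : set (PSL2 R)) : Prop :=
  forall P : mpoly.mpoly (2 * 2) R,
    (forall s, mpoly.meval (entries (- val s)) P =
               mpoly.meval (entries (val s)) P) ->
    (forall s, H (psl2 s) -> mpoly.meval (entries (val s)) P = 0) ->
    forall s, mpoly.meval (entries (val s)) P = 0.

End PSL2.

(** * The universal cover of PSL_2(R) *)

Section UniversalCover.
Context {R : realType}.
Implicit Types (s : SL2 R) (g : PSL2 R).

(* PSL_2(R) acts on the circle RP^1 = R / pi Z, where t stands for the line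
   spanned by (cos t, sin t). Its universal cover is the group of all lifts of
   these projective transformations to homeomorphisms of R; the kernel of the
   covering map consists of the translations by the multiples of pi. *)
Definition line_vec (t : R) : 'cV[R]_2 :=
  \col_i (if i == 0 then cos t else sin t).

Definition lifts_action g (F : R -> R) : Prop :=
  forall s, psl2 s = g ->
  forall t, exists c : R, val s *m line_vec t = c *: line_vec (F t).

Lemma line_vec_neq0 t : line_vec t != 0.
Proof.
apply/eqP => /colP e; have := cos2Dsin2 t.
have := e 0; rewrite !mxE /= => ->; have := e 1; rewrite !mxE /= => ->.
by rewrite expr0n /= addr0 => /eqP; rewrite eq_sym oner_eq0.
Qed.

Lemma lifts_actionP s (F : R -> R) :
  (forall t, exists c : R, val s *m line_vec t = c *: line_vec (F t)) ->
  lifts_action (psl2 s) F.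
Proof.
move=> H s' /psl2_eqP [] e t; have [c cE] := H t.
- by exists c; rewrite e.
- by exists (- c); rewrite e mulNmx cE scaleNr.
Qed.

Lemma lifts_action_one : lifts_action 1%g id.
Proof. by apply: lifts_actionP => t; exists 1; rewrite mul1mx scale1r. Qed.

Lemma lifts_action_mul g h F G :
  lifts_action g F -> lifts_action h G -> lifts_action (g * h)%g (F \o G).
Proof.
rewrite -(psl2_surj g) -(psl2_surj h) -psl2M => gF hG.
apply: lifts_actionP => t /=.
have [c cE] := hG _ erefl t; have [d dE] := gF _ erefl (G t).
by exists (c * d); rewrite -mulmxA cE -scalemxAr dE scalerA.
Qed.

Lemma lifts_action_inv g F G : cancel G F ->
  lifts_action g F -> lifts_action g^-1%g G.
Proof.
rewrite -(psl2_surj g) -psl2V => GK gF; apply: lifts_actionP => t /=.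
have [c] := gF _ erefl (G t); rewrite GK => cE.
have u := SL2_unit (repr g).
have c0 : c != 0.
  apply/eqP => c0; move: cE; rewrite c0 scale0r => /(congr1 (mulmx (invmx (val (repr g))))).
  by rewrite mulKmx // mulmx0 => /eqP; rewrite (negbTE (line_vec_neq0 _)).
exists c^-1; have -> : line_vec t = c^-1 *: (val (repr g) *m line_vec (G t)).
  by rewrite cE scalerA mulVf // scale1r.
by rewrite -scalemxAr mulKmx.
Qed.

Record psl2_tilde := PSL2Tilde {
  tilde_proj : PSL2 R;
  tilde_fun : R -> R;
  tilde_inv : R -> R;
  tilde_funK : cancel tilde_fun tilde_inv;
  tilde_invK : cancel tilde_inv tilde_fun;
  tilde_fun_continuous : continuous tilde_fun;
  tilde_inv_continuous : continuous tilde_inv;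
  tilde_lifts : lifts_action tilde_proj tilde_fun }.

HB.instance Definition _ := gen_eqMixin psl2_tilde.
HB.instance Definition _ := gen_choiceMixin psl2_tilde.

Lemma psl2_tilde_ext (x y : psl2_tilde) :
  tilde_proj x = tilde_proj y -> tilde_fun x =1 tilde_fun y -> x = y.
Proof.
case: x y => [p F F' FK F'K cF cF' pF] [q G G' GK G'K cG cG' qG] /= pq /funext FG.
have FG' : F' = G' by apply/funext => t; rewrite -[t in LHS]G'K -FG FK.
case: _ / pq in qG *; case: _ / FG in GK G'K cG qG *.
case: _ / FG' in GK G'K cG' *.
by congr PSL2Tilde; exact: Prop_irrelevance.
Qed.

Definition tilde_one : psl2_tilde :=
  PSL2Tilde (fun=> erefl) (fun=> erefl) (fun=> cvg_id) (fun=> cvg_id)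
    lifts_action_one.

Lemma continuous_fcomp (F G : R -> R) :
  continuous F -> continuous G -> continuous (F \o G).
Proof. by move=> cF cG t; apply: continuous_comp; [exact: cG|exact: cF]. Qed.

Definition tilde_mul (x y : psl2_tilde) : psl2_tilde :=
  PSL2Tilde
    (can_comp (tilde_funK x) (tilde_funK y))
    (can_comp (tilde_invK y) (tilde_invK x))
    (continuous_fcomp (@tilde_fun_continuous x) (@tilde_fun_continuous y))
    (continuous_fcomp (@tilde_inv_continuous y) (@tilde_inv_continuous x))
    (lifts_action_mul (@tilde_lifts x) (@tilde_lifts y)).

Definition tilde_opp (x : psl2_tilde) : psl2_tilde :=
  PSL2Tilde (tilde_invK x) (tilde_funK x)
    (@tilde_inv_continuous x) (@tilde_fun_continuous x)
    (lifts_action_inv (tilde_invK x) (@tilde_lifts x)).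

Lemma tilde_mulA : associative tilde_mul.
Proof. by move=> x y z; apply: psl2_tilde_ext; rewrite //= mulgA. Qed.
Lemma tilde_mul1 : left_id tilde_one tilde_mul.
Proof. by move=> x; apply: psl2_tilde_ext; rewrite //= mul1g. Qed.
Lemma tilde_mulr1 : right_id tilde_one tilde_mul.
Proof. by move=> x; apply: psl2_tilde_ext; rewrite //= mulg1. Qed.
Lemma tilde_Vmul : left_inverse tilde_one tilde_opp tilde_mul.
Proof.
move=> x; apply: psl2_tilde_ext => [|t]; first by rewrite /= mulVg.
by rewrite /= tilde_funK.
Qed.
Lemma tilde_mulV : right_inverse tilde_one tilde_opp tilde_mul.
Proof.
move=> x; apply: psl2_tilde_ext => [|t]; first by rewrite /= mulgV.
by rewrite /= tilde_invK.
Qed.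

HB.instance Definition _ := isGroup.Build psl2_tilde
  tilde_mulA tilde_mul1 tilde_mulr1 tilde_Vmul tilde_mulV.

End UniversalCover.
Arguments psl2_tilde : clear implicits.

(** * Representations and the moduli space *)

Definition rep (R : realType) : Type := UMagmaMorphism.type Gamma2 (PSL2 R).
Definition rep_hom (R : realType) (rho : rep R) :
  UMagmaMorphism.type Gamma2 (PSL2 R) := rho.
Coercion rep_hom : rep >-> UMagmaMorphism.type.

HB.instance Definition _ (R : realType) := gen_eqMixin (rep R).
HB.instance Definition _ (R : realType) := gen_choiceMixin (rep R).

Definition rep_coords (R : realType) (rho : rep R) :
    (PSL2 R * PSL2 R * PSL2 R * PSL2 R)%type :=
  (rho a1, rho b1, rho a2, rho b2).

(* Hom(Gamma_2, PSL_2(R)) as a subspace of PSL_2(R)^4. *)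
HB.instance Definition _ (R : realType) :=
  Topological.copy (rep R) (initial_topology (@rep_coords R)).

Definition non_elementary (R : realType) : set (rep R) :=
  [set rho | zariski_dense (range rho)].

(* eu(rho) = k, where k is identified with the translation by k pi. *)
Definition euler_class (R : realType) (rho : rep R) (k : int) : Prop :=
  exists x1 y1 x2 y2 : psl2_tilde R,
    [/\ tilde_proj x1 = rho a1, tilde_proj y1 = rho b1,
        tilde_proj x2 = rho a2, tilde_proj y2 = rho b2 &
        tilde_fun (surface_relator x1 y1 x2 y2) =
          (fun t => t + k%:~R * trigo.pi)].

Definition nerep (R : realType) : Type := set_type (@non_elementary R).
HB.instance Definition _ (R : realType) :=
  SubChoice.copy (nerep R) (set_type (@non_elementary R)).
HB.instance Definition _ (R : realType) :=
  Topological.copy (nerep R) (set_type (@non_elementary R)).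

Section Moduli.
Context {R : realType}.
Implicit Types rho sigma : nerep R.

Definition conj_eq rho sigma : Prop :=
  exists g : PSL2 R, forall x, val sigma x = (g * val rho x * g^-1)%g.

Lemma conj_eq_is_equiv :
  equiv_class_of (fun rho sigma => `[< conj_eq rho sigma >]).
Proof.
have sym rho sigma : conj_eq rho sigma -> conj_eq sigma rho.
  by move=> [g gP]; exists g^-1%g => x; rewrite gP invgK !mulgA mulVg mul1g mulgVK.
split=> [rho|rho sigma|sigma rho tau].
- by apply/asboolP; exists 1%g => x; rewrite mul1g invg1 mulg1.
- by apply/asboolP/asboolP => /sym.
- move=> /asboolP [g gP] /asboolP [h hP]; apply/asboolP; exists (h * g)%g => x.
  by rewrite hP gP invgM !mulgA.
Qed.
Definition conj_equiv := EquivRelPack conj_eq_is_equiv.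

End Moduli.

Definition moduli (R : realType) : Type :=
  quotient_topology {eq_quot @conj_equiv R}.
HB.instance Definition _ (R : realType) := Choice.on (moduli R).
HB.instance Definition _ (R : realType) := Quotient.on (moduli R).
HB.instance Definition _ (R : realType) := Topological.on (moduli R).

Section ModuliAction.
Context {R : realType}.
Implicit Types rho sigma : nerep R.

Definition rep_class rho : moduli R := \pi_(moduli R) rho.

Lemma rep_class_eqP rho sigma :
  rep_class rho = rep_class sigma <-> conj_eq rho sigma.
Proof.
have E : (rep_class rho = rep_class sigma) =
    (\pi_{eq_quot @conj_equiv R} rho = \pi_{eq_quot @conj_equiv R} sigma).
  by rewrite /rep_class unlock.
rewrite E; split=> [/eqP|st].
  by rewrite eqmodE => /asboolP.
by apply/eqP; rewrite eqmodE; apply/asboolP.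
Qed.

Definition comp_rep (rho : rep R) (phi : aut_plus) : rep R :=
  (rho \o phi : UMagmaMorphism.type Gamma2 (PSL2 R)).

Lemma non_elementary_comp rho (phi : aut_plus) :
  non_elementary (comp_rep (val rho) phi).
Proof.
have -> : non_elementary (comp_rep (val rho) phi) = non_elementary (val rho).
  rewrite /non_elementary /=; congr zariski_dense; apply/seteqP.
  split=> [_ [x _ <-]|_ [x _ <-]]; first by exists (phi x).
  by have [psi _ psiK] := aut_bij phi; exists (psi x); rewrite //= psiK.
exact: set_valP.
Qed.

Definition precomp rho (phi : aut_plus) : nerep R :=
  exist _ (comp_rep (val rho) phi) (mem_set (@non_elementary_comp rho phi)).

Definition Mod_act (x : moduli R) (m : Mod) : moduli R :=
  rep_class (precomp (repr x) (repr m)).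

Lemma Mod_actE rho (phi : aut_plus) :
  Mod_act (rep_class rho) (\pi_Mod phi) = rep_class (precomp rho phi).
Proof.
have /rep_class_eqP [g gP] : rep_class rho = rep_class (repr (rep_class rho)).
  by rewrite /rep_class reprK.
have /Mod_eqP [c cP] : \pi_Mod phi = \pi_Mod (repr (\pi_Mod phi)).
  by rewrite reprK.
apply/esym/rep_class_eqP; exists (g * val rho c)%g => x /=.
by rewrite gP cP !gmulfM gmulfV invgM !mulgA.
Qed.

Definition moduli0_set : set (moduli R) :=
  [set x | exists2 rho, rep_class rho = x & euler_class (val rho) 0].

End ModuliAction.

Definition moduli0 (R : realType) : Type := set_type (@moduli0_set R).
HB.instance Definition _ (R : realType) :=
  SubChoice.copy (moduli0 R) (set_type (@moduli0_set R)).
HB.instance Definition _ (R : realType) :=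
  Topological.copy (moduli0 R) (set_type (@moduli0_set R)).

(** * The manifold structure of the moduli space and its null sets *)

Section Manifold.
Context {R : realType}.

(* C^infinity functions on an open subset U of a finite dimensional space. *)
Definition smooth_on (E : normedModType R) (U : set E) (f : E -> R) : Prop :=
  forall (vs : seq E) (x : E), U x ->
    differentiable (foldr (fun v (g : E -> R) => 'D_v g) f vs) x.

Definition R6 : normedModType R := (R * R * R * R * R * R)%type.
Definition M4 : normedModType R :=
  ('M[R]_2 * 'M[R]_2 * 'M[R]_2 * 'M[R]_2)%type.

Definition lebesgue6 : set R6 -> \bar R :=
  let l := @lebesgue_measure R in (l \x l \x l \x l \x l \x l)%E.

Definition lifts_rep (A : M4) (rho : rep R) : Prop :=
  exists s1 t1 s2 t2 : SL2 R,
    A = (val s1, val t1, val s2, val t2) /\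
    rep_coords rho = (psl2 s1, psl2 t1, psl2 s2, psl2 t2).

(* Smooth functions on an open subset V of the manifold of non-elementary
   representations: SL_2(R)^4 is a covering of PSL_2(R)^4, and the lifts of
   non-elementary representations form a submanifold of M_2(R)^4. *)
Definition smooth_nerep (V : set (nerep R)) (h : nerep R -> R) : Prop :=
  forall rho A, V rho -> lifts_rep A (val rho) ->
  exists (W : set M4) (F : M4 -> R),
    [/\ open W, W A, smooth_on W F &
      forall sigma B, V sigma -> W B -> lifts_rep B (val sigma) ->
        h sigma = F B].

(* The quotient structure, for which the projection is a submersion. *)
Definition smooth_moduli (V : set (moduli R)) (h : moduli R -> R) : Prop :=
  smooth_nerep (rep_class @^-1` V) (h \o rep_class).

Definition smooth_chart (U : set (moduli R)) (x : moduli R -> R6) : Prop :=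
  [/\ open U,
      set_inj U x,
      (forall V, V `<=` U -> (open V <-> open (x @` V))) &
      (forall (O : set R6) (f : R6 -> R), O `<=` x @` U -> open O ->
        (smooth_on O f <-> smooth_moduli (U `&` x @^-1` O) (f \o x)))].

Definition null_moduli (A : set (moduli R)) : Prop :=
  forall U x, smooth_chart U x -> lebesgue6.-negligible (x @` (A `&` U)).

Definition null_moduli0 (A : set (moduli0 R)) : Prop :=
  null_moduli (set_val @` A).

End Manifold.
Arguments R6 : clear implicits.
Arguments M4 : clear implicits.

(** * Ergodicity *)

(* The measurable functions are the Borel ones. The set N consists of the null
   sets, and act x g y means that g sends x to y. *)
Definition ergodic (R : realType) (T : topologicalType) (N : set (set T))
    (G : Type) (act : T -> G -> T -> Prop) : Prop :=
  forall f : T -> R,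
    (forall B : set R, measurable B -> <<s @open T >> (f @^-1` B)) ->
    (forall x g y, act x g y -> f y = f x) ->
    exists c : R, N [set x | f x <> c].

Definition Mod_act0 (R : realType) (x : moduli0 R) (m : Mod) (y : moduli0 R) :
  Prop := set_val y = Mod_act (set_val x) m.

(* Main.v *)
(* For two matrices A, B of determinant 1 put g = AB - BA; det g does not depend
   on the signs of A and B. Consider the classes [rho] such that det g > 0 for
   lifts A, B of rho(psi a1), rho(psi b1), where psi is some automorphism of
   Gamma_2. They form an open invariant set, which has interior points of Euler
   class 0 (with psi = id). So does its complement: let rho0 be the
   representation (A, B, B, A) with A = [[2,1],[1,1]], B = [[1,-1],[-2,3]]. The
   matrix g intertwines rho o psi with rho o psi o h, where the endomorphism h,
   the hyperelliptic involution, acts by -1 on the abelianization of Gamma_2.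
   Along a segment from rho0 to a nearby rho, in coordinates where the matrices
   are polynomial up to positive factors, divide g by the common factor of its
   entries. The quotient never vanishes and intertwines irreducible
   representations, hence it is invertible and its determinant keeps its sign.
   If det g > 0 at rho, then rho0 and its twist by psi o h o psi^-1 are conjugate
   by a real matrix of positive determinant. As the image of rho0 spans the ring
   M_2(Z), this matrix is a multiple of an element of SL_2(Z), so the conjugation
   preserves the homomorphism from SL_2(Z) to Z/3. But the twist changes its
   sign, and it is nontrivial on B. *)

(* The sign in question compares a trace with 2, since [\det g = 2 - \tr (A B A^-1 B^-1)]. The
   obstacle is uniformity in [psi]: the complement must contain one ball on which [\det g <= 0] for
   infinitely many [psi] at once, and continuity at [rho0] gives a ball for one [psi] only. The
   segment argument is uniform because it uses nothing but irreducibility on the ball, while the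
   arithmetic of [rho0] excludes a positive intertwiner for every [psi]. The common factor has to go
   because [g] vanishes whenever the images of [psi a1] and [psi b1] commute. Positivity is
   essential: conjugation by an integral matrix of determinant -1 does change the sign of the
   character of order 3, and for [psi = id] the bracket at [rho0] has determinant -1.

   Null sets are tested in smooth charts, so actual charts are needed inside both sets. They come
   from an explicit six-parameter slice of normalized quadruples, around points with [A2 = B1] and
   [B2 = A1]; there the two commutators cancel, also in the universal cover, which makes the Euler
   class 0. *)
Require Import Defs.
From HB Require Import structures.
From mathcomp Require Import all_boot all_order all_algebra.
From mathcomp Require Import all_classical all_reals all_analysis.
From mathcomp Require Import ring lra.
From mathcomp Require mpoly.
Import numFieldNormedType.Exports.

Set Implicit Arguments.
Unset Strict Implicit.
Unset Printing Implicit Defensive.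

Import Order.TTheory GRing.Theory Num.Theory.

Local Open Scope quotient_scope.
Local Open Scope classical_set_scope.
Local Open Scope ring_scope.


(** * Smooth functions on normed spaces *)

Section SmoothFunctions.
Context {R : realType}.
Implicit Types (E : normedModType R).

Definition iterD E (f : E -> R) (vs : seq E) : E -> R :=
  foldr (fun v (g : E -> R) => 'D_v g) f vs.

(** In [smooth_on] the number of directions is unbounded; bounding it by [n] makes the closure
    properties provable by induction. *)
Definition Cn (n : nat) E (U : set E) (f : E -> R) : Prop :=
  forall vs, (size vs <= n)%N -> forall x, U x -> differentiable (iterD f vs) x.

Lemma smooth_onP E (U : set E) (f : E -> R) :
  smooth_on U f <-> forall n, Cn n U f.
Proof.
split=> [sf n vs _ x Ux|sf vs x Ux]; first exact: sf.
exact: (sf (size vs) vs (leqnn _) x Ux).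
Qed.

Lemma iterD_rcons E (f : E -> R) vs v : iterD f (rcons vs v) = iterD ('D_v f) vs.
Proof. by rewrite /iterD foldr_rcons. Qed.

(** [foldr] applies the last direction first, so splitting the list at its end exposes the innermost
    derivative, and the induction continues with ['D_v f] in place of [f]. *)
Lemma CnS n E (U : set E) (f : E -> R) :
  Cn n.+1 U f <->
  (forall x, U x -> differentiable f x) /\ (forall v, Cn n U ('D_v f)).
Proof.
split=> [Cf|[df Cf]].
  split=> [x Ux|v vs sz x Ux]; first exact: (Cf [::]).
  by rewrite -iterD_rcons; apply: Cf => //; rewrite size_rcons.
move=> vs; case/lastP: vs => [_ x Ux|vs v]; first exact: df.
by rewrite size_rcons iterD_rcons => sz x Ux; exact: Cf.
Qed.

Lemma Cn0 E (U : set E) (f : E -> R) :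
  Cn 0 U f <-> forall x, U x -> differentiable f x.
Proof.
split=> [Cf x Ux|df [|//] _ x Ux]; first exact: (Cf [::]).
exact: df.
Qed.

Lemma CnW n E (U : set E) (f : E -> R) : Cn n.+1 U f -> Cn n U f.
Proof. by move=> Cf vs sz; apply: Cf; rewrite ltnW. Qed.

Lemma iterD_near E (U : set E) (f g : E -> R) vs : open U ->
  (forall x, U x -> f x = g x) -> forall x, U x -> iterD f vs x = iterD g vs x.
Proof.
move=> oU fg; elim: vs => [|v vs IH] x Ux /=; first exact: fg.
apply: near_eq_derive; near=> y; apply: IH; near: y.
exact: open_nbhs_nbhs.
Unshelve. all: by end_near. Qed.

Lemma near_differentiable E (E' : normedModType R) (f g : E -> E') x :
  {near x, f =1 g} -> differentiable f x -> differentiable g x.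
Proof.
move=> fg df; have fgx : f x = g x by exact: nbhs_singleton fg.
have fg0 : \forall y \near (0 : E), f (y + x) = g (y + x).
  by move: fg; rewrite (near_shift 0) subr0.
have [cd /eqaddoP ed] := (diff_locallyP x f).1 df.
have edg : g \o shift x = cst (g x) + 'd f x +o_ 0 id.
  apply/eqaddoP => eps eps0; have {}ed := ed _ eps0.
  near=> y.
  have -> : (g \o shift x - (cst (g x) + 'd f x)) y =
            (f \o shift x - (cst (f x) + 'd f x)) y.
    by rewrite !fctE /= -fgx; congr (_ - _); apply/esym; near: y.
  by near: y.
have e : 'd g x = 'd f x :> (E -> E') by exact: diff_unique.
by apply/diff_locallyP; rewrite e.
Unshelve. all: by end_near. Qed.

Lemma eq_Cn n E (U : set E) (f g : E -> R) : open U ->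
  (forall x, U x -> f x = g x) -> Cn n U f -> Cn n U g.
Proof.
move=> oU fg Cf vs sz x Ux.
have e : \forall y \near x, iterD f vs y = iterD g vs y.
  near=> y; apply: (iterD_near vs oU fg); near: y; exact: open_nbhs_nbhs.
exact: near_differentiable e (Cf vs sz x Ux).
Unshelve. all: by end_near. Qed.

(** The formula [df] is required on [U] only, because rules such as that of Leibniz presuppose
    differentiability, known only there. *)
Lemma CnS_near n E (U : set E) (f : E -> R) (df : E -> E -> R) : open U ->
  (forall x, U x -> differentiable f x) ->
  (forall v x, U x -> 'D_v f x = df v x) -> (forall v, Cn n U (df v)) ->
  Cn n.+1 U f.
Proof.
move=> oU dif e Cdf; apply/CnS; split=> // v.
by apply: (eq_Cn oU _ (Cdf v)) => x Ux; rewrite e.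
Qed.

Lemma Cn_cst n E (U : set E) (k : R) : Cn n U (fun=> k).
Proof.
elim: n k => [|n IH] k; first by apply/Cn0 => x _; exact: differentiable_cst.
apply/CnS; split=> [x _|v]; first exact: differentiable_cst.
rewrite (_ : 'D_v _ = fun=> 0) //.
by apply/funext => x; rewrite derive_cst.
Qed.

Lemma CnD n E (U : set E) (f g : E -> R) : open U ->
  Cn n U f -> Cn n U g -> Cn n U (fun x => f x + g x).
Proof.
move=> oU; elim: n f g => [|n IH] f g.
  move=> /Cn0 df /Cn0 dg; apply/Cn0 => x Ux.
  by apply: differentiableD; [exact: df|exact: dg].
move=> /CnS[df Cf] /CnS[dg Cg].
apply: (CnS_near (df := fun v x => 'D_v f x + 'D_v g x)) => //.
- by move=> x Ux; apply: differentiableD; [exact: df|exact: dg].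
- move=> v x Ux.
  by rewrite deriveD //; apply: diff_derivable; [exact: df|exact: dg].
- by move=> v; exact: IH.
Qed.

Lemma CnM n E (U : set E) (f g : E -> R) : open U ->
  Cn n U f -> Cn n U g -> Cn n U (fun x => f x * g x).
Proof.
move=> oU; elim: n f g => [|n IH] f g.
  move=> /Cn0 df /Cn0 dg; apply/Cn0 => x Ux.
  by apply: differentiableM; [exact: df|exact: dg].
(* The Leibniz rule keeps [f] and [g] themselves next to their derivatives, so the induction
   hypothesis is needed for both. *)
move=> Cf1 Cg1; have Cf0 := CnW Cf1; have Cg0 := CnW Cg1.
move/CnS: Cf1 => [df Cf]; move/CnS: Cg1 => [dg Cg].
apply: (CnS_near (df := fun v x => f x * 'D_v g x + g x * 'D_v f x)) => //.
- by move=> x Ux; apply: differentiableM; [exact: df|exact: dg].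
- move=> v x Ux.
  by rewrite deriveM //; apply: diff_derivable; [exact: df|exact: dg].
- by move=> v; apply: CnD => //; exact: IH.
Qed.

Lemma Cn_sum n E (U : set E) (I : eqType) (s : seq I) (f : I -> E -> R) :
  open U -> (forall i, i \in s -> Cn n U (f i)) ->
  Cn n U (fun x => \sum_(i <- s) f i x).
Proof.
move=> oU; elim: s => [|i s IH] Cf.
  apply: (eq_Cn (f := fun=> 0)) => //; last exact: Cn_cst.
  by move=> x _; rewrite big_nil.
apply: (eq_Cn (f := fun x => f i x + \sum_(j <- s) f j x)) => //.
  by move=> x _; rewrite big_cons.
apply: CnD => //; first by apply: Cf; rewrite mem_head.
by apply: IH => j js; apply: Cf; rewrite in_cons js orbT.
Qed.

(* A map between normed spaces is represented by finitely many real-valued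
   coordinates with constant direction vectors, so that the chain rule needs
   no basis of the target. *)
Definition expansion E E' : Type := seq ((E -> R) * E').

Definition expands E E' (U : set E) (G : E -> E') (s : expansion E E') : Prop :=
  forall x, U x -> G x = \sum_(p <- s) p.1 x *: p.2.

Lemma expands_is_diff E E' (U : set E) (G : E -> E') (s : expansion E E') x :
  open U -> expands U G s ->
  (forall p, p \in s -> forall x, U x -> differentiable p.1 x) -> U x ->
  differentiable G x /\
  forall v, 'D_v G x = \sum_(p <- s) 'D_v p.1 x *: p.2.
Proof.
move=> oU eG ds Ux.
have key : differentiable (fun y => \sum_(p <- s) p.1 y *: p.2) x /\
    forall v, 'D_v (fun y => \sum_(p <- s) p.1 y *: p.2) x =
              \sum_(p <- s) 'D_v p.1 x *: p.2.
  elim: s ds {eG} => [|p s IH] ds.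
    rewrite (_ : (fun _ => _) = cst 0); last first.
      by apply/funext => y; rewrite big_nil.
    split; first exact: differentiable_cst.
    by move=> v; rewrite derive_cst big_nil.
  have [q qs|dI eI] := IH; first by apply: ds; rewrite in_cons qs orbT.
  have dp : differentiable p.1 x by apply: ds => //; rewrite mem_head.
  have dZ : differentiable (fun y => p.1 y *: p.2) x by exact: differentiableZl.
  rewrite (_ : (fun _ => _) = (fun y => p.1 y *: p.2) +
      (fun y => \sum_(q <- s) q.1 y *: q.2)); last first.
    by apply/funext => y; rewrite big_cons.
  split; first exact: differentiableD.
  move=> v; rewrite deriveD; [|exact: diff_derivable..].
  by rewrite eI big_cons deriveE // diffZl // [in RHS]deriveE.
have e : \forall y \near x, \sum_(p <- s) p.1 y *: p.2 = G y.
  by near=> y; rewrite eG //; near: y; exact: open_nbhs_nbhs.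
split.
  exact: near_differentiable e key.1.
by move=> v; rewrite -key.2; apply: near_eq_derive; near=> y; apply/esym; near: y.
Unshelve. all: by end_near. Qed.

(** The vectors [p.2] being constant, the chain rule produces the functions ['D_(p.2) f \o G], which
    are again compositions with [G], of lower order. *)
Lemma Cn_comp n E E' (U : set E) (U' : set E') (G : E -> E')
    (s : expansion E E') (f : E' -> R) : open U ->
  expands U G s -> (forall p, p \in s -> Cn n U p.1) ->
  (forall x, U x -> U' (G x)) -> Cn n U' f -> Cn n U (f \o G).
Proof.
move=> oU eG; elim: n f => [|n IH] f Cs GU.
  move=> /Cn0 df; apply/Cn0 => x Ux.
  apply: (@differentiable_comp _ E E' R); last exact/df/GU.
  have ds p : p \in s -> forall x, U x -> differentiable p.1 x.
    by move=> /Cs /Cn0.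
  exact: (expands_is_diff oU eG ds Ux).1.
move=> /CnS[df Cf].
have ds p : p \in s -> forall x, U x -> differentiable p.1 x.
  by move=> /Cs /CnS[].
pose df' v x := \sum_(p <- s) 'D_v p.1 x * 'D_(p.2) f (G x).
apply: (CnS_near (df := df')) => //.
- move=> x Ux; apply: differentiable_comp; last exact/df/GU.
  exact: (expands_is_diff oU eG ds Ux).1.
- move=> v x Ux; have [dG eD] := expands_is_diff oU eG ds Ux.
  have dfG := df _ (GU _ Ux).
  rewrite deriveE; last exact: differentiable_comp.
  rewrite diff_comp //= -(deriveE _ dG) eD linear_sum /df'.
  by apply: eq_bigr => p _; rewrite linearZ /= -deriveE.
- move=> v; apply: Cn_sum => // p ps; apply: CnM => //.
    by have /CnS[] := Cs _ ps.
  exact: (IH _ (fun q qs => CnW (Cs q qs)) GU (Cf _)).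
Qed.

Lemma open_neq0 : open [set x : R | x != 0].
Proof.
rewrite (_ : [set x | _] = ~` [set 0 : R]).
  by apply: closed_openC; exact: closed_eq.
by apply/seteqP; split=> x /= /eqP.
Qed.

Lemma open_gt0 : open [set x : R | 0 < x].
Proof. exact: open_gt. Qed.

(** The derivative is a polynomial in the function itself, so the induction feeds on its own
    statement; [Cn_sqrt] works alike. *)
Lemma Cn_inv n : Cn n [set x : R | x != 0] (@GRing.inv R).
Proof.
elim: n => [|n IH].
  by apply/Cn0 => x /= x0; exact: differentiable_Rinv.
apply: (CnS_near (E := R) (df := fun v x => - v * (x^-1 * x^-1))).
- exact: open_neq0.
- by move=> x /= x0; exact: differentiable_Rinv.
- move=> v x /= x0; rewrite deriveE; last exact: differentiable_Rinv.
  rewrite diff_Rinv //= /GRing.scale /= expr2 invfM.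
  by rewrite mulNr mulrC -mulNr.
- move=> v; have C1 := @Cn_cst n _ [set x : R | x != 0] (- v).
  exact: CnM open_neq0 C1 (CnM open_neq0 IH IH).
Qed.

Lemma expands_real E (U : set E) (g : E -> R) :
  expands U g [:: (g, 1 : R)].
Proof. by move=> x _; rewrite big_seq1 /= /GRing.scale /= mulr1. Qed.

Lemma CnV n E (U : set E) (g : E -> R) : open U ->
  Cn n U g -> (forall x, U x -> g x != 0) -> Cn n U (fun x => (g x)^-1).
Proof.
move=> oU Cg g0.
have Cp p : p \in [:: (g, 1 : R)] -> Cn n U p.1 by rewrite inE => /eqP ->.
exact: (@Cn_comp n E R U [set x | x != 0] g _ _ oU (@expands_real _ _ _) Cp g0
  (@Cn_inv n)).
Qed.

Lemma differentiable_sqrt (x : R) : 0 < x -> differentiable (@Num.sqrt R) x.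
Proof. by move=> x0; apply/derivable1_diffP; have [] := is_derive1_sqrt x0. Qed.

Lemma Cn_sqrt n : Cn n [set x : R | 0 < x] (@Num.sqrt R).
Proof.
elim: n => [|n IH].
  by apply/Cn0 => x /= x0; exact: differentiable_sqrt.
apply: (CnS_near (E := R) (df := fun v x => v * (2 * Num.sqrt x)^-1)).
- exact: open_gt0.
- by move=> x /= x0; exact: differentiable_sqrt.
- move=> v x /= x0; rewrite deriveE; last exact: differentiable_sqrt.
  rewrite -[v in LHS]mulr1 linearZ /= -deriveE; last exact: differentiable_sqrt.
  by rewrite derive_sqrt.
- move=> v; have C1 := @Cn_cst n _ [set x : R | 0 < x].
  apply: CnM open_gt0 (C1 v) (CnV open_gt0 (CnM open_gt0 (C1 2) IH) _).
  by move=> x /= x0; rewrite mulf_neq0 // gt_eqF // sqrtr_gt0.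
Qed.

Lemma Cn_linear n E (U : set E) (f : {linear E -> R}) : open U ->
  continuous f -> Cn n U f.
Proof.
move=> oU cf; case: n => [|n].
  by apply/Cn0 => x _; exact: linear_differentiable.
apply: (CnS_near (df := fun v _ => f v)) => //.
- by move=> x _; exact: linear_differentiable.
- move=> v x _; rewrite deriveE; last exact: linear_differentiable.
  by rewrite diff_lin.
- by move=> v; exact: Cn_cst.
Qed.

(** * Closure properties of smooth functions and smooth maps *)

Section SmoothOn.
Context {E : normedModType R} (U : set E) (oU : open U).
Implicit Types f g : E -> R.

Lemma smooth_cst (k : R) : smooth_on U (fun=> k).
Proof. by apply/smooth_onP => n; exact: Cn_cst. Qed.

Lemma smoothD f g :
  smooth_on U f -> smooth_on U g -> smooth_on U (fun x => f x + g x).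
Proof.
by move=> /smooth_onP sf /smooth_onP sg; apply/smooth_onP => n; exact: CnD.
Qed.

Lemma smoothM f g :
  smooth_on U f -> smooth_on U g -> smooth_on U (fun x => f x * g x).
Proof.
by move=> /smooth_onP sf /smooth_onP sg; apply/smooth_onP => n; exact: CnM.
Qed.

Lemma smoothN f : smooth_on U f -> smooth_on U (fun x => - f x).
Proof.
move=> sf; rewrite (_ : (fun _ => _) = fun x => -1 * f x).
  by apply: smoothM => //; exact: smooth_cst.
by apply/funext => x; rewrite mulN1r.
Qed.

Lemma smoothB f g :
  smooth_on U f -> smooth_on U g -> smooth_on U (fun x => f x - g x).
Proof. by move=> sf sg; apply: smoothD => //; exact: smoothN. Qed.

Lemma smoothV f : smooth_on U f -> (forall x, U x -> f x != 0) ->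
  smooth_on U (fun x => (f x)^-1).
Proof.
by move=> /smooth_onP sf f0; apply/smooth_onP => n; exact: CnV.
Qed.

Lemma smooth_div f g : smooth_on U f -> smooth_on U g ->
  (forall x, U x -> g x != 0) -> smooth_on U (fun x => f x / g x).
Proof. by move=> sf sg g0; apply: smoothM => //; exact: smoothV. Qed.

Lemma smooth_sqrt f : smooth_on U f -> (forall x, U x -> 0 < f x) ->
  smooth_on U (fun x => Num.sqrt (f x)).
Proof.
move=> /smooth_onP sf f0; apply/smooth_onP => n.
have Cp p : p \in [:: (f, 1 : R)] -> Cn n U p.1 by rewrite inE => /eqP ->.
exact: (@Cn_comp n E R U [set x | 0 < x] f _ _ oU (@expands_real _ _ _) Cp f0
  (@Cn_sqrt n)).
Qed.

Lemma eq_smooth f g :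
  (forall x, U x -> f x = g x) -> smooth_on U f -> smooth_on U g.
Proof.
by move=> fg /smooth_onP sf; apply/smooth_onP => n; exact: eq_Cn (sf n).
Qed.

Lemma smooth_continuous f x : smooth_on U f -> U x -> {for x, continuous f}.
Proof.
by move=> sf Ux; apply: differentiable_continuous; exact: (sf [::]).
Qed.

Definition smooth_map (E' : normedModType R) (G : E -> E') : Prop :=
  exists2 s : expansion E E', expands U G s &
    forall p, p \in s -> smooth_on U p.1.

Lemma smooth_map_real f : smooth_on U f -> smooth_map f.
Proof.
move=> sf; exists [:: (f, 1 : R)]; first exact: expands_real.
by move=> p; rewrite inE => /eqP ->.
Qed.

Lemma smooth_map_pair (E1 E2 : normedModType R) (G1 : E -> E1) (G2 : E -> E2) :
  smooth_map G1 -> smooth_map G2 -> smooth_map (fun x => (G1 x, G2 x)).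
Proof.
move=> [s1 e1 S1] [s2 e2 S2].
exists ([seq (p.1, (p.2, 0)) | p <- s1] ++ [seq (p.1, (0, p.2)) | p <- s2]).
  move=> x Ux; rewrite big_cat !big_map e1 // e2 //=.
  have p1 (s : expansion E E1) :
      \sum_(p <- s) p.1 x *: (p.2, 0 : E2) = (\sum_(p <- s) p.1 x *: p.2, 0).
    elim: s => [|p s IH]; first by rewrite !big_nil.
    by rewrite !big_cons IH; congr pair; rewrite /= ?scaler0 ?addr0.
  have p2 (s : expansion E E2) :
      \sum_(p <- s) p.1 x *: (0 : E1, p.2) = (0, \sum_(p <- s) p.1 x *: p.2).
    elim: s => [|p s IH]; first by rewrite !big_nil.
    by rewrite !big_cons IH; congr pair; rewrite /= ?scaler0 ?addr0.
  by rewrite p1 p2; congr pair; rewrite /= ?addr0 ?add0r.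
by move=> p; rewrite mem_cat => /orP[] /mapP[q qs ->]; [exact: S1|exact: S2].
Qed.

Lemma smooth_map_matrix (m n : nat) (G : E -> 'M[R]_(m.+1, n.+1)) :
  (forall i j, smooth_on U (fun x => G x i j)) -> smooth_map G.
Proof.
move=> sG.
exists [seq (fun x => G x ij.1 ij.2, delta_mx ij.1 ij.2)
        | ij : 'I_m.+1 * 'I_n.+1].
  move=> x _; rewrite big_map [LHS]matrix_sum_delta pair_bigA /=.
  by rewrite big_enum.
by move=> p /mapP[ij _ ->]; exact: sG.
Qed.

Lemma smooth_comp (E' : normedModType R) (U' : set E') (G : E -> E')
    (f : E' -> R) :
  smooth_map G -> (forall x, U x -> U' (G x)) -> smooth_on U' f ->
  smooth_on U (f \o G).
Proof.
move=> [s eG sG] GU /smooth_onP sf; apply/smooth_onP => n.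
by apply: (Cn_comp oU eG _ GU (sf n)) => p /sG /smooth_onP.
Qed.

Lemma smooth_map_continuous (E' : normedModType R) (G : E -> E') x :
  smooth_map G -> U x -> {for x, continuous G}.
Proof.
move=> [s eG sG] Ux; apply: differentiable_continuous.
have ds p : p \in s -> forall x, U x -> differentiable p.1 x.
  by move=> ps y Uy; exact: (sG _ ps [::]).
exact: (expands_is_diff oU eG ds Ux).1.
Qed.

End SmoothOn.

Lemma smooth_linear E (U : set E) (f : {linear E -> R}) : open U ->
  continuous f -> smooth_on U f.
Proof. by move=> oU cf; apply/smooth_onP => n; exact: Cn_linear. Qed.

End SmoothFunctions.

(** * Two by two matrices *)

Section Mx2.
Context {K : comNzRingType}.
Implicit Types (a b c d : K) (A B : 'M[K]_2).

Definition mx2 a b c d : 'M[K]_2 :=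
  \matrix_(i, j) if i == 0 then (if j == 0 then a else b)
                 else (if j == 0 then c else d).

Lemma mx2_00 a b c d : mx2 a b c d 0 0 = a. Proof. by rewrite mxE. Qed.
Lemma mx2_01 a b c d : mx2 a b c d 0 1 = b. Proof. by rewrite mxE. Qed.
Lemma mx2_10 a b c d : mx2 a b c d 1 0 = c. Proof. by rewrite mxE. Qed.
Lemma mx2_11 a b c d : mx2 a b c d 1 1 = d. Proof. by rewrite mxE. Qed.
Definition mx2E := (mx2_00, mx2_01, mx2_10, mx2_11).

Lemma ord2P (i : 'I_2) : i = 0 \/ i = 1.
Proof. by case: i => -[|[|//]] ?; [left|right]; apply/val_inj. Qed.

Lemma mx2_eta A : A = mx2 (A 0 0) (A 0 1) (A 1 0) (A 1 1).
Proof.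
by apply/matrixP => i j; rewrite mxE; case: (ord2P i) => ->; case: (ord2P j) => ->.
Qed.

Lemma eq_mx2 A B : A 0 0 = B 0 0 -> A 0 1 = B 0 1 -> A 1 0 = B 1 0 ->
  A 1 1 = B 1 1 -> A = B.
Proof. by move=> e1 e2 e3 e4; rewrite (mx2_eta A) e1 e2 e3 e4 -mx2_eta. Qed.

Lemma mulmx2E A B i j : (A *m B) i j = A i 0 * B 0 j + A i 1 * B 1 j.
Proof. by rewrite mxE big_ord_recl big_ord1 (_ : lift _ _ = 1) //; apply/val_inj. Qed.

Lemma det_mx2E A : \det A = A 0 0 * A 1 1 - A 0 1 * A 1 0.
Proof.
rewrite (expand_det_row _ 0) big_ord_recl big_ord1 (_ : lift _ _ = 1);
  last by apply/val_inj.
rewrite /cofactor !det_mx11 !mxE /= expr0 mul1r.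
rewrite (_ : lift 0 0 = 1); last by apply/val_inj.
rewrite (_ : lift 1 0 = 0); last by apply/val_inj.
rewrite /= ; ring.
Qed.

Lemma tr_mx2E A : \tr A = A 0 0 + A 1 1.
Proof.
by rewrite /mxtrace big_ord_recl big_ord1 (_ : lift _ _ = 1) //; apply/val_inj.
Qed.

Lemma scalar_mx2 a : a%:M = mx2 a 0 0 a.
Proof. by apply: eq_mx2; rewrite !mxE. Qed.

Lemma mulmx_mx2 a b c d a' b' c' d' : mx2 a b c d *m mx2 a' b' c' d' =
  mx2 (a * a' + b * c') (a * b' + b * d') (c * a' + d * c') (c * b' + d * d').
Proof. by apply: eq_mx2; rewrite mulmx2E !mx2E. Qed.

Lemma det_mx2 a b c d : \det (mx2 a b c d) = a * d - b * c.
Proof. by rewrite det_mx2E !mx2E. Qed.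

Lemma tr_mx2 a b c d : \tr (mx2 a b c d) = a + d.
Proof. by rewrite tr_mx2E !mx2E. Qed.

Lemma addmx_mx2 a b c d a' b' c' d' :
  mx2 a b c d + mx2 a' b' c' d' = mx2 (a + a') (b + b') (c + c') (d + d').
Proof. by apply: eq_mx2; rewrite mxE !mx2E. Qed.

Lemma oppmx_mx2 a b c d : - mx2 a b c d = mx2 (- a) (- b) (- c) (- d).
Proof. by apply: eq_mx2; rewrite mxE !mx2E. Qed.

Lemma scalemx_mx2 k a b c d : k *: mx2 a b c d = mx2 (k * a) (k * b) (k * c) (k * d).
Proof. by apply: eq_mx2; rewrite mxE !mx2E. Qed.

(** The adjugate stands in for the inverse: they agree in determinant 1, and the adjugate exists
    over [int] and over polynomials and commutes with ring morphisms. *)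
Definition adj2 A : 'M[K]_2 := mx2 (A 1 1) (- A 0 1) (- A 1 0) (A 0 0).

Lemma adj2_mx2 a b c d : adj2 (mx2 a b c d) = mx2 d (- b) (- c) a.
Proof. by rewrite /adj2 !mx2E. Qed.

Definition mx2_simpl := (mulmx_mx2, addmx_mx2, oppmx_mx2, scalemx_mx2, adj2_mx2,
  scalar_mx2, det_mx2, tr_mx2).

Lemma mulmx_adj2 A : A *m adj2 A = (\det A)%:M.
Proof. by rewrite (mx2_eta A) !mx2_simpl; congr mx2; ring. Qed.

Lemma mul_adj2mx A : adj2 A *m A = (\det A)%:M.
Proof. by rewrite (mx2_eta A) !mx2_simpl; congr mx2; ring. Qed.

Lemma adj2M A B : adj2 (A *m B) = adj2 B *m adj2 A.
Proof.
by rewrite (mx2_eta A) (mx2_eta B) !mx2_simpl; congr mx2; ring.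
Qed.

Lemma adj2K : involutive adj2.
Proof. by move=> A; rewrite (mx2_eta A) !mx2_simpl !opprK. Qed.

Lemma det_adj2 A : \det (adj2 A) = \det A.
Proof. by rewrite (mx2_eta A) !mx2_simpl; ring. Qed.

Lemma adj2Z k A : adj2 (k *: A) = k *: adj2 A.
Proof. by rewrite (mx2_eta A) !mx2_simpl; congr mx2; ring. Qed.

(* Cayley-Hamilton *)
Lemma adj2E A : adj2 A = (\tr A)%:M - A.
Proof. by rewrite (mx2_eta A) !mx2_simpl; congr mx2; ring. Qed.

Definition brk A B : 'M[K]_2 := A *m B - B *m A.

(** By Cayley-Hamilton [A + adj2 A] is the scalar [\tr A], whence both sides equal
    [B - adj2 A *m B *m A]. *)
Lemma brk_invl A B : \det A = 1 -> brk A B *m A = adj2 A *m brk A B.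
Proof.
move=> dA; rewrite /brk mulmxBl mulmxBr !mulmxA mul_adj2mx dA mul1mx adj2E.
rewrite !mulmxBl mul_scalar_mx.
have /(congr1 (mulmx B)) : A *m A = (\tr A) *: A - 1%:M.
  apply/eqP; rewrite eq_sym subr_eq addrC -subr_eq -mul_scalar_mx -mulmxBl -adj2E.
  by rewrite mul_adj2mx dA.
rewrite mulmxA mulmxBr mulmx1 -scalemxAr => ->.
rewrite -scalemxAl.
set X := A *m B *m A; set Y := \tr A *: _.
by rewrite !opprB addrCA.
Qed.

Lemma brkC A B : brk B A = - brk A B.
Proof. by rewrite /brk opprB. Qed.

Lemma brk_invr A B : \det B = 1 -> brk A B *m B = adj2 B *m brk A B.
Proof.
move=> dB; have := brk_invl A dB; rewrite brkC mulNmx mulmxN.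
exact: oppr_inj.
Qed.

End Mx2.

Lemma map_mx2 (K L : comNzRingType) (f : {rmorphism K -> L}) (A : 'M[K]_2) :
  map_mx f A = mx2 (f (A 0 0)) (f (A 0 1)) (f (A 1 0)) (f (A 1 1)).
Proof. by rewrite [LHS]mx2_eta !mxE. Qed.

Lemma map_adj2 (K L : comNzRingType) (f : {rmorphism K -> L}) (A : 'M[K]_2) :
  map_mx f (adj2 A) = adj2 (map_mx f A).
Proof. by rewrite !map_mx2 /adj2 !mx2E !rmorphN. Qed.

(** * Words and homomorphisms on the surface group *)

Section Words.

Definition word_mx (K : comNzRingType) (G : generator -> 'M[K]_2) (w : word) :
    'M[K]_2 :=
  foldr (fun (l : letter) M => (if l.2 then G l.1 else adj2 (G l.1)) *m M) 1%:M w.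

Definition word_val (G : groupType) (f : generator -> G) (w : word) : G :=
  foldr (fun (l : letter) x => ((if l.2 then f l.1 else (f l.1)^-1) * x)%g) 1%g w.

Lemma word_val_cat (G : groupType) (f : generator -> G) u v :
  word_val f (u ++ v) = (word_val f u * word_val f v)%g.
Proof. by elim: u => [|l u IH] /=; rewrite ?mul1g // IH mulgA. Qed.

Lemma word_val_eq (G : groupType) (f : generator -> G) u v :
  surface_relator (f A1) (f B1) (f A2) (f B2) = 1%g ->
  word_eq u v -> word_val f u = word_val f v.
Proof.
move=> rel; elim=> {u v} //.
- by move=> u v w _ -> _ ->.
- by move=> u u' v v' _ e _ e'; rewrite !word_val_cat e e'.
- by move=> x [] /=; rewrite mulg1 ?mulgV ?mulVg.
- by rewrite /= mulg1 -[RHS]rel /surface_relator /commutator !mulgA.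
Qed.

Section Lift.
Context (G : groupType) (f : generator -> G).
Hypothesis rel : surface_relator (f A1) (f B1) (f A2) (f B2) = 1%g.

Definition Gamma2_lift_fun (x : Gamma2) : G := word_val f (repr x).

Lemma Gamma2_lift_funE w : Gamma2_lift_fun (\pi_Gamma2 w) = word_val f w.
Proof. exact/(word_val_eq rel)/word_eq_repr. Qed.

Lemma Gamma2_lift_fun1 : Gamma2_lift_fun 1%g = 1%g.
Proof. exact: (Gamma2_lift_funE [::]). Qed.

Lemma Gamma2_lift_funM :
  {morph Gamma2_lift_fun : x y / (x * y)%g >-> (x * y)%g}.
Proof.
move=> x y; rewrite -(reprK x) -(reprK y) -[(_ * _)%g]/(Gamma2_mul _ _) Gamma2_mulE.
by rewrite !Gamma2_lift_funE word_val_cat.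
Qed.

Definition Gamma2_lift : UMagmaMorphism.type Gamma2 G :=
  HB.pack Gamma2_lift_fun
    (isMultiplicative.Build Gamma2 G Gamma2_lift_fun Gamma2_lift_funM)
    (Multiplicative_isUMagmaMorphism.Build Gamma2 G Gamma2_lift_fun
      Gamma2_lift_fun1).

Lemma Gamma2_lift_gen x : Gamma2_lift (gen x) = f x.
Proof. by rewrite /= Gamma2_lift_funE /= mulg1. Qed.

End Lift.

Lemma hom_word (G : groupType) (h : UMagmaMorphism.type Gamma2 G) w :
  h (\pi_Gamma2 w) = word_val (h \o gen) w.
Proof.
elim: w => [|[x b] w IH]; first exact: gmulf1.
rewrite /= -IH -cat1s -Gamma2_mulE gmulfM; congr (_ * _)%g.
by case: b => //; rewrite -gen_inv gmulfV.
Qed.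

Lemma Gamma2_ind (P : Gamma2 -> Prop) : P 1%g ->
  (forall x y, P x -> P y -> P (x * y)%g) ->
  (forall x, P (gen x)) -> (forall x, P (gen x)^-1%g) -> forall x, P x.
Proof.
move=> P1 PM Pg Pv x; rewrite -(reprK x); elim: (repr x) => [//|[y b] w IH].
have Pl : P (\pi_Gamma2 [:: (y, b)]).
  by case: b; [exact: Pg|rewrite -gen_inv; exact: Pv].
by rewrite -cat1s -Gamma2_mulE; exact: PM.
Qed.

End Words.

(** * The hyperelliptic involution *)

Section Hyperelliptic.

(** Inverting all generators breaks the relator. Now [[a1^-1, b1^-1] = (b1 a1)^-1 (a1 b1)], and
    conjugation by [hyp_conj] turns [[a2^-1, b2^-1]] into the inverse of this element. *)
Definition hyp_conj : Gamma2 :=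
  ((gen B1 * gen A1)^-1 * (gen A2 * gen B2))%g.

Definition hyp_gen (x : generator) : Gamma2 :=
  match x with
  | A1 => (gen A1)^-1
  | B1 => (gen B1)^-1
  | A2 => hyp_conj * (gen A2)^-1 * hyp_conj^-1
  | B2 => hyp_conj * (gen B2)^-1 * hyp_conj^-1
  end%g.

Lemma commutator2E :
  (gen A2 * gen B2 = gen B1 * gen A1 * (gen A1 * gen B1)^-1 * gen B2 * gen A2)%g.
Proof.
have := Gamma2_relation; rewrite /surface_relator /commutator => rel.
have e : ((gen A1 * gen B1 * (gen A1)^-1 * (gen B1)^-1) * (gen A2 * gen B2) =
    gen B2 * gen A2)%g.
  rewrite -[RHS]mul1g -rel -!mulgA; do 5!congr (_ * _)%g.
  by rewrite (mulKg (gen B2)) mulVg mulg1.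
rewrite -[RHS]mulgA -e !invgM !mulgA.
by rewrite mulgVK mulgVK mulgK mulgV mul1g.
Qed.

Lemma hyp_rel :
  surface_relator (hyp_gen A1) (hyp_gen B1) (hyp_gen A2) (hyp_gen B2) = 1%g.
Proof.
rewrite /surface_relator.
have cJ (v x y : Gamma2) : commutator (v * x * v^-1)%g (v * y * v^-1)%g =
    (v * commutator x y * v^-1)%g.
  by rewrite /commutator !invgM !invgK !mulgA !mulgVK.
rewrite /hyp_gen cJ /commutator !invgK /hyp_conj.
set a := gen A1; set b := gen B1; set c := gen A2; set d := gen B2.
have e : (c * d * (c^-1 * d^-1 * c * d) = b * a * (a * b)^-1 * (c * d))%g.
  rewrite {1}[(c * d)%g]commutator2E -/a -/b -/c -/d.
  by rewrite -!mulgA; do 3!congr (_ * _)%g; rewrite (mulVKg c) (mulVKg d).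
rewrite -[X in (_ * (X * _ * _))%g]/((b * a)^-1 * (c * d))%g -[X in (_ * (X * _))%g]mulgA e.
by rewrite !invgM !invgK !mulgA !(mulgK, mulgVK, mulgV, mul1g, mulVg).
Qed.

Definition hyp : UMagmaMorphism.type Gamma2 Gamma2 := Gamma2_lift hyp_rel.

(** An additive map does not see the conjugation by [hyp_conj], so each generator is simply
    inverted. *)
Lemma hyp_additive (V : zmodType) (k : Gamma2 -> V) :
  (forall x y, k (x * y)%g = k x + k y) -> forall x, k (hyp x) = - k x.
Proof.
move=> kM; have k1 : k 1%g = 0.
  by apply: (addrI (k 1%g)); rewrite -kM mulg1 addr0.
have kV x : k x^-1%g = - k x.
  by apply: (addrI (k x)); rewrite -kM mulgV k1 subrr.
have kg y : k (hyp (gen y)) = - k (gen y).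
  rewrite Gamma2_lift_gen; case: y; rewrite /= ?kV //.
    by rewrite kM kM !kV addrAC subrr add0r.
  by rewrite kM kM !kV addrAC subrr add0r.
elim/Gamma2_ind => [|x y IHx IHy|y|y].
- by rewrite gmulf1 k1 oppr0.
- by rewrite gmulfM !kM IHx IHy opprD.
- exact: kg.
- by rewrite gmulfV !kV kg.
Qed.

End Hyperelliptic.

(** * The bracket as an intertwiner for the hyperelliptic involution *)

Section SL2Facts.
Context {R : realType}.

Lemma val_SL2V (s : SL2 R) : val (s^-1)%g = adj2 (val s).
Proof.
rewrite /=; apply: (can_inj (mulKmx (SL2_unit s))).
by rewrite mulmxV ?SL2_unit // mulmx_adj2 SL2_det.
Qed.

Lemma val_SL2M (s t : SL2 R) : val (s * t)%g = val s *m val t.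
Proof. by []. Qed.

Lemma val_SL21 : val (1%g : SL2 R) = 1%:M.
Proof. by []. Qed.

Lemma val_word (f : generator -> SL2 R) w :
  val (word_val f w) = word_mx (fun x => val (f x)) w.
Proof.
by elim: w => [//|[x [|]] w IH]; rewrite /word_val /= -/(word_val f w) IH // -val_SL2V.
Qed.

(* [g = AB - BA] inverts [A] and [B]; the relator makes it proportional, up to
   the factor [hyp_conj], to the same matrix for the second handle. *)
Lemma hyp_intertwine (h : UMagmaMorphism.type Gamma2 (SL2 R)) (y : Gamma2) :
  let g := brk (val (h (gen A1))) (val (h (gen B1))) in
  g *m val (h y) = val (h (hyp y)) *m g.
Proof.
move=> g.
set A := val (h (gen A1)); set B := val (h (gen B1)).
set A' := val (h (gen A2)); set B' := val (h (gen B2)).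
pose g' := brk A' B'.
have dA : \det A = 1 by exact: SL2_det.
have dB : \det B = 1 by exact: SL2_det.
have dA' : \det A' = 1 by exact: SL2_det.
have dB' : \det B' = 1 by exact: SL2_det.
pose V := val (h hyp_conj).
have VE : V = adj2 (B *m A) *m (A' *m B').
  by rewrite /V /hyp_conj gmulfM gmulfV val_SL2M val_SL2V !gmulfM.
have gg' : g = - (V *m g').
  have e : A *m B *m adj2 A *m adj2 B *m A' *m B' *m adj2 A' *m adj2 B' = 1%:M.
    have /(congr1 (fun x => val (h x))) := Gamma2_relation.
    rewrite gmulf1 val_SL21 /surface_relator /commutator !(gmulfM, gmulfV).
    by rewrite !(val_SL2M, val_SL2V) !mulmxA.
  (* Cayley-Hamilton again, as [X *m Y] and [Y *m X] have the same trace; in this form the relator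
     can be applied to [g] and [g']. *)
  have gE (X Y : 'M[R]_2) : brk X Y = adj2 (Y *m X) - adj2 (X *m Y).
    by rewrite !adj2E mxtrace_mulC opprB addrC addrA subrK.
  have C2 : A' *m B' *m adj2 A' *m adj2 B' = B *m A *m adj2 (A *m B).
    have dBA : \det (B *m A *m adj2 (A *m B)) = 1.
      by rewrite !det_mulmx det_adj2 det_mulmx dA dB !mulr1.
    rewrite -[LHS]mul1mx -dBA -mulmx_adj2 -[RHS]mulmx1 -e -!mulmxA.
    congr (_ *m (_ *m _)); rewrite !mulmxA; do 4!congr (_ *m _).
    by rewrite !adj2M !adj2K -!mulmxA.
  have e1 : adj2 (B *m A) *m (A' *m B') *m adj2 (B' *m A') = adj2 (A *m B).
    rewrite (adj2M B' A') -!mulmxA; move: C2; rewrite -!mulmxA => ->.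
    by rewrite (mulmxA B A) mulmxA mul_adj2mx det_mulmx dA dB mulr1 mul1mx.
  have e2 : adj2 (B *m A) *m (A' *m B') *m adj2 (A' *m B') = adj2 (B *m A).
    by rewrite -mulmxA mulmx_adj2 det_mulmx dA' dB' mulr1 mulmx1.
  by rewrite /g /g' VE (gE A B) (gE A' B') mulmxBr e1 e2 opprB.
have hJ v x : val (h (v * x^-1 * v^-1)%g) =
    val (h v) *m adj2 (val (h x)) *m adj2 (val (h v)).
  by rewrite !(gmulfM, gmulfV) !val_SL2M !val_SL2V.
have gx (x : generator) : g *m val (h (gen x)) = val (h (hyp (gen x))) *m g.
  rewrite Gamma2_lift_gen; case: x => /=.
  - by rewrite gmulfV val_SL2V; exact: brk_invl.
  - by rewrite gmulfV val_SL2V; exact: brk_invr.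
  - rewrite hJ -/V -/A' gg' mulNmx mulmxN.
    congr (- _); rewrite -[in LHS]mulmxA brk_invl // !mulmxA.
    by rewrite -[V *m adj2 A' *m adj2 V *m V]mulmxA mul_adj2mx SL2_det mulmx1.
  - rewrite hJ -/V -/B' gg' mulNmx mulmxN.
    congr (- _); rewrite -[in LHS]mulmxA brk_invr // !mulmxA.
    by rewrite -[V *m adj2 B' *m adj2 V *m V]mulmxA mul_adj2mx SL2_det mulmx1.
elim/Gamma2_ind: y => [|x y IHx IHy|//|x].
- by rewrite !gmulf1 mulmx1 mul1mx.
- by rewrite !gmulfM !val_SL2M mulmxA IHx -!mulmxA IHy.
- rewrite !gmulfV !val_SL2V.
  apply: (can_inj (mulKmx (SL2_unit (h (hyp (gen x)))))).
  rewrite !mulmxA mulmx_adj2 SL2_det mul1mx -gx -mulmxA mulmx_adj2 SL2_det.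
  by rewrite mulmx1.
Qed.

End SL2Facts.

(** * A character of SL_2(Z) of order three *)

Section Chi.

(* The abelianization of SL_2(Z/3) is cyclic of order three; this polynomial
   computes the projection to it. *)
Definition chi_nat (a b c d : nat) : nat := ((1 + 2 * c * c) * b * d + c * (a + d))%N.

(** Additivity on SL_2(Z/3) is a finite check, phrased with natural numbers so that it can be
    computed. *)
Definition chi_natP : bool :=
  let r := iota 0 3 in
  all (fun a => all (fun b => all (fun c => all (fun d =>
    ((a * d) %% 3 == (1 + b * c) %% 3)%N ==>
    all (fun a' => all (fun b' => all (fun c' => all (fun d' =>
      ((a' * d') %% 3 == (1 + b' * c') %% 3)%N ==>
      (chi_nat (a * a' + b * c') (a * b' + b * d') (c * a' + d * c') (c * b' + d * d') %% 3
       == (chi_nat a b c d + chi_nat a' b' c' d') %% 3)%N) r) r) r) r) r) r) r) r.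

Lemma chi_nat_true : chi_natP. Proof. by vm_compute. Qed.

(** As 2 is -1 here, this is [(a + d) c - b d (c^2 - 1)], the exponent modulo 3 in the multiplier of
    the eighth power of the Dedekind eta function. *)
Definition chi3 (a b c d : 'Z_3) : 'Z_3 := (1 + 2 * c * c) * b * d + c * (a + d).

Lemma Z3_nat (m n : nat) : (m%:R == n%:R :> 'Z_3) = (m %% 3 == n %% 3)%N.
Proof. by rewrite -(inj_eq val_inj) /= !val_Zp_nat. Qed.

Lemma chi3_nat (a b c d : nat) :
  chi3 a%:R b%:R c%:R d%:R = (chi_nat a b c d)%:R.
Proof. by rewrite /chi3 /chi_nat !(natrD, natrM). Qed.

Lemma chi3M (a b c d a' b' c' d' : 'Z_3) :
  a * d - b * c = 1 -> a' * d' - b' * c' = 1 ->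
  chi3 (a * a' + b * c') (a * b' + b * d') (c * a' + d * c') (c * b' + d * d') =
  chi3 a b c d + chi3 a' b' c' d'.
Proof.
have Z3E (x : 'Z_3) : exists2 n, n \in iota 0 3 & x = n%:R.
  by exists (val x); [rewrite mem_iota /= (ltn_ord x)|rewrite natr_Zp].
have [na ia ->] := Z3E a; have [nb ib ->] := Z3E b.
have [nc ic ->] := Z3E c; have [nd id ->] := Z3E d.
have [na' ia' ->] := Z3E a'; have [nb' ib' ->] := Z3E b'.
have [nc' ic' ->] := Z3E c'; have [nd' id' ->] := Z3E d'.
have dn (x y z t : nat) : x%:R * y%:R - z%:R * t%:R = 1 :> 'Z_3 ->
    ((x * y) %% 3 == (1 + z * t) %% 3)%N.
  by move=> /eqP; rewrite subr_eq -!natrM -[1]/(1%:R) -natrD Z3_nat.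
move=> /dn d1 /dn d2.
rewrite -!natrM -!natrD !chi3_nat -natrD; apply/eqP; rewrite Z3_nat.
have /allP/(_ _ ia)/allP/(_ _ ib)/allP/(_ _ ic)/allP/(_ _ id) := chi_nat_true.
move=> /implyP/(_ d1).
move=> /allP/(_ _ ia')/allP/(_ _ ib')/allP/(_ _ ic')/allP/(_ _ id').
by move=> /implyP/(_ d2).
Qed.

Definition chi (M : 'M[int]_2) : 'Z_3 :=
  chi3 (M 0 0)%:~R (M 0 1)%:~R (M 1 0)%:~R (M 1 1)%:~R.

Lemma chiM (M N : 'M[int]_2) : \det M = 1 -> \det N = 1 ->
  chi (M *m N) = chi M + chi N.
Proof.
rewrite !det_mx2E => /(congr1 (fun z : int => z%:~R : 'Z_3)) dM.
move=> /(congr1 (fun z : int => z%:~R : 'Z_3)) dN.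
rewrite /chi !mulmx2E !rmorphD !rmorphM /=; apply: chi3M.
  by rewrite -!rmorphM -rmorphB.
by rewrite -!rmorphM -rmorphB.
Qed.

End Chi.

(** * Integrality of conjugators *)

Lemma Bezout4 (n1 n2 n3 n4 : int) : exists (G a1 a2 a3 a4 f1 f2 f3 f4 : int),
  G = a1 * n1 + a2 * n2 + a3 * n3 + a4 * n4 /\
  [/\ n1 = f1 * G, n2 = f2 * G, n3 = f3 * G & n4 = f4 * G].
Proof.
have [u1 [v1 e1]] := Bezoutz n1 n2; have [u2 [v2 e2]] := Bezoutz n3 n4.
have [u [v e]] := Bezoutz (gcdz n1 n2) (gcdz n3 n4).
set G := gcdz (gcdz n1 n2) (gcdz n3 n4) in e.
have /dvdzP[f1 F1] : (G %| n1)%Z by rewrite (dvdz_trans (dvdz_gcdl _ _)) ?dvdz_gcdl.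
have /dvdzP[f2 F2] : (G %| n2)%Z by rewrite (dvdz_trans (dvdz_gcdl _ _)) ?dvdz_gcdr.
have /dvdzP[f3 F3] : (G %| n3)%Z by rewrite (dvdz_trans (dvdz_gcdr _ _)) ?dvdz_gcdl.
have /dvdzP[f4 F4] : (G %| n4)%Z by rewrite (dvdz_trans (dvdz_gcdr _ _)) ?dvdz_gcdr.
exists G, (u * u1), (u * v1), (v * u2), (v * v2), f1, f2, f3, f4; split=> //.
by rewrite -e -e1 -e2; ring.
Qed.

(* If all products of two entries are integral multiples of the determinant
   [D > 0], the matrix is a multiple of an integral matrix of determinant 1. *)
Lemma integral_multiple (R : realType) (k : 'M[R]_2) : 0 < \det k ->
  (forall i j i' j', exists n : int, k i j * k i' j' = n%:~R * \det k) ->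
  exists (w : R) (f : 'M[int]_2), w != 0 /\ \det f = 1 /\ k = w *: map_mx intr f.
Proof.
move=> D0 kn; set D := \det k in D0 kn *.
have DE : D = k 0 0 * k 1 1 - k 0 1 * k 1 0 by rewrite /D det_mx2E.
have [i [j kij]] : exists i j, k i j != 0.
  apply: contrapT => k0; suff e i j : k i j = 0.
    by move: D0; rewrite DE !e !mul0r subr0 ltxx.
  by apply: contrapT => /eqP kij; apply: k0; exists i, j.
have [n1 e1] := kn i j 0 0; have [n2 e2] := kn i j 0 1.
have [n3 e3] := kn i j 1 0; have [n4 e4] := kn i j 1 1.
have [G [a1 [a2 [a3 [a4 [f1 [f2 [f3 [f4 [EG [F1 F2 F3 F4]]]]]]]]]]] :=
  Bezout4 n1 n2 n3 n4.
(* The Bezout coefficients of [G], applied to the entries of [k]: multiplication by [k i j] gives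
   [G * D], so every entry of [k] is an integral multiple of [w]. *)
pose w := a1%:~R * k 0 0 + a2%:~R * k 0 1 + a3%:~R * k 1 0 + a4%:~R * k 1 1.
have ew : k i j * w = G%:~R * D.
  rewrite EG !rmorphD !rmorphM /= /w !mulrDr !mulrDl.
  by do !congr (_ + _); rewrite mulrCA ?e1 ?e2 ?e3 ?e4 mulrA.
have kf a b f n : k i j * k a b = n%:~R * D -> n = f * G -> k a b = w * f%:~R.
  by move=> e en; apply: (mulfI kij); rewrite e en mulrA ew rmorphM /=; ring.
pose f := mx2 f1 f2 f3 f4.
have kE : k = w *: map_mx intr f.
  apply: eq_mx2; rewrite !mxE /=; apply: kf; eassumption.
have w0 : w != 0.
  by apply/eqP => w0; move: D0; rewrite /D kE w0 scale0r det0 ltxx.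
exists w, f; split=> //; split=> //.
have dE : D = w ^+ 2 * (\det f)%:~R.
  by rewrite /D kE detZ -det_map_mx.
(* [w * w] is an integral combination of products of two entries, hence [M * D] with an integer
   [M > 0]; together with [D = w^2 * \det f] this leaves only [\det f = 1]. *)
pose I x := exists n : int, x = n%:~R * D.
have ID x y : I x -> I y -> I (x + y).
  by move=> [m ->] [n ->]; exists (m + n); rewrite rmorphD mulrDl.
have IZ (m : int) x : I x -> I (m%:~R * x).
  by move=> [n ->]; exists (m * n); rewrite rmorphM mulrA.
have Iwk a b : I (k a b * w).
  have IZk (m : int) c d : I (k a b * (m%:~R * k c d)) by rewrite mulrCA; exact/IZ/kn.
  rewrite /w !mulrDr.
  exact: (ID _ _ (ID _ _ (ID _ _ (IZk _ _ _) (IZk _ _ _)) (IZk _ _ _)) (IZk _ _ _)).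
have [M wM] : I (w * w).
  have IZw (m : int) c d : I (m%:~R * k c d * w) by rewrite -mulrA; exact/IZ/Iwk.
  rewrite {1}/w !mulrDl.
  exact: (ID _ _ (ID _ _ (ID _ _ (IZw _ _ _) (IZw _ _ _)) (IZw _ _ _)) (IZw _ _ _)).
have M0 : 0 < M.
  rewrite -(ltr0z R) -(pmulr_lgt0 _ D0) -wM -expr2 lt_neqAle sqr_ge0 andbT.
  by rewrite eq_sym sqrf_eq0.
have MD : M * \det f = 1.
  apply/eqP; rewrite -(eqr_int R) rmorphM /=; apply/eqP.
  apply: (mulfI (lt0r_neq0 D0)); rewrite mulr1 mulrCA mulrA -wM mulrC -expr2.
  by rewrite mulrC -dE.
have := congr1 absz MD; rewrite abszM => /eqP; rewrite muln_eq1 => /andP[/eqP M1 _].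
by move: MD; rewrite -[M](gtz0_abs M0) M1 mul1r.
Qed.

(** * A representation with integral image *)

Section IntegralRep.
Context {R : realType}.

(** Both matrices are hyperbolic with positive trace, their bracket has determinant -1, and
    [int_B *m int_A] differs from the identity by a matrix unit, up to sign. *)
Definition int_A : 'M[int]_2 := mx2 2 1 1 1.
Definition int_B : 'M[int]_2 := mx2 1 (-1) (-2) 3.

Definition int_gen (x : generator) : 'M[int]_2 :=
  match x with A1 => int_A | B1 => int_B | A2 => int_B | B2 => int_A end.

Lemma det_int_gen x : \det (map_mx intr (int_gen x) : 'M[R]_2) = 1.
Proof.
by case: x; rewrite map_mx2 /= !mx2E det_mx2 ?rmorphN /=; ring.
Qed.

Definition int_sl2 (x : generator) : SL2 R := mkSL2 (det_int_gen x).

Lemma surface_relator_swap (G : groupType) (a b : G) :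
  surface_relator a b b a = 1%g.
Proof.
rewrite /surface_relator /commutator !mulgA.
by rewrite !mulgVK mulgK mulgV.
Qed.

Lemma int_rel : surface_relator (int_sl2 A1) (int_sl2 B1) (int_sl2 A2) (int_sl2 B2) = 1%g.
Proof.
rewrite (_ : int_sl2 A2 = int_sl2 B1); last exact/val_inj.
rewrite (_ : int_sl2 B2 = int_sl2 A1); last exact/val_inj.
exact: surface_relator_swap.
Qed.

Definition int_hom : UMagmaMorphism.type Gamma2 (SL2 R) := Gamma2_lift int_rel.

Definition int_val (x : Gamma2) : 'M[int]_2 := word_mx int_gen (repr x).

Lemma map_word_mx (K L : comNzRingType) (f : {rmorphism K -> L})
    (G : generator -> 'M[K]_2) w :
  map_mx f (word_mx G w) = word_mx (fun x => map_mx f (G x)) w.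
Proof.
elim: w => [|[x b] w IH] /=; first by rewrite map_mx1.
by rewrite map_mxM IH; case: b; rewrite ?map_adj2.
Qed.

Lemma val_int_hom x : val (int_hom x) = map_mx intr (int_val x).
Proof.
by rewrite /= /Gamma2_lift_fun val_word map_word_mx.
Qed.

Lemma map_intr_inj : injective (map_mx intr : 'M[int]_2 -> 'M[R]_2).
Proof.
move=> M N e; apply/matrixP => i j; apply/eqP; rewrite -(eqr_int R).
by move/matrixP/(_ i j): e; rewrite !mxE => ->.
Qed.

Lemma int_valM x y : int_val (x * y)%g = int_val x *m int_val y.
Proof.
by apply: map_intr_inj; rewrite map_mxM -!val_int_hom gmulfM.
Qed.

Lemma det_int_val x : \det (int_val x) = 1.
Proof.
by apply/eqP; rewrite -(eqr_int R) -det_map_mx -val_int_hom SL2_det.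
Qed.

Lemma int_val_gen x : int_val (gen x) = int_gen x.
Proof. by apply: map_intr_inj; rewrite -val_int_hom Gamma2_lift_gen. Qed.

(* Conjugation by a matrix of positive determinant normalizing the image is
   conjugation by an element of SL_2(Z), which preserves the character [chi]. *)
Lemma int_hom_no_intertwiner (f : Gamma2 -> Gamma2) (k : 'M[R]_2) :
  (forall c : Gamma2 -> 'Z_3, (forall x y, c (x * y)%g = c x + c y) ->
     forall x, c (f x) = - c x) ->
  0 < \det k -> (forall x, k *m val (int_hom x) = val (int_hom (f x)) *m k) -> False.
Proof.
move=> fN D0 kf.
(* The integral matrices whose conjugate by [k] is integral. They form an additive group containing
   the image of [int_hom], from which all matrix units are produced. *)
pose S (M : 'M[int]_2) := exists M' : 'M[int]_2,
  k *m map_mx intr M = map_mx intr M' *m k.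
have SD M N : S M -> S N -> S (M + N).
  move=> [M' eM] [N' eN]; exists (M' + N').
  by rewrite !map_mxD mulmxDl mulmxDr eM eN.
have SN M : S M -> S (- M).
  by move=> [M' eM]; exists (- M'); rewrite !map_mxN mulNmx mulmxN eM.
have Sv x : S (int_val x) by exists (int_val (f x)); rewrite -!val_int_hom.
have S1 : S 1%:M by exists 1%:M; rewrite !map_mx1 mulmx1 mul1mx.
have SA : S int_A by have := Sv (gen A1); rewrite int_val_gen.
have SB : S int_B by have := Sv (gen B1); rewrite int_val_gen.
have SBA : S (int_B *m int_A).
  by have := Sv (gen B1 * gen A1)%g; rewrite int_valM !int_val_gen.
have S21 : S (mx2 0 0 1 0).
  rewrite (_ : mx2 _ _ _ _ = 1%:M - int_B *m int_A); first by apply: (SD) => //; exact: (SN).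
  by rewrite /int_A /int_B !mx2_simpl; congr mx2; ring.
have SP : S (mx2 1 1 0 0).
  rewrite (_ : mx2 _ _ _ _ = int_A - 1%:M - mx2 0 0 1 0).
    by apply: (SD); [apply: (SD) => //|]; exact: (SN).
  by rewrite /int_A !mx2_simpl; congr mx2; ring.
have S22 : S (mx2 0 0 0 1).
  rewrite (_ : mx2 _ _ _ _ = mx2 1 1 0 0 - 1%:M +
      (int_B - 1%:M + (mx2 0 0 1 0 + mx2 0 0 1 0))).
    by apply: (SD); apply: (SD) => //; [exact: (SN)|apply: (SD) => //; exact: (SN)|exact: SD].
  by rewrite /int_B !mx2_simpl; congr mx2; ring.
have S11 : S (mx2 1 0 0 0).
  rewrite (_ : mx2 _ _ _ _ = 1%:M - mx2 0 0 0 1); first by apply: (SD) => //; exact: (SN).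
  by rewrite !mx2_simpl; congr mx2; ring.
have S12 : S (mx2 0 1 0 0).
  rewrite (_ : mx2 _ _ _ _ = mx2 1 1 0 0 - mx2 1 0 0 0).
    by apply: (SD) => //; exact: (SN).
  by rewrite !mx2_simpl; congr mx2; ring.
have SE M : S M -> forall a b, exists n : int,
    (k *m map_mx intr M *m adj2 k) a b = n%:~R * \det k.
  move=> [M' ->] a b; exists (M' a b).
  by rewrite -mulmxA mulmx_adj2 mul_mx_scalar !mxE mulrC.
have IN (x : R) : (exists n : int, - x = n%:~R * \det k) ->
    exists n : int, x = n%:~R * \det k.
  by move=> [n e]; exists (- n); rewrite rmorphN mulNr -e opprK.
(* The entries of [k *m E *m adj2 k], for a matrix unit [E], are up to sign the products of two
   entries of [k]; so these are integral multiples of [\det k]. *)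
set p := k 0 0; set q := k 0 1; set r := k 1 0; set s := k 1 1.
have e11 : k *m map_mx intr (mx2 1 0 0 0) *m adj2 k =
    mx2 (p * s) (- (p * q)) (r * s) (- (q * r)).
  by rewrite map_mx2 !mx2E !(rmorph0, rmorph1) {1}(mx2_eta k) /adj2 !mx2_simpl;
    congr mx2; rewrite /p /q /r /s; ring.
have e12 : k *m map_mx intr (mx2 0 1 0 0) *m adj2 k =
    mx2 (- (p * r)) (p * p) (- (r * r)) (p * r).
  by rewrite map_mx2 !mx2E !(rmorph0, rmorph1) {1}(mx2_eta k) /adj2 !mx2_simpl;
    congr mx2; rewrite /p /q /r /s; ring.
have e21 : k *m map_mx intr (mx2 0 0 1 0) *m adj2 k =
    mx2 (q * s) (- (q * q)) (s * s) (- (q * s)).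
  by rewrite map_mx2 !mx2E !(rmorph0, rmorph1) {1}(mx2_eta k) /adj2 !mx2_simpl;
    congr mx2; rewrite /p /q /r /s; ring.
have := SE _ S11 0 0; rewrite e11 mx2E => Ips.
have := SE _ S11 0 1; rewrite e11 mx2E => /IN Ipq.
have := SE _ S11 1 0; rewrite e11 mx2E => Irs.
have := SE _ S11 1 1; rewrite e11 mx2E => /IN Iqr.
have := SE _ S12 0 1; rewrite e12 mx2E => Ipp.
have := SE _ S12 1 1; rewrite e12 mx2E => Ipr.
have := SE _ S12 1 0; rewrite e12 mx2E => /IN Irr.
have := SE _ S21 0 0; rewrite e21 mx2E => Iqs.
have := SE _ S21 0 1; rewrite e21 mx2E => /IN Iqq.
have := SE _ S21 1 0; rewrite e21 mx2E => Iss.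
have kn i j i' j' : exists n : int, k i j * k i' j' = n%:~R * \det k.
  by case: (ord2P i) => ->; case: (ord2P j) => ->; case: (ord2P i') => ->;
    case: (ord2P j') => ->; rewrite -/p -/q -/r -/s //; rewrite mulrC.
have [w [g [w0 [dg kE]]]] := integral_multiple D0 kn.
have gf x : g *m int_val x = int_val (f x) *m g.
  apply: map_intr_inj; rewrite !map_mxM -!val_int_hom.
  have := kf x; rewrite kE -scalemxAl -scalemxAr => /(congr1 ( *:%R w^-1)).
  by rewrite !scalerA mulVf // !scale1r.
have cM x y : chi (int_val (x * y)%g) = chi (int_val x) + chi (int_val y).
  by rewrite int_valM chiM ?det_int_val.
(* Applying [chi] to [gf] cancels the contribution of [g]: the values at [b1] and at [f b1] agree.
   They are also opposite, but the value is 1, which differs from -1 in Z/3. *)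
have := fN (chi \o int_val) cM (gen B1); rewrite /=.
have := congr1 chi (gf (gen B1)); rewrite !chiM ?det_int_val // addrC => /addIr <-.
have chiB : chi int_B = 1 by rewrite /chi !mx2E; apply/val_inj; vm_compute.
by rewrite int_val_gen chiB => /(congr1 val).
Qed.

End IntegralRep.

(** * Sign of an intertwiner along a polynomial path *)

Section PolyPath.
Context {R : realType}.
Implicit Types (P : 'M[{poly R}]_2) (p : {poly R}).

Definition eval_mx P (t : R) : 'M[R]_2 := map_mx (horner_eval t) P.

Lemma eval_mxE P t i j : eval_mx P t i j = (P i j).[t].
Proof. by rewrite mxE. Qed.

Lemma det_eval_mx P t : \det (eval_mx P t) = (\det P).[t].
Proof. by rewrite det_map_mx. Qed.

(* Dividing out the common factor of the entries. *)
Lemma primitive_mx P : P != 0 -> exists (d : {poly R}) (Q : 'M[{poly R}]_2),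
  [/\ d != 0, P = d *: Q & forall t, eval_mx Q t != 0].
Proof.
move=> P0; pose d := gcdp (gcdp (P 0 0) (P 0 1)) (gcdp (P 1 0) (P 1 1)).
have dP i j : d %| P i j.
  case: (ord2P i) => ->; case: (ord2P j) => ->; rewrite /d.
  - exact: dvdp_trans (dvdp_gcdl _ _) (dvdp_gcdl _ _).
  - exact: dvdp_trans (dvdp_gcdl _ _) (dvdp_gcdr _ _).
  - exact: dvdp_trans (dvdp_gcdr _ _) (dvdp_gcdl _ _).
  - exact: dvdp_trans (dvdp_gcdr _ _) (dvdp_gcdr _ _).
have d0 : d != 0.
  apply: contra P0 => /eqP d0; apply/eqP/matrixP => i j; rewrite mxE.
  by apply/eqP; have := dP i j; rewrite d0 dvd0p.
pose Q := \matrix_(i, j) (P i j %/ d).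
have PE : P = d *: Q.
  by apply/matrixP => i j; rewrite !mxE mulrC divpK.
exists d, Q; split=> // t; apply/eqP => Qt.
have dQ i j : ('X - t%:P) %| Q i j.
  by rewrite dvdp_XsubCl /root -eval_mxE Qt mxE.
have ddP i j : d * ('X - t%:P) %| P i j by rewrite PE mxE dvdp_mul2l.
have : d * ('X - t%:P) %| d by rewrite /d !dvdp_gcd !ddP.
move=> /(dvdp_leq d0); rewrite size_mul ?polyXsubC_eq0 // size_XsubC addn2 /=.
by rewrite ltnn.
Qed.

Lemma poly_dnbhs_neq0 p t : p != 0 -> \forall u \near t^', p.[u] != 0.
Proof.
move=> p0; have [m [q]] := multiplicity_XsubC p t; rewrite p0 /= => qt pE.
have nq : \forall u \near t^', q.[u] != 0.
  apply: nbhs_dnbhs.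
  exact: (@continuous_horner _ q t _ (open_nbhs_nbhs (conj open_neq0 qt))).
near=> u; rewrite pE hornerM mulf_neq0 //; first by near: u.
rewrite horner_exp hornerXsubC expf_neq0 // subr_eq0.
by near: u; exact: nbhs_dnbhs_neq.
Unshelve. all: by end_near. Qed.

Lemma continuous_dnbhs_eq0 (h : R -> R) t :
  {for t, continuous h} -> (\forall u \near t^', h u = 0) -> h t = 0.
Proof.
move=> ch h0; apply: contrapT => /eqP ht.
have hn : \forall u \near t^', h u != 0.
  by apply: nbhs_dnbhs; exact: (ch _ (open_nbhs_nbhs (conj open_neq0 ht))).
have [u [u0]] : exists u, h u = 0 /\ h u != 0.
  by apply: (@filter_ex _ t^' _); near=> u; split; near: u.
by rewrite u0 eqxx.
Unshelve. all: by end_near. Qed.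

(* If [P] intertwines irreducible families at every time, so does its primitive
   part, which is therefore invertible at every time. *)
Lemma intertwiner_det_sign (I : Type) P (X X' : I -> R -> 'M[R]_2) :
  (forall x (t : R) i j, 0 <= t <= 1 -> {for t, continuous (fun u => X x u i j)}) ->
  (forall x (t : R) i j, 0 <= t <= 1 -> {for t, continuous (fun u => X' x u i j)}) ->
  (forall x (t : R), 0 <= t <= 1 -> \forall u \near t,
     eval_mx P u *m X x u = X' x u *m eval_mx P u) ->
  (forall (t : R) (M : 'M[R]_2), 0 <= t <= 1 -> M != 0 ->
     (forall x, M *m X x t = X' x t *m M) -> \det M != 0) ->
  0 < (\det P).[1] ->
  exists M : 'M[R]_2, 0 < \det M /\ forall x, M *m X x 0 = X' x 0 *m M.
Proof.
move=> cX cX' PX irr P1.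
have P0 : P != 0 by apply: contraL P1 => /eqP ->; rewrite det0 horner0 ltxx.
have [d [Q [d0 PE Qt]]] := primitive_mx P0.
(* [d] may vanish at [t], but not at the other times close to [t]; there the relation for [Q]
   follows by division, and it extends to [t] by continuity. *)
have QX x t : 0 <= t <= 1 -> eval_mx Q t *m X x t = X' x t *m eval_mx Q t.
  move=> t01; apply/matrixP => i j; apply/eqP; rewrite -subr_eq0; apply/eqP.
  pose h u := (eval_mx Q u *m X x u) i j - (X' x u *m eval_mx Q u) i j.
  have cQ a b : {for t, continuous (fun u => eval_mx Q u a b)}.
    rewrite (_ : (fun _ => _) = horner (Q a b)); first exact: continuous_horner.
    by apply/funext => u; rewrite eval_mxE.
  apply: (@continuous_dnbhs_eq0 h).
    rewrite (_ : h = fun u =>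
        (eval_mx Q u i 0 * X x u 0 j + eval_mx Q u i 1 * X x u 1 j) -
        (X' x u i 0 * eval_mx Q u 0 j + X' x u i 1 * eval_mx Q u 1 j));
      last by apply/funext => u; rewrite /h !mulmx2E.
    by apply: cvgB; apply: cvgD; apply: cvgM;
      [exact: cQ|exact: cX|exact: cQ|exact: cX|exact: cX'|exact: cQ|exact: cX'|exact: cQ].
  have := nbhs_dnbhs (PX x t t01); have := poly_dnbhs_neq0 t d0.
  apply: filterS2 => u du; rewrite PE /eval_mx map_mxZ /= -scalemxAl -scalemxAr.
  move=> /matrixP/(_ i j); rewrite !mxE => /(mulfI du).
  by rewrite /h => e; apply/eqP; rewrite subr_eq0; apply/eqP; rewrite !mxE.
have dQ t : 0 <= t <= 1 -> (\det Q).[t] != 0.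
  by move=> t01; rewrite -det_eval_mx; apply: (irr t) => // x; exact: QX.
(* Division changes the determinant by the square [d^2], so the sign at time 1 is preserved. *)
have Q1 : 0 < (\det Q).[1].
  have P1E : (\det P).[1] = d.[1] ^+ 2 * (\det Q).[1].
    by rewrite PE detZ hornerM horner_exp.
  move: (P1); rewrite P1E pmulr_rgt0 // lt_neqAle sqr_ge0 andbT eq_sym sqrf_eq0.
  by apply: contraL P1 => /eqP d1; rewrite P1E d1 expr0n mul0r ltxx.
exists (eval_mx Q 0); split; last by move=> x; apply: QX; rewrite lexx ler01.
rewrite det_eval_mx ltNge; apply/negP => Q0.
have Q01 : (\det Q).[0] <= 0 <= (\det Q).[1] by rewrite Q0 ltW.
have [t t01 rt] := poly_ivt ler01 Q01.
by have := dQ t t01; move: rt; rewrite /root => ->.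
Qed.

End PolyPath.

(** * Zariski density *)

Section ZariskiDensity.
Import (canonicals) mpoly.
Context {R : realType}.

(** A Laurent polynomial away from 0. If it vanishes at infinitely many nonzero points it vanishes
    at all of them, so infinitely many points put a whole curve into a Zariski closure. *)
Definition laurent (f : R -> R) : Prop :=
  exists (k : nat) (Q : {poly R}), forall u, u != 0 -> u ^+ k * f u = Q.[u].

Lemma laurent_cst (c : R) : laurent (fun=> c).
Proof. by exists 0%N, c%:P => u _; rewrite hornerC mul1r. Qed.

Lemma laurent_id : laurent id.
Proof. by exists 0%N, 'X => u _; rewrite hornerX mul1r. Qed.

Lemma laurentV : laurent (fun u => u^-1).
Proof. by exists 1%N, 1 => u u0; rewrite hornerC expr1 mulfV. Qed.

Lemma laurentD f g : laurent f -> laurent g -> laurent (fun u => f u + g u).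
Proof.
move=> [k [P eP]] [m [Q eQ]].
exists (k + m)%N, ('X^m * P + 'X^k * Q) => u u0.
by rewrite hornerD !hornerM !hornerXn -eP // -eQ // exprD; ring.
Qed.

Lemma laurentM f g : laurent f -> laurent g -> laurent (fun u => f u * g u).
Proof.
move=> [k [P eP]] [m [Q eQ]].
exists (k + m)%N, (P * Q) => u u0.
by rewrite hornerM -eP // -eQ // exprD; ring.
Qed.

Lemma laurentX f n : laurent f -> laurent (fun u => f u ^+ n).
Proof.
move=> lf; elim: n => [|n IH]; first exact: laurent_cst.
rewrite (_ : (fun _ => _) = fun u => f u * f u ^+ n); first exact: laurentM.
by apply/funext => u; rewrite exprS.
Qed.

Lemma laurent_sum (I : Type) (s : seq I) (f : I -> R -> R) :
  (forall i, laurent (f i)) -> laurent (fun u => \sum_(i <- s) f i u).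
Proof.
move=> lf; elim: s => [|i s IH].
  rewrite (_ : (fun _ => _) = fun=> 0); first exact: laurent_cst.
  by apply/funext => u; rewrite big_nil.
rewrite (_ : (fun _ => _) = fun u => f i u + \sum_(j <- s) f j u).
  exact: laurentD.
by apply/funext => u; rewrite big_cons.
Qed.

Lemma laurent_prod (I : Type) (s : seq I) (f : I -> R -> R) :
  (forall i, laurent (f i)) -> laurent (fun u => \prod_(i <- s) f i u).
Proof.
move=> lf; elim: s => [|i s IH].
  rewrite (_ : (fun _ => _) = fun=> 1); first exact: laurent_cst.
  by apply/funext => u; rewrite big_nil.
rewrite (_ : (fun _ => _) = fun u => f i u * \prod_(j <- s) f j u).
  exact: laurentM.
by apply/funext => u; rewrite big_cons.
Qed.

Lemma laurent_eq0 f (v : nat -> R) : laurent f -> injective v ->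
  (forall n, v n != 0) -> (forall n, f (v n) = 0) ->
  forall u, u != 0 -> f u = 0.
Proof.
move=> [k [Q eQ]] vinj v0 fv u u0.
have Q0 : Q = 0.
  apply/eqP; apply: contraT => Qn0.
  have := @max_poly_roots _ Q (map v (iota 0 (size Q))) Qn0.
  rewrite size_map size_iota ltnn map_inj_uniq // iota_uniq; apply=> //.
  by apply/allP => _ /mapP[n _ ->]; rewrite /root -eQ // fv mulr0.
have := eQ u u0; rewrite Q0 horner0 => /eqP; rewrite mulf_eq0 => /orP[|/eqP//].
by rewrite expf_eq0 (negbTE u0) andbF.
Qed.

Definition evalP (P : mpoly.mpoly (2 * 2) R) (M : 'M[R]_2) : R :=
  mpoly.meval (entries M) P.

Lemma entriesE (M : 'M[R]_2) i : exists a b, forall N : 'M[R]_2, entries N i = N a b.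
Proof.
by case/mxvec_indexP: i => a b; exists a, b => N; rewrite /entries mxvecE.
Qed.

Lemma laurent_evalP P (M : R -> 'M[R]_2) :
  (forall i j, laurent (fun u => M u i j)) -> laurent (fun u => evalP P (M u)).
Proof.
move=> lM; rewrite /evalP.
under eq_fun do rewrite mpoly.mevalE.
apply: laurent_sum => m; apply: laurentM; first exact: laurent_cst.
apply: laurent_prod => i; apply: laurentX.
by have [a [b e]] := entriesE 0 i; under eq_fun do rewrite e.
Qed.

Lemma laurent_mx2 (f g h k : R -> R) :
  laurent f -> laurent g -> laurent h -> laurent k ->
  forall i j, laurent (fun u => mx2 (f u) (g u) (h u) (k u) i j).
Proof.
move=> lf lg lh lk i j.
by case: (ord2P i) => ->; case: (ord2P j) => ->; under eq_fun do rewrite mx2E.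
Qed.

Lemma evalP_mull P (A : 'M[R]_2) :
  exists P', forall M, evalP P' M = evalP P (A *m M).
Proof.
have polE i j : exists Q, forall M, evalP Q M = (A *m M) i j.
  exists (mpoly.mpolyC _ (A i 0) * mpoly.mpolyX _ (mpoly.mnm1 (mxvec_index 0 j)) +
          mpoly.mpolyC _ (A i 1) * mpoly.mpolyX _ (mpoly.mnm1 (mxvec_index 1 j))).
  move=> M; rewrite /evalP mpoly.mevalD !mpoly.mevalM !mpoly.mevalC !mpoly.mevalXU.
  by rewrite /entries !mxvecE mulmx2E.
have /boolp.choice[q qE] : forall i, exists Q, forall M, evalP Q M = entries (A *m M) i.
  move=> i; have [a [b e]] := entriesE 0 i.
  by have [Q QE] := polE a b; exists Q => M; rewrite QE e.
exists (\sum_(m <- mpoly.msupp P) mpoly.mpolyC _ (mpoly.mcoeff m P) *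
   \prod_i q i ^+ (mpoly.fun_of_multinom m i)).
move=> M; rewrite /evalP rmorph_sum mpoly.mevalE; apply: eq_bigr => m _.
rewrite rmorphM /= mpoly.mevalC; congr (_ * _).
by rewrite rmorph_prod; apply: eq_bigr => i _; rewrite rmorphXn /= -/(evalP _ _) qE.
Qed.

Lemma evalP_mulr P (A : 'M[R]_2) :
  exists P', forall M, evalP P' M = evalP P (M *m A).
Proof.
have polE i j : exists Q, forall M, evalP Q M = (M *m A) i j.
  exists (mpoly.mpolyC _ (A 0 j) * mpoly.mpolyX _ (mpoly.mnm1 (mxvec_index i 0)) +
          mpoly.mpolyC _ (A 1 j) * mpoly.mpolyX _ (mpoly.mnm1 (mxvec_index i 1))).
  move=> M; rewrite /evalP mpoly.mevalD !mpoly.mevalM !mpoly.mevalC !mpoly.mevalXU.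
  by rewrite /entries !mxvecE mulmx2E; congr (_ + _); rewrite mulrC.
have /boolp.choice[q qE] : forall i, exists Q, forall M, evalP Q M = entries (M *m A) i.
  move=> i; have [a [b e]] := entriesE 0 i.
  by have [Q QE] := polE a b; exists Q => M; rewrite QE e.
exists (\sum_(m <- mpoly.msupp P) mpoly.mpolyC _ (mpoly.mcoeff m P) *
   \prod_i q i ^+ (mpoly.fun_of_multinom m i)).
move=> M; rewrite /evalP rmorph_sum mpoly.mevalE; apply: eq_bigr => m _.
rewrite rmorphM /= mpoly.mevalC; congr (_ * _).
by rewrite rmorph_prod; apply: eq_bigr => i _; rewrite rmorphXn /= -/(evalP _ _) qE.
Qed.

Section ZariskiClosure.
Variable H : set 'M[R]_2.
Hypothesis H1 : H 1%:M.
Hypothesis HM : forall h h', H h -> H h' -> H (h *m h').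

Definition zariski_closure : set 'M[R]_2 :=
  [set s | forall P, (forall h, H h -> evalP P h = 0) -> evalP P s = 0].
Local Notation Z := zariski_closure.

Lemma closure_incl h : H h -> Z h. Proof. by move=> Hh P; exact. Qed.

(** Translations preserve polynomial functions, so the left factor may first be replaced by an
    element of [H], and then the right one. *)
Lemma closureM s t : Z s -> Z t -> Z (s *m t).
Proof.
move=> Zs Zt P PH; have [P' P'E] := evalP_mulr P t.
rewrite -P'E; apply: Zs => h Hh; rewrite P'E.
have [P'' P''E] := evalP_mull P h; rewrite -P''E; apply: Zt => h' Hh'.
by rewrite P''E; apply: PH; exact: HM.
Qed.

Lemma closure_curve (M : R -> 'M[R]_2) (v : nat -> R) :
  (forall i j, laurent (fun u => M u i j)) -> injective v ->
  (forall n, v n != 0) -> (forall n, Z (M (v n))) ->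
  forall u, u != 0 -> Z (M u).
Proof.
move=> lM vinj v0 vZ u u0 P PH.
by apply: (laurent_eq0 (laurent_evalP P lM) vinj v0 _ u0) => n; exact: vZ.
Qed.

Variable l : R.
Hypothesis l1 : 1 < l.
Hypothesis Hl : H (mx2 l 0 0 l^-1).

Let l0 : l != 0. Proof. by rewrite gt_eqF // (lt_trans ltr01). Qed.

Lemma closure_torus u : u != 0 -> Z (mx2 u 0 0 u^-1).
Proof.
apply: (@closure_curve (fun u => mx2 u 0 0 u^-1) (fun n => l ^+ n)).
- by apply: laurent_mx2; [exact: laurent_id|exact: laurent_cst..|exact: laurentV].
- by apply: ieexprIn; [exact: lt_trans l1|rewrite gt_eqF].
- by move=> n; rewrite expf_neq0.
- move=> n; apply: closure_incl; elim: n => [|n IH].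
    by rewrite expr0 invr1 -scalar_mx2.
  have := HM Hl IH; rewrite mulmx_mx2 !(mulr0, mul0r, addr0, add0r) -invfM.
  by rewrite -exprS.
Qed.

(* The double coset [T g T] of the diagonal torus consists of the matrices of
   determinant 1 with the same product of diagonal entries. *)
Definition diag_prod (s : 'M[R]_2) : R := s 0 0 * s 1 1.

Lemma closure_cell g s : Z g -> \det g = 1 -> \det s = 1 ->
  diag_prod g != 0 -> diag_prod g != 1 -> diag_prod s = diag_prod g -> Z s.
Proof.
rewrite /diag_prod !det_mx2E => Zg dg ds g0 g1 sg.
pose a := g 0 0; pose b := g 0 1; pose c := g 1 0; pose d := g 1 1.
pose p := s 0 0; pose q := s 0 1; pose r := s 1 0; pose t := s 1 1.
move: dg ds g0 g1 sg; rewrite -/a -/b -/c -/d -/p -/q -/r -/t => dg ds g0 g1 sg.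
have bc0 : b * c != 0.
  by apply: contra g1 => /eqP bc; rewrite bc subr0 in dg; rewrite dg.
have [a0 d0] : a != 0 /\ d != 0 by move: g0; rewrite mulf_eq0 negb_or => /andP.
have [b0 c0] : b != 0 /\ c != 0 by move: bc0; rewrite mulf_eq0 negb_or => /andP.
have pt0 : p * t != 0 by rewrite sg.
have [p0 t0] : p != 0 /\ t != 0 by move: pt0; rewrite mulf_eq0 negb_or => /andP.
have qr : q * r = b * c by apply: (addrI (1 : R)); rewrite -{1}ds -dg sg; ring.
have qr0 : q * r != 0 by rewrite qr.
have [q0 r0] : q != 0 /\ r != 0 by move: qr0; rewrite mulf_eq0 negb_or => /andP.
pose M x y := mx2 (a * x) (b * y) (c * y^-1) (d * x^-1).
(* Torus elements [u] on the left and [w] on the right give [x = u w] and [y = u / w], hence only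
   [x y = u^2 > 0]; the other sign is reached by the curve in [x] with [y = q / b] fixed. *)
have ZM x y : 0 < x * y -> Z (M x y).
  move=> xy; have x0 : x != 0.
    by apply: contraL xy => /eqP ->; rewrite mul0r ltxx.
  have y0 : y != 0 by apply: contraL xy => /eqP ->; rewrite mulr0 ltxx.
  pose u := Num.sqrt (x * y); have u0 : u != 0 by rewrite gt_eqF // sqrtr_gt0.
  have uu : u * u = x * y by rewrite -expr2 sqr_sqrtr // ltW.
  pose w := x / u; have w0 : w != 0 by rewrite mulf_neq0 // invr_eq0.
  have := closureM (closureM (closure_torus u0) Zg) (closure_torus w0).
  rewrite (mx2_eta g) -/a -/b -/c -/d !mulmx_mx2 !(mulr0, mul0r, addr0, add0r).
  suff -> : mx2 (u * a * w) (u * b * w^-1) (u^-1 * c * w) (u^-1 * d * w^-1) = M x y by [].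
  have yE : y = u * u / x by rewrite uu mulrAC mulfV // mul1r.
  by rewrite /M /w yE; congr mx2; field; rewrite ?u0 ?x0.
have y0 : q / b != 0 by rewrite mulf_neq0 // invr_eq0.
have lM : forall i j, laurent (fun x => M x (q / b) i j).
  apply: laurent_mx2; [|exact: laurent_cst|exact: laurent_cst|];
    apply: laurentM; [exact: laurent_cst|exact: laurent_id|exact: laurent_cst|].
  exact: laurentV.
have <- : M (p / a) (q / b) = s.
  rewrite (mx2_eta s) -/p -/q -/r -/t /M.
  have -> : r = b * c / q by rewrite -qr mulrAC mulfV // mul1r.
  have -> : t = a * d / p by rewrite -sg mulrAC mulfV // mul1r.
  by congr mx2; field; rewrite ?a0 ?b0 ?p0 ?q0.
apply: (@closure_curve (fun x => M x (q / b)) (fun n => n.+1%:R * (q / b)) lM).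
- by move=> m n /(mulIf y0) /eqP; rewrite eqr_nat => /eqP [].
- by move=> n; rewrite mulf_neq0 // pnatr_eq0.
- move=> n; apply: ZM; rewrite -mulrA -expr2 mulr_gt0 ?ltr0n //.
  by rewrite lt_neqAle sqr_ge0 andbT eq_sym sqrf_eq0.
- by rewrite mulf_neq0 // invr_eq0.
Qed.

(* [N_k N_k] meets [N_k'] as soon as the quadratic equation for [tau] below has
   a real root. *)
Lemma closure_step (k k' : R) :
  (forall s, \det s = 1 -> diag_prod s = k -> Z s) ->
  k != 1 -> k != 0 -> k' != 0 -> k' != 1 ->
  0 <= (1 - k') * ((2 * k - 1) ^+ 2 - k') ->
  forall s, \det s = 1 -> diag_prod s = k' -> Z s.
Proof.
move=> Zk k1 k0 k'0 k'1 disc s ds sk'.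
pose A := (k - 1) ^+ 2; pose B := k ^+ 2 + (k - 1) ^+ 2 - k'.
have A0 : A != 0 by rewrite sqrf_eq0 subr_eq0.
pose S := Num.sqrt ((1 - k') * ((2 * k - 1) ^+ 2 - k')).
have SS : S ^+ 2 = B ^+ 2 - 4 * A * k ^+ 2.
  by rewrite sqr_sqrtr // /A /B; ring.
pose t := (S - B) / (2 * A).
have tE : A * t ^+ 2 + B * t + k ^+ 2 = 0.
  have -> : A * t ^+ 2 + B * t + k ^+ 2 = (S ^+ 2 - (B ^+ 2 - 4 * A * k ^+ 2)) / (4 * A).
    by rewrite /t; field; rewrite A0.
  by rewrite SS subrr mul0r.
have t0 : t != 0.
  apply/eqP => t0; move/eqP: tE; rewrite t0 expr0n /= !mulr0 !add0r sqrf_eq0.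
  by rewrite (negbTE k0).
(* Both matrices have determinant 1 and diagonal product [k], and the diagonal product of [s1 *m s2]
   is [k'] exactly when [A t^2 + B t + k^2 = 0]. *)
pose s1 := mx2 t 1 (k - 1) (k / t); pose s2 := mx2 1 (k - 1) 1 k.
have Z12 : Z (s1 *m s2).
  apply: closureM; apply: Zk; rewrite ?det_mx2 /diag_prod ?mx2E; field => //.
have d12 : \det (s1 *m s2) = 1.
  by rewrite det_mulmx !det_mx2; field.
have p12 : diag_prod (s1 *m s2) = k'.
  rewrite /diag_prod mulmx_mx2 !mx2E; apply/eqP; rewrite -subr_eq0.
  have -> : (t * 1 + 1 * 1) * ((k - 1) * (k - 1) + k / t * k) - k' =
     (A * t ^+ 2 + B * t + k ^+ 2) / t by rewrite /A /B; field.
  by rewrite tE mul0r.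
by apply: (closure_cell Z12 d12 ds); rewrite p12.
Qed.

(** The discriminant condition of [closure_step] always admits [k' = -1]; from [k = -1] it admits
    every [k' <= 1], in particular [1/2]; from [k = 1/2] it admits every [k' > 1]. *)
Lemma closure_generic g s : H g -> \det g = 1 -> \det s = 1 ->
  diag_prod g != 0 -> diag_prod g != 1 -> diag_prod s != 0 -> diag_prod s != 1 ->
  Z s.
Proof.
move=> Hg dg ds g0 g1 s0 s1.
have Zg t : \det t = 1 -> diag_prod t = diag_prod g -> Z t.
  by move=> dt e; apply: (closure_cell (closure_incl Hg)).
have Zm1 t : \det t = 1 -> diag_prod t = -1 -> Z t.
  apply: (closure_step Zg) => //; rewrite ?oppr_eq0 ?oner_eq0 ?lt_eqF //.
  apply: mulr_ge0; first lra.
  by rewrite opprK addr_ge0 // sqr_ge0.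
have Zle1 k : k != 0 -> k != 1 -> k <= 1 ->
    forall t, \det t = 1 -> diag_prod t = k -> Z t.
  move=> k0 k1 kle; apply: (closure_step Zm1) => //.
    by rewrite lt_eqF //; lra.
  by apply: mulr_ge0; lra.
have Zhalf t : \det t = 1 -> diag_prod t = 2^-1 -> Z t.
  apply: Zle1; [by rewrite gt_eqF //; lra|by rewrite lt_eqF //; lra|lra].
have [sle|slt] := leP (diag_prod s) 1; first exact: (Zle1 (diag_prod s)).
apply: (closure_step Zhalf _ _ s0 s1 _ ds erefl).
- by rewrite lt_eqF //; lra.
- by rewrite gt_eqF //; lra.
- rewrite mulfV ?pnatr_eq0 // subrr expr0n /= sub0r mulrN -mulNr.
  by apply: mulr_ge0; lra.
Qed.

(** The remaining matrices lie, at [u = 1], on unipotent translates whose points are generic for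
    large [u]. A lower triangular translate first makes the entries of the first column nonzero,
    then an upper triangular one moves the diagonal product away from 0 and 1. The parameter is
    shifted by 1 since [closure_curve] leaves out [u = 0]. *)
Lemma closure_full g s : H g -> \det g = 1 ->
  diag_prod g != 0 -> diag_prod g != 1 -> \det s = 1 -> Z s.
Proof.
move=> Hg dg g0 g1.
have Zgen s' : \det s' = 1 -> diag_prod s' != 0 -> diag_prod s' != 1 -> Z s'.
  by move=> ds s0 s1; exact: (closure_generic Hg).
have avoid (a b e : R) : b != 0 -> exists m : R, 0 <= m /\
    forall x, m < x -> a + b * x != e.
  move=> b0; exists `|(e - a) / b|; split=> // x xm; apply/eqP => E.
  have xE : x = (e - a) / b by rewrite -E addrC addKr mulrC mulKf.
  by move: xm; rewrite xE ltNge ler_norm.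
have shift_inj (m : R) : injective (fun n : nat => m + n.+1%:R).
  by move=> i j /addrI /eqP; rewrite eqr_nat => /eqP[].
have Z1 s' : \det s' = 1 -> s' 0 0 != 0 -> s' 1 0 != 0 -> Z s'.
  move=> ds s00 s10.
  have c0 : s' 0 0 * s' 1 0 != 0 by rewrite mulf_neq0.
  pose M (u : R) := s' *m mx2 1 (u - 1) 0 1.
  have lM : forall i j, laurent (fun u => M u i j).
    move=> i j; rewrite /M; under eq_fun do rewrite mulmx2E.
    apply: laurentD; apply: laurentM; try exact: laurent_cst;
    apply: laurent_mx2; try exact: laurent_cst;
    exact: (laurentD laurent_id (laurent_cst _)).
  have [m0 [m0p av0]] := avoid (s' 0 0 * s' 1 1 - s' 0 0 * s' 1 0) _ 0 c0.
  have [m1 [m1p av1]] := avoid (s' 0 0 * s' 1 1 - s' 0 0 * s' 1 0) _ 1 c0.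
  have pos n : 0 < m0 + m1 + n.+1%:R :> R by rewrite ltr_wpDl ?addr_ge0 ?ltr0n.
  have <- : M 1 = s' by rewrite /M subrr -scalar_mx2 mulmx1.
  apply: (@closure_curve M (fun n => m0 + m1 + n.+1%:R) lM (shift_inj _)).
  - by move=> n; rewrite gt_eqF.
  - move=> n; have n0 : (0 : R) < n.+1%:R by rewrite ltr0n.
    have dE u : diag_prod (M u) =
        s' 0 0 * s' 1 1 - s' 0 0 * s' 1 0 + s' 0 0 * s' 1 0 * u.
      by rewrite /diag_prod /M {1 2}(mx2_eta s') mulmx_mx2 !mx2E; ring.
    apply: Zgen; first by rewrite det_mulmx ds det_mx2; ring.
      by rewrite dE; apply: av0; lra.
    by rewrite dE; apply: av1; lra.
  - exact: oner_neq0.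
move=> ds.
have [k [kp av]] : exists m : R, 0 <= m /\ forall x, m < x ->
    s 0 0 + s 0 1 * (x - 1) != 0 /\ s 1 0 + s 1 1 * (x - 1) != 0.
  have one (a b : R) : (a != 0) || (b != 0) -> exists m : R, 0 <= m /\
      forall x, m < x -> a + b * (x - 1) != 0.
    have [->|b0 _] := eqVneq b 0.
      by rewrite orbF => a0; exists 0; split=> // x _; rewrite mul0r addr0.
    have [m [m0 mE]] := avoid (a - b) b 0 b0; exists m; split=> // x mx.
    by have := mE x mx; rewrite (_ : a + b * (x - 1) = a - b + b * x) //; ring.
  have nz (a b c d : R) : a * d - b * c = 1 -> (a != 0) || (b != 0).
    move=> e; rewrite -negb_and; apply/negP => /andP[/eqP a0 /eqP b0].
    by move/eqP: e; rewrite a0 b0 !mul0r subrr eq_sym oner_eq0.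
  move: ds; rewrite det_mx2E => ds.
  have [m [m0 mE]] := one _ _ (nz _ _ _ _ ds).
  have ds' : s 1 0 * (- s 0 1) - s 1 1 * (- s 0 0) = 1 by rewrite -ds; ring.
  have [m' [m0' mE']] := one _ _ (nz _ _ _ _ ds').
  exists (m + m'); split; first exact: addr_ge0.
  by move=> x xm; split; [apply: mE|apply: mE']; lra.
pose M (u : R) := s *m mx2 1 0 (u - 1) 1.
have lM : forall i j, laurent (fun u => M u i j).
  move=> i j; rewrite /M; under eq_fun do rewrite mulmx2E.
  apply: laurentD; apply: laurentM; try exact: laurent_cst;
  apply: laurent_mx2; try exact: laurent_cst;
  exact: (laurentD laurent_id (laurent_cst _)).
have pos n : 0 < k + n.+1%:R :> R by rewrite ltr_wpDl ?ltr0n.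
have <- : M 1 = s by rewrite /M subrr -scalar_mx2 mulmx1.
apply: (@closure_curve M (fun n => k + n.+1%:R) lM (shift_inj _)).
- by move=> n; rewrite gt_eqF.
- move=> n; have [|e1 e2] := av (k + n.+1%:R); first by rewrite ltrDl ltr0n.
  apply: Z1; first by rewrite det_mulmx ds det_mx2; ring.
    by rewrite /M mulmx2E !mx2E mulr1.
  by rewrite /M mulmx2E !mx2E mulr1.
- exact: oner_neq0.
Qed.

End ZariskiClosure.

Lemma zariski_dense_range (h : UMagmaMorphism.type Gamma2 (SL2 R))
    (rho : UMagmaMorphism.type Gamma2 (PSL2 R)) (x y : Gamma2) (l : R) :
  (forall z, psl2 (h z) = rho z) -> 1 < l -> val (h x) = mx2 l 0 0 l^-1 ->
  diag_prod (val (h y)) != 0 -> diag_prod (val (h y)) != 1 ->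
  zariski_dense (range rho).
Proof.
move=> hrho l1 hx hy0 hy1 P _ PH s.
pose H : set 'M[R]_2 := [set val (h z) | z in setT].
have H1 : H 1%:M by exists 1%g => //; rewrite gmulf1.
have HM a b : H a -> H b -> H (a *m b).
  by move=> [z _ <-] [w _ <-]; exists (z * w)%g => //; rewrite gmulfM.
have Hx : H (mx2 l 0 0 l^-1) by exists x.
have Hy : H (val (h y)) by exists y.
apply: (closure_full H1 HM l1 Hx Hy (SL2_det _) hy0 hy1 (SL2_det s)).
by move=> _ [z _ <-]; apply: PH; exists z => //; rewrite hrho.
Qed.

End ZariskiDensity.

(** * Lifts to the universal cover and the Euler class *)

Section EulerClass.
Context {R : realType}.
Implicit Types (M : 'M[R]_2) (s : SL2 R).

(* Coordinates of [M v] in the orthonormal frame [v = (cos t, sin t)],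
   [v' = (- sin t, cos t)]. *)
Definition rot_u M (t : R) : R :=
  cos t * (M 0 0 * cos t + M 0 1 * sin t) + sin t * (M 1 0 * cos t + M 1 1 * sin t).
Definition rot_w M (t : R) : R :=
  cos t * (M 1 0 * cos t + M 1 1 * sin t) - sin t * (M 0 0 * cos t + M 0 1 * sin t).

(** If [rot_u M t > 0], the angle from [v] to [M v] is smaller than [pi / 2] in absolute value and
    equals this arctangent, so no branch has to be chosen. *)
Definition rot_lift M (t : R) : R := t + atan (rot_w M t / rot_u M t).

(* The symmetric part of [M] is positive definite. *)
Definition rot_pos M : Prop :=
  0 < \tr M /\ (M 0 1 + M 1 0) ^+ 2 < 4 * (M 0 0 * M 1 1).

Lemma rot_pos_u M t : rot_pos M -> 0 < rot_u M t.
Proof.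
move=> []; rewrite tr_mx2E; set a := M 0 0; set b := M 0 1.
set c := M 1 0; set d := M 1 1 => tr0 disc.
have ad0 : 0 < 4 * (a * d) by exact: le_lt_trans (sqr_ge0 _) disc.
have a0 : 0 < a by nra.
have key : 4 * a * rot_u M t =
    (2 * a * cos t + (b + c) * sin t) ^+ 2 + (4 * (a * d) - (b + c) ^+ 2) * sin t ^+ 2.
  by rewrite /rot_u -/a -/b -/c -/d; ring.
rewrite -(pmulr_rgt0 _ (_ : 0 < 4 * a)); last by rewrite mulr_gt0.
rewrite key; have [s0|s0] := eqVneq (sin t) 0.
  have c1 : cos t ^+ 2 = 1 by have := cos2Dsin2 t; rewrite s0 expr0n addr0.
  rewrite s0 expr0n !mulr0 !addr0 exprMn c1 mulr1 exprn_gt0 //.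
  by rewrite mulr_gt0.
apply: ltr_wpDl; first exact: sqr_ge0.
by rewrite mulr_gt0 ?subr_gt0 // lt_neqAle sqr_ge0 andbT eq_sym sqrf_eq0.
Qed.

Lemma rot_pos_adj M : rot_pos M -> rot_pos (adj2 M).
Proof.
move=> [t0 d0]; split; first by move: t0; rewrite !tr_mx2E !mx2E addrC.
by move: d0; rewrite !mx2E -opprD sqrrN [M 1 1 * _]mulrC.
Qed.

Lemma eq_col2 (v w : 'cV[R]_2) : v 0 0 = w 0 0 -> v 1 0 = w 1 0 -> v = w.
Proof.
move=> e0 e1; apply/matrixP => i j; rewrite (ord1 j).
by case: (ord2P i) => ->.
Qed.

Lemma mulmx2_col M (v : 'cV[R]_2) i : (M *m v) i 0 = M i 0 * v 0 0 + M i 1 * v 1 0.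
Proof. by rewrite mxE big_ord_recl big_ord1 (_ : lift _ _ = 1) //; apply/val_inj. Qed.

Lemma rot_liftP M t : 0 < rot_u M t ->
  exists c : R, M *m line_vec t = c *: line_vec (rot_lift M t).
Proof.
move=> u0; set th := atan (rot_w M t / rot_u M t).
have cth : 0 < cos th by rewrite cos_gt0_pihalf // atan_gtNpi2 atan_ltpi2.
exists (rot_u M t / cos th).
have sth : sin th = rot_w M t / rot_u M t * cos th.
  by rewrite -[rot_w _ _ / _]atanK /tan divfK // gt_eqF.
have cs : cos t ^+ 2 + sin t ^+ 2 = 1 by exact: cos2Dsin2.
have e1 : rot_u M t / cos th * cos th = rot_u M t by rewrite divfK // gt_eqF.
have e2 : rot_u M t / cos th * sin th = rot_w M t.
  by rewrite sth; field; rewrite !gt_eqF.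
apply: eq_col2; rewrite mulmx2_col !mxE /= /rot_lift -/th ?cosD ?sinD.
  rewrite mulrBr mulrCA e1 mulrCA e2 /rot_u /rot_w.
  rewrite -[LHS]mulr1 -cs; ring.
rewrite mulrDr mulrCA e1 mulrCA e2 /rot_u /rot_w.
rewrite -[LHS]mulr1 -cs; ring.
Qed.

Lemma line_vec_parallel (k t t' : R) :
  line_vec t = k *: line_vec t' -> sin (t' - t) = 0.
Proof.
move=> /matrixP e; have := e 0 0; have := e 1 0; rewrite !mxE /= => es ec.
by rewrite sinB ec es; ring.
Qed.

Lemma sin_eq0_lt_pi (x : R) : sin x = 0 -> `|x| < pi -> x = 0.
Proof.
move=> s0 xpi; apply: contrapT => /eqP x0.
have [xp|xn|xn] := ltgtP x 0; last by rewrite xn eqxx in x0.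
  have : 0 < sin (- x) by rewrite sin_gt0_pi // oppr_gt0 xp -[- x]ltr0_norm.
  by rewrite sinN s0 oppr0 ltxx.
have : 0 < sin x by rewrite sin_gt0_pi // xn -[x]gtr0_norm.
by rewrite s0 ltxx.
Qed.

Lemma rot_lift_dist M t : `|rot_lift M t - t| < pi / 2.
Proof. by rewrite /rot_lift addrC addKr ltr_norml atan_gtNpi2 atan_ltpi2. Qed.

(** The composite fixes every line, so it moves [t] by a multiple of [pi]; each of the two maps
    moves it by less than [pi / 2]. *)
Lemma rot_liftK M : \det M = 1 -> rot_pos M ->
  cancel (rot_lift M) (rot_lift (adj2 M)).
Proof.
move=> dM pM t; apply/eqP; rewrite -subr_eq0; apply/eqP; apply: sin_eq0_lt_pi.
  have [c cE] := rot_liftP (rot_pos_u t pM).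
  have [d dE] := rot_liftP (rot_pos_u (rot_lift M t) (rot_pos_adj pM)).
  apply: (line_vec_parallel (k := c * d)).
  by rewrite -scalerA -dE scalemxAr -cE mulmxA mul_adj2mx dM mul1mx.
have -> : (pi : R) = pi / 2 + pi / 2 by field.
rewrite -[X in `|X|](subrKA (rot_lift M t)).
by apply: le_lt_trans (ler_normD _ _) _; rewrite ltrD // rot_lift_dist.
Qed.

Lemma rot_lift_continuous_for (T : topologicalType) (p : T) (A : T -> 'M[R]_2)
    (y : T -> R) :
  (forall i j, {for p, continuous (fun x => A x i j)}) -> {for p, continuous y} ->
  0 < rot_u (A p) (y p) -> {for p, continuous (fun x => rot_lift (A x) (y x))}.
Proof.
move=> cA cy u0.
have cc : {for p, continuous (fun x => cos (y x))}.
  by apply: continuous_comp => //; exact: continuous_cos.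
have cs : {for p, continuous (fun x => sin (y x))}.
  by apply: continuous_comp => //; exact: continuous_sin.
have c0 : {for p, continuous (fun x => A x 0 0 * cos (y x) + A x 0 1 * sin (y x))}.
  by apply: cvgD; apply: cvgM => //; exact: cA.
have c1 : {for p, continuous (fun x => A x 1 0 * cos (y x) + A x 1 1 * sin (y x))}.
  by apply: cvgD; apply: cvgM => //; exact: cA.
have cu : {for p, continuous (fun x => rot_u (A x) (y x))}.
  by apply: cvgD; exact: cvgM.
have cw : {for p, continuous (fun x => rot_w (A x) (y x))}.
  by apply: cvgB; exact: cvgM.
apply: cvgD => //.
apply: (@continuous_comp _ _ _ (fun x => rot_w (A x) (y x) / rot_u (A x) (y x)) atan).
  apply: cvgM => //; apply: cvgV => //; by rewrite gt_eqF.
exact: continuous_atan.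
Qed.

Lemma eq_continuous_for (T : topologicalType) (p : T) (f g : T -> R) :
  f =1 g -> {for p, continuous f} -> {for p, continuous g}.
Proof. by move=> /funext ->. Qed.

Lemma continuous_adj2 (T : topologicalType) (p : T) (A : T -> 'M[R]_2) :
  (forall i j, {for p, continuous (fun x => A x i j)}) ->
  forall i j, {for p, continuous (fun x => adj2 (A x) i j)}.
Proof.
move=> cA i j; case: (ord2P i) => ->; case: (ord2P j) => ->.
- by apply: (@eq_continuous_for _ _ (fun x => A x 1 1)) => // x; rewrite mx2E.
- apply: (@eq_continuous_for _ _ (fun x => - A x 0 1)).
    by move=> x; rewrite mx2E.
  by apply: cvgN; exact: cA.
- apply: (@eq_continuous_for _ _ (fun x => - A x 1 0)).
    by move=> x; rewrite mx2E.
  by apply: cvgN; exact: cA.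
- by apply: (@eq_continuous_for _ _ (fun x => A x 0 0)) => // x; rewrite mx2E.
Qed.

Lemma rot_lift_continuous M : rot_pos M -> continuous (rot_lift M).
Proof.
move=> pM t; apply: (@rot_lift_continuous_for R t (fun=> M) id).
- by move=> i j; exact: cst_continuous.
- exact: cvg_id.
- exact: rot_pos_u.
Qed.

Section Tilde.
Variables (s : SL2 R) (ps : rot_pos (val s)).

Lemma rot_tilde_subproof :
  cancel (rot_lift (adj2 (val s))) (rot_lift (val s)).
Proof.
rewrite -{2}[val s]adj2K; apply: rot_liftK; last exact: rot_pos_adj.
by rewrite det_adj2 SL2_det.
Qed.

Definition rot_tilde : psl2_tilde R :=
  PSL2Tilde (rot_liftK (SL2_det s) ps) rot_tilde_subproof
    (rot_lift_continuous ps) (rot_lift_continuous (rot_pos_adj ps))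
    (lifts_actionP (fun t => rot_liftP (rot_pos_u t ps))).

End Tilde.

Definition rel_lift (M : generator -> 'M[R]_2) (t : R) : R :=
  rot_lift (M A1) (rot_lift (M B1)
 (rot_lift (adj2 (M A1)) (rot_lift (adj2 (M B1))
 (rot_lift (M A2) (rot_lift (M B2)
 (rot_lift (adj2 (M A2)) (rot_lift (adj2 (M B2)) t))))))).

(** [F t - t] is continuous with values in the multiples of [pi], hence constant, and its value at 0
    is too small not to be 0. *)
Lemma lift_of_one (F : R -> R) : lifts_action (1%g : PSL2 R) F ->
  continuous F -> `|F 0| < pi -> F = id.
Proof.
move=> lF cF F0.
have sF t : sin (F t - t) = 0.
  have [c] := lF 1%g erefl t; rewrite mul1mx; exact: line_vec_parallel.
have F00 : F 0 = 0.
  by apply: sin_eq0_lt_pi => //; have := sF 0; rewrite subr0.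
pose G t := F t - t.
have cG : continuous G by move=> t; apply: cvgB; [exact: cF|exact: cvg_id].
have G0 : G 0 = 0 by rewrite /G F00 subrr.
apply/funext => t; apply/eqP; rewrite -subr_eq0; apply/eqP; rewrite -/(G t).
apply: contrapT => /eqP Gt.
have Gpi : pi <= `|G t|.
  rewrite leNgt; apply/negP => Gpi; move/eqP: Gt; apply.
  exact: sin_eq0_lt_pi (sF t) Gpi.
have pi0 : 0 < (pi : R) by exact: pi_gt0.
(* A value between [G 0 = 0] and [G t] whose sine is not 0; the intermediate value theorem would
   make [G] attain it. *)
have [v vE [vs vI]] : exists2 v : R, sin v != 0 &
    (Num.min 0 (G t) <= v <= Num.max 0 (G t)) /\ v != 0.
  have [Gp|Gn|G00] := ltgtP 0 (G t); last by rewrite -G00 eqxx in Gt.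
    exists (pi / 2); first by rewrite sin_pihalf oner_neq0.
    split; last by rewrite gt_eqF // divr_gt0.
    by move: Gpi; rewrite gtr0_norm // => ?; apply/andP; split; lra.
  exists (- (pi / 2)); first by rewrite sinN sin_pihalf oppr_eq0 oner_neq0.
  split; last by rewrite oppr_eq0 gt_eqF // divr_gt0.
  by move: Gpi; rewrite ltr0_norm // => ?; apply/andP; split; lra.
have [c Gc] : exists c, G c = v.
  have [t0|t0] := leP 0 t.
    have [||c _ Gc] := @IVT R G 0 t v t0; last by exists c.
      by apply: continuous_subspaceT.
    by rewrite G0.
  have [||c _ Gc] := @IVT R G t 0 v (ltW t0); last by exists c.
    by apply: continuous_subspaceT.
  by rewrite G0 minC maxC.
by move: vE; rewrite -Gc sF eqxx.
Qed.

Lemma euler_class0 (rho : rep R) (s : generator -> SL2 R) :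
  (forall x, rho (gen x) = psl2 (s x)) -> (forall x, rot_pos (val (s x))) ->
  `|rel_lift (fun x => val (s x)) 0| < pi -> euler_class rho 0.
Proof.
move=> rs ps rl.
exists (rot_tilde (ps A1)), (rot_tilde (ps B1)), (rot_tilde (ps A2)), (rot_tilde (ps B2)).
split; try by rewrite /= rs.
set T := surface_relator _ _ _ _.
have TE : tilde_fun T = rel_lift (fun x => val (s x)) by [].
have T1 : tilde_proj T = 1%g.
  transitivity (rho (surface_relator (gen A1) (gen B1) (gen A2) (gen B2))).
    by rewrite /surface_relator /commutator !(gmulfM, gmulfV) !rs.
  by rewrite Gamma2_relation gmulf1.
have -> : tilde_fun T = id.
  apply: lift_of_one; first by rewrite -T1; exact: tilde_lifts.
    exact: tilde_fun_continuous.
  by rewrite TE.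
by apply/funext => t; rewrite mul0r addr0.
Qed.

Lemma rel_lift_near (T : topologicalType) (p : T) (M : T -> generator -> 'M[R]_2) :
  (forall g i j, {for p, continuous (fun x => M x g i j)}) ->
  (forall g, rot_pos (M p g)) -> (forall g, \det (M p g) = 1) ->
  M p A2 = M p B1 -> M p B2 = M p A1 ->
  \forall x \near p, (forall g, rot_pos (M x g)) /\ `|rel_lift (M x) 0| < pi.
Proof.
move=> cM pM dM e1 e2.
have cadj g i j : {for p, continuous (fun x => adj2 (M x g) i j)}.
  by apply: continuous_adj2 => a b; exact: cM.
have near_pos g : \forall x \near p, rot_pos (M x g).
  have [t0 d0] := pM g.
  have c1 : {for p, continuous (fun x => \tr (M x g))}.
    apply: (@eq_continuous_for _ _ (fun x => M x g 0 0 + M x g 1 1)).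
      by move=> x; rewrite tr_mx2E.
    by apply: cvgD; exact: cM.
  have c2 : {for p, continuous (fun x => 4 * (M x g 0 0 * M x g 1 1) -
      (M x g 0 1 + M x g 1 0) ^+ 2)}.
    apply: (@eq_continuous_for _ _ (fun x => 4 * (M x g 0 0 * M x g 1 1) -
        (M x g 0 1 + M x g 1 0) * (M x g 0 1 + M x g 1 0))) => //.
    apply: cvgB; last by apply: cvgM; apply: cvgD; exact: cM.
    by apply: cvgM; [exact: cvg_cst|apply: cvgM; exact: cM].
  have n1 : \forall x \near p, 0 < \tr (M x g).
    exact: (c1 _ (open_nbhs_nbhs (conj open_gt0 t0))).
  have n2 : \forall x \near p, 0 < 4 * (M x g 0 0 * M x g 1 1) -
      (M x g 0 1 + M x g 1 0) ^+ 2.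
    by apply: (c2 _ (open_nbhs_nbhs (conj open_gt0 _))); rewrite /= subr_gt0.
  near=> x; split; first by near: x.
  by rewrite -subr_gt0; near: x.
have cl : {for p, continuous (fun x => rel_lift (M x) 0)}.
  rewrite /rel_lift.
  do 8?[apply: rot_lift_continuous_for;
    [first [exact: cM|exact: cadj]| |apply: rot_pos_u; first [exact: pM|exact/rot_pos_adj/pM]]].
  exact: cst_continuous.
(* At [p] the second commutator is the inverse of the first, so the eight lifts cancel in pairs. *)
have l0 : rel_lift (M p) 0 = 0.
  rewrite /rel_lift e1 e2.
  have K g t : rot_lift (M p g) (rot_lift (adj2 (M p g)) t) = t.
    rewrite -{1}[M p g]adj2K; apply: rot_liftK; last exact: rot_pos_adj.
    by rewrite det_adj2.
  have K' g t : rot_lift (adj2 (M p g)) (rot_lift (M p g) t) = t.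
    exact: rot_liftK.
  by rewrite (K' B1) (K' A1) (K B1) (K A1).
have nl : \forall x \near p, `|rel_lift (M x) 0| < pi.
  have nb : \forall x \near p, ball (rel_lift (M p) 0) pi (rel_lift (M x) 0).
    exact: (cl _ (nbhsx_ballx _ _ (pi_gt0 R))).
  by move: nb; apply: filterS => x; rewrite l0 /ball /= sub0r normrN.
have [[[n1 n2] n3] n4] := (near_pos A1, near_pos B1, near_pos A2, near_pos B2).
near=> x; split; last by near: x.
by case; near: x.
Unshelve. all: by end_near. Qed.

End EulerClass.

(** * A slice of the representation variety *)

Section Slice.
Context {R : realType}.

(* Solutions [N] of [N A = A' N] form a plane if [A] and [A'] have the same
   characteristic polynomial; this one has first row proportional to [(1, t)]. *)
Definition transporter (A A' : 'M[R]_2) (t : R) : 'M[R]_2 :=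
  mx2 (A' 0 1) (A' 0 1 * t)
      (A 0 0 + t * A 1 0 - A' 0 0) (A 0 1 + t * A 1 1 - t * A' 0 0).

Lemma transporterP A A' t : \tr A = \tr A' -> \det A = \det A' ->
  transporter A A' t *m A = A' *m transporter A A' t.
Proof.
rewrite !tr_mx2E !det_mx2E /transporter.
rewrite [in X in _ *m X = _](mx2_eta A) [in X in _ = X *m _](mx2_eta A').
set p := A 0 0; set q := A 0 1; set r := A 1 0; set s := A 1 1.
set p' := A' 0 0; set q' := A' 0 1; set r' := A' 1 0; set s' := A' 1 1.
move=> tE dE.
have sE : s' = p + s - p' by rewrite tE addrC addKr.
have qE : r' * q' = p' * s' - (p * s - q * r) by rewrite dE; ring.
rewrite mulmx_mx2 [RHS]mulmx_mx2; congr mx2; try ring.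
  apply/eqP; rewrite -subr_eq0; apply/eqP.
  transitivity ((p' * s' - (p * s - q * r)) - r' * q'); last by rewrite qE subrr.
  by rewrite sE; ring.
apply/eqP; rewrite -subr_eq0; apply/eqP.
transitivity (t * ((p' * s' - (p * s - q * r)) - r' * q')); last by rewrite qE; ring.
by rewrite sE; ring.
Qed.

(** The first row of the equation, divided by [A' 0 1], expresses the second row of [N] through the
    first. *)
Lemma transporter_uniq (A A' N : 'M[R]_2) : A' 0 1 != 0 -> N 0 0 != 0 ->
  N *m A = A' *m N -> N = (N 0 0 / A' 0 1) *: transporter A A' (N 0 1 / N 0 0).
Proof.
move=> q0 u0 /matrixP NA.
have := NA 0 0; have := NA 0 1; rewrite !mulmx2E => e1 e0.
have wE : N 1 0 = (N 0 0 * A 0 0 + N 0 1 * A 1 0 - A' 0 0 * N 0 0) / A' 0 1.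
  by rewrite e0 addrC addKr mulrC mulKf.
have zE : N 1 1 = (N 0 0 * A 0 1 + N 0 1 * A 1 1 - A' 0 0 * N 0 1) / A' 0 1.
  by rewrite e1 addrC addKr mulrC mulKf.
apply: eq_mx2; rewrite mxE /transporter mx2E ?wE ?zE; field; rewrite ?q0 ?u0 //.
Qed.

Implicit Types (x : R6 R).

Definition xl x : R := x.1.1.1.1.1.
Definition xa x : R := x.1.1.1.1.2.
Definition xc x : R := x.1.1.1.2.
Definition xp x : R := x.1.1.2.
Definition xr x : R := x.1.2.
Definition xt x : R := x.2.

(* A representation is normalized by [A1 = diag(l, 1/l)] and by the entry 1 of
   [B1]. The relation says that [B2] conjugates [A2] to [A2' = [A1, B1] A2], so
   the second column [(q, s)] of [A2] is determined by [det A2 = 1] and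
   [tr A2' = tr A2], and [B2] by one more parameter [t]. *)
Definition sec_d x : R := (1 + xc x) / xa x.
(** The trace condition reads [s = l^2 p - (a l^2 / c) r + d q]; inserted into [p s - q r = 1] it
    leaves a linear equation for [q] with coefficient [sec_m]. *)
Definition sec_m x : R := sec_d x * xp x - xr x.
Definition sec_q x : R :=
  (1 - xl x * xl x * (xp x * xp x) + xa x * (xl x * xl x) / xc x * (xp x * xr x)) / sec_m x.
Definition sec_s x : R :=
  xl x * xl x * xp x - xa x * (xl x * xl x) / xc x * xr x + sec_d x * sec_q x.

Definition sec_A1 x : 'M[R]_2 := mx2 (xl x) 0 0 (xl x)^-1.
Definition sec_B1 x : 'M[R]_2 := mx2 (xa x) 1 (xc x) (sec_d x).
Definition sec_A2 x : 'M[R]_2 := mx2 (xp x) (sec_q x) (xr x) (sec_s x).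
Definition sec_A2' x : 'M[R]_2 :=
  sec_A1 x *m sec_B1 x *m adj2 (sec_A1 x) *m adj2 (sec_B1 x) *m sec_A2 x.
Definition sec_N x : 'M[R]_2 := transporter (sec_A2 x) (sec_A2' x) (xt x).
Definition sec_B2 x : 'M[R]_2 := (Num.sqrt (\det (sec_N x)))^-1 *: sec_N x.

Definition sec_gen x (g : generator) : 'M[R]_2 :=
  match g with A1 => sec_A1 x | B1 => sec_B1 x | A2 => sec_A2 x | B2 => sec_B2 x end.

Definition sec x : M4 R := (sec_A1 x, sec_B1 x, sec_A2 x, sec_B2 x).

(** The positive traces single out one of the two lifts of each generator; [good_c] and [good_d]
    keep the diagonal product [1 + xc x] of [sec_B1 x] away from 1 and 0, as Zariski density
    requires. *)
Record good x : Prop := Good {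
  good_l : 1 < xl x;
  good_a : 0 < xa x;
  good_c : xc x != 0;
  good_d : 1 + xc x != 0;
  good_m : 0 < sec_m x;
  good_q : 0 < sec_A2' x 0 1;
  good_N : 0 < \det (sec_N x);
  good_tB1 : 0 < \tr (sec_B1 x);
  good_tA2 : 0 < \tr (sec_A2 x);
  good_tN : 0 < \tr (sec_N x) }.

Section Good.
Variables (x : R6 R) (gx : good x).

Let l0 : xl x != 0.
Proof. by rewrite gt_eqF // (lt_trans ltr01) // good_l. Qed.
Let a0 : xa x != 0. Proof. by rewrite gt_eqF // good_a. Qed.
Let c0 : xc x != 0. Proof. exact: good_c. Qed.
Let m0 : sec_m x != 0. Proof. by rewrite gt_eqF // good_m. Qed.

Lemma det_sec_A1 : \det (sec_A1 x) = 1.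
Proof. by rewrite det_mx2; field. Qed.

Lemma det_sec_B1 : \det (sec_B1 x) = 1.
Proof. by rewrite det_mx2 /sec_d; field. Qed.

Lemma sec_mq : sec_m x * sec_q x =
  1 - xl x * xl x * (xp x * xp x) + xa x * (xl x * xl x) / xc x * (xp x * xr x).
Proof. by rewrite mulrC divfK. Qed.

Lemma det_sec_A2 : \det (sec_A2 x) = 1.
Proof.
rewrite det_mx2 /sec_s.
transitivity (xl x * xl x * (xp x * xp x) -
  xa x * (xl x * xl x) / xc x * (xp x * xr x) + sec_m x * sec_q x).
  by rewrite /sec_m; ring.
by rewrite sec_mq; ring.
Qed.

Lemma det_sec_A2' : \det (sec_A2' x) = 1.
Proof.
by rewrite !det_mulmx !det_adj2 det_sec_A1 det_sec_B1 det_sec_A2 !mulr1.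
Qed.

Lemma tr_sec_A2' : \tr (sec_A2' x) = \tr (sec_A2 x).
Proof.
rewrite /sec_A2' /sec_A1 /sec_B1 /sec_A2 /sec_s.
move: (sec_q x) => q; rewrite !mx2_simpl /sec_d; field.
by rewrite l0 a0 c0.
Qed.

Lemma sec_NP : sec_N x *m sec_A2 x = sec_A2' x *m sec_N x.
Proof.
by apply: transporterP; rewrite ?tr_sec_A2' // det_sec_A2 det_sec_A2'.
Qed.

Lemma sec_B2P : sec_B2 x *m sec_A2 x = sec_A2' x *m sec_B2 x.
Proof. by rewrite -scalemxAl -scalemxAr sec_NP. Qed.

Lemma sqrt_sec_N : 0 < Num.sqrt (\det (sec_N x)).
Proof. by rewrite sqrtr_gt0 good_N. Qed.

Lemma det_sec_B2 : \det (sec_B2 x) = 1.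
Proof.
rewrite detZ exprVn sqr_sqrtr ?mulVf //; first by rewrite gt_eqF // good_N.
exact: ltW (good_N gx).
Qed.

Lemma det_sec_gen g : \det (sec_gen x g) = 1.
Proof.
case: g; [exact: det_sec_A1|exact: det_sec_B1|exact: det_sec_A2|exact: det_sec_B2].
Qed.

Definition sec_sl2 (g : generator) : SL2 R := mkSL2 (det_sec_gen g).

Lemma sec_rel :
  surface_relator (sec_sl2 A1) (sec_sl2 B1) (sec_sl2 A2) (sec_sl2 B2) = 1%g.
Proof.
apply/val_inj; rewrite /surface_relator /commutator !(val_SL2M, val_SL2V) /= !mulmxA.
rewrite -/(sec_A2' x) -sec_B2P -mulmxA -mulmxA [sec_A2 x *m _]mulmxA mulmx_adj2.
by rewrite det_sec_A2 mul1mx mulmx_adj2 det_sec_B2.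
Qed.

End Good.

(** * Conjugation invariant coordinates *)

Implicit Types (A : M4 R).

Definition co_t A : R := \tr A.1.1.1.
Definition co_w A : R := Num.sqrt (co_t A * co_t A - 4).
Definition co_l A : R := (co_t A + co_w A) / 2.
(* The spectral projectors of the first matrix. *)
Definition co_E A : 'M[R]_2 :=
  (co_w A)^-1 *: (A.1.1.1 - ((co_t A - co_w A) / 2)%:M).
Definition co_F A : 'M[R]_2 := (co_w A)^-1 *: ((co_l A)%:M - A.1.1.1).
Definition co_a A : R := \tr (co_E A *m A.1.1.2).
Definition co_c A : R := \tr (co_E A *m A.1.1.2 *m co_F A *m A.1.1.2).
Definition co_p A : R := \tr (co_E A *m A.1.2).
Definition co_r A : R := \tr (co_E A *m A.1.1.2 *m co_F A *m A.1.2).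
Definition co_u A : R := \tr (co_E A *m A.2).
Definition co_tau A : R :=
  \tr (co_F A *m A.1.1.2 *m co_E A *m A.2) / (co_c A * co_u A).

(** The parameters of the normal form, written as traces of products with the spectral projectors.
    They need no normalization, which makes them conjugation invariant, and they are smooth on
    [coords_dom] below. *)
Definition coords A : R6 R := (co_l A, co_a A, co_c A, co_p A, co_r A, co_tau A).

Definition conj4 (S T : 'M[R]_2) A : M4 R :=
  (S *m A.1.1.1 *m T, S *m A.1.1.2 *m T, S *m A.1.2 *m T, S *m A.2 *m T).

Section Conj.
Variables (S T : 'M[R]_2) (TS : T *m S = 1%:M) (ST : S *m T = 1%:M).

Lemma tr_conj M : \tr (S *m M *m T) = \tr M.
Proof. by rewrite mxtrace_mulC mulmxA TS mul1mx. Qed.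

Lemma mul_conj M N : S *m M *m T *m (S *m N *m T) = S *m (M *m N) *m T.
Proof. by rewrite !mulmxA -[S *m M *m T *m S]mulmxA TS mulmx1. Qed.

Lemma scalar_conj (k : R) : S *m k%:M *m T = k%:M.
Proof. by rewrite mul_mx_scalar -scalemxAl ST scalemx1. Qed.

Lemma co_t_conj A : co_t (conj4 S T A) = co_t A. Proof. exact: tr_conj. Qed.
Lemma co_w_conj A : co_w (conj4 S T A) = co_w A.
Proof. by rewrite /co_w co_t_conj. Qed.
Lemma co_l_conj A : co_l (conj4 S T A) = co_l A.
Proof. by rewrite /co_l co_t_conj co_w_conj. Qed.

Lemma co_E_conj A : co_E (conj4 S T A) = S *m co_E A *m T.
Proof.
rewrite /co_E co_t_conj co_w_conj -scalemxAr -scalemxAl; congr (_ *: _).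
by rewrite mulmxBr mulmxBl scalar_conj.
Qed.

Lemma co_F_conj A : co_F (conj4 S T A) = S *m co_F A *m T.
Proof.
rewrite /co_F co_l_conj co_w_conj -scalemxAr -scalemxAl; congr (_ *: _).
by rewrite mulmxBr mulmxBl scalar_conj.
Qed.

Lemma co_u_conj A : co_u (conj4 S T A) = co_u A.
Proof. by rewrite /co_u co_E_conj mul_conj tr_conj. Qed.

Lemma coords_conj A : coords (conj4 S T A) = coords A.
Proof.
have cc : co_c (conj4 S T A) = co_c A.
  by rewrite /co_c co_E_conj co_F_conj !mul_conj tr_conj.
rewrite /coords cc co_l_conj; congr (_, _, _, _, _, _).
- by rewrite /co_a co_E_conj mul_conj tr_conj.
- by rewrite /co_p co_E_conj mul_conj tr_conj.
- by rewrite /co_r co_E_conj co_F_conj !mul_conj tr_conj.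
- by rewrite /co_tau cc co_u_conj co_E_conj co_F_conj !mul_conj tr_conj.
Qed.

End Conj.

Section Diagonal.
Variables (l : R) (l1 : 1 < l) (B A2 B2 : 'M[R]_2).
Let A : M4 R := (mx2 l 0 0 l^-1, B, A2, B2).

Let l0 : l != 0. Proof. by rewrite gt_eqF // (lt_trans ltr01). Qed.

Lemma diag_gap : 0 < l - l^-1.
Proof. by rewrite subr_gt0 (lt_trans _ l1) // invf_lt1 // (lt_trans ltr01). Qed.

Lemma diag_w : co_w A = l - l^-1.
Proof.
rewrite /co_w /co_t /= tr_mx2 (_ : _ - 4 = (l - l^-1) ^+ 2); last by field.
by rewrite sqrtr_sqr gtr0_norm // diag_gap.
Qed.

Lemma diag_l : co_l A = l.
Proof. by rewrite /co_l diag_w /co_t /= tr_mx2; field. Qed.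

Lemma diag_E : co_E A = mx2 1 0 0 0.
Proof.
have g0 : l - l^-1 != 0 by rewrite gt_eqF // diag_gap.
rewrite /co_E diag_w /co_t /= !mx2_simpl.
have -> : (l + l^-1 - (l - l^-1)) / 2 = l^-1 by field.
by rewrite !subr0 subrr !mulr0 mulVf.
Qed.

Lemma diag_F : co_F A = mx2 0 0 0 1.
Proof.
have g0 : l - l^-1 != 0 by rewrite gt_eqF // diag_gap.
by rewrite /co_F diag_w diag_l /= !mx2_simpl !subr0 subrr !mulr0 mulVf.
Qed.

Lemma diag_u : co_u A = B2 0 0.
Proof.
by rewrite /co_u diag_E /= [in LHS](mx2_eta B2) !mx2_simpl; ring.
Qed.

Lemma diag_coords : coords A = (l, B 0 0, B 0 1 * B 1 0, A2 0 0, B 0 1 * A2 1 0,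
  B 1 0 * B2 0 1 / (B 0 1 * B 1 0 * B2 0 0)).
Proof.
have cc : co_c A = B 0 1 * B 1 0.
  by rewrite /co_c diag_E diag_F /= [in LHS](mx2_eta B) !mx2_simpl; ring.
rewrite /coords diag_l cc; congr (_, _, _, _, _, _).
- by rewrite /co_a diag_E /= [in LHS](mx2_eta B) !mx2_simpl; ring.
- by rewrite /co_p diag_E /= [in LHS](mx2_eta A2) !mx2_simpl; ring.
- rewrite /co_r diag_E diag_F /= [in LHS](mx2_eta A2) [in LHS](mx2_eta B) !mx2_simpl.
  by ring.
- rewrite /co_tau cc diag_u diag_E diag_F /=; congr (_ / _).
  by rewrite [in LHS](mx2_eta B2) [in LHS](mx2_eta B) !mx2_simpl; ring.
Qed.

End Diagonal.

Lemma coords_sec x : good x -> coords (sec x) = x.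
Proof.
move=> gx; rewrite /sec /sec_A1 diag_coords ?good_l // /sec_B1 /sec_A2 !mx2E !mul1r.
have c0 := good_c gx.
have q0 : sec_A2' x 0 1 != 0 by rewrite gt_eqF // good_q.
have s0 : (Num.sqrt (\det (sec_N x)))^-1 != 0.
  by rewrite invr_eq0 gt_eqF // sqrt_sec_N.
have -> : xc x * sec_B2 x 0 1 / (xc x * sec_B2 x 0 0) = xt x.
  have -> : sec_B2 x 0 0 = (Num.sqrt (\det (sec_N x)))^-1 * sec_A2' x 0 1.
    by rewrite mxE mx2_00.
  have -> : sec_B2 x 0 1 = (Num.sqrt (\det (sec_N x)))^-1 * (sec_A2' x 0 1 * xt x).
    by rewrite mxE mx2_01.
  move: (sec_A2' x 0 1) (xc x) (xt x) (_^-1) q0 c0 s0 => q c t w q0 c0 w0.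
  by field; rewrite q0 w0 c0.
by case: x {gx c0 q0 s0} => [[[[[]]]]].
Qed.

Lemma co_u_sec x : good x -> 0 < co_u (sec x).
Proof.
move=> gx; rewrite /sec /sec_A1 diag_u ?good_l // /sec_B2 mxE /sec_N mx2E.
by rewrite mulr_gt0 ?good_q // invr_gt0 sqrt_sec_N.
Qed.

Lemma tr_sec_gen x g : good x -> 0 < \tr (sec_gen x g).
Proof.
move=> gx; have l0 : 0 < xl x by rewrite (lt_trans ltr01) // good_l.
case: g => /=.
- by rewrite tr_mx2 addr_gt0 ?invr_gt0.
- exact: good_tB1.
- exact: good_tA2.
- by rewrite mxtraceZ mulr_gt0 ?invr_gt0 ?sqrt_sec_N // good_tN.
Qed.

Definition rel4 A : 'M[R]_2 :=
  A.1.1.1 *m A.1.1.2 *m adj2 A.1.1.1 *m adj2 A.1.1.2 *m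
  (A.1.2 *m A.2 *m adj2 A.1.2 *m adj2 A.2).

Definition sl4 A : Prop :=
  [/\ \det A.1.1.1 = 1, \det A.1.1.2 = 1, \det A.1.2 = 1 & \det A.2 = 1].

(** In normal form the determinant of [B] gives its last entry, the trace condition and
    [\det A2 = 1] give the second column of [A2], and [transporter_uniq] gives [B2] up to a factor,
    fixed by [\det B2 = 1] and the sign of [co_u]. *)
Lemma sec_coords_normal (l : R) (B A2 B2 : 'M[R]_2) : 1 < l -> B 0 1 = 1 ->
  let A : M4 R := (mx2 l 0 0 l^-1, B, A2, B2) in
  sl4 A -> rel4 A = 1%:M -> good (coords A) -> 0 < co_u A -> sec (coords A) = A.
Proof.
move=> l1 b1 A [/= _ dB dA2 dB2] rel gA u0.
have l0 : l != 0 by rewrite gt_eqF // (lt_trans ltr01).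
have e := diag_coords l1 B A2 B2; rewrite -/A b1 !mul1r in e.
rewrite /A diag_u // in u0.
have u0' : B2 0 0 != 0 by rewrite gt_eqF.
set x := coords A in e gA *; have c0 := good_c gA; have a0 : xa x != 0.
  by rewrite gt_eqF // good_a.
have m0 : sec_m x != 0 by rewrite gt_eqF // good_m.
have q0 : sec_A2' x 0 1 != 0 by rewrite gt_eqF // good_q.
have [[el ea ec ep er] et] : [/\ xl x = l, xa x = B 0 0, xc x = B 1 0,
    xp x = A2 0 0 & xr x = A2 1 0] /\ xt x = B2 0 1 / B2 0 0.
  rewrite e; split=> //; rewrite /xt /=; field.
  by rewrite u0'; move: c0; rewrite e.
have A1E : sec_A1 x = mx2 l 0 0 l^-1 by rewrite /sec_A1 el.
have dE : sec_d x = B 1 1.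
  rewrite /sec_d ec ea; move: dB; rewrite det_mx2E b1 mul1r => dB.
  apply: (mulIf a0); rewrite {1}ea divfK -?ea // ea mulrC.
  by move/eqP: dB; rewrite subr_eq addrC => /eqP ->; rewrite addrC.
have B1E : sec_B1 x = B by rewrite /sec_B1 ea ec dE [RHS]mx2_eta b1.
pose C := mx2 l 0 0 l^-1 *m B *m adj2 (mx2 l 0 0 l^-1) *m adj2 B.
have CA : C *m A2 *m B2 = B2 *m A2.
  have := congr1 (mulmx^~ (B2 *m A2)) rel; rewrite /rel4 /= mul1mx => <-.
  rewrite -/C -[in RHS]mulmxA -!mulmxA [adj2 B2 *m _]mulmxA mul_adj2mx dB2 mul1mx.
  by rewrite mul_adj2mx dA2 mulmx1.
have CA' : C *m A2 = B2 *m A2 *m adj2 B2.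
  by rewrite -CA -[RHS]mulmxA mulmx_adj2 dB2 mulmx1.
have trC : \tr (C *m A2) = \tr A2.
  by rewrite CA' mxtrace_mulC mulmxA mul_adj2mx dB2 mul1mx.
have sE : A2 1 1 = l * l * A2 0 0 - B 0 0 * (l * l) / B 1 0 * A2 1 0 + B 1 1 * A2 0 1.
  have c0' : B 1 0 != 0 by rewrite -ec.
  have a0' : B 0 0 != 0 by rewrite -ea.
  have gap : 1 - l^-1 * l^-1 != 0.
    rewrite subr_eq0 eq_sym lt_eqF // -invfM invf_lt1 ?mulr_gt0 ?(lt_trans ltr01) //.
    by rewrite mulr_egt1.
  have k0 : B 1 0 * (1 - l^-1 * l^-1) != 0 by rewrite mulf_neq0.
  apply/eqP; rewrite -subr_eq0; apply/eqP; apply: (mulfI k0); rewrite mulr0.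
  (* The equality of traces is the equation for [A2 1 1] multiplied by [c (1 - l^-2)], nonzero
     because [l > 1]. *)
  transitivity (\tr (C *m A2) - \tr A2); last by rewrite trC subrr.
  have dE' : B 1 1 = (1 + B 1 0) / B 0 0 by rewrite -dE /sec_d ec ea.
  rewrite /C [in RHS](mx2_eta B) [in RHS](mx2_eta A2) b1 !mx2_simpl dE'.
  by field; rewrite l0 a0' c0'.
have qE : sec_q x = A2 0 1.
  apply: (mulfI m0); rewrite sec_mq // /sec_m dE el ea ec ep er.
  have := dA2; rewrite det_mx2E sE => <-.
  by field; rewrite -ec.
have A2E : sec_A2 x = A2.
  by rewrite /sec_A2 /sec_s qE dE el ea ec ep er -sE -mx2_eta.
have A2'E : sec_A2' x = C *m A2 by rewrite /sec_A2' A1E B1E A2E.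
have NE : B2 = (B2 0 0 / (C *m A2) 0 1) *: sec_N x.
  rewrite /sec_N et A2E A2'E; apply: transporter_uniq => //.
  by rewrite -A2'E.
rewrite /sec A1E B1E A2E; congr (_, _, _, _).
set k := _ / _ in NE; have k0 : 0 < k by rewrite divr_gt0 // -A2'E good_q.
have kN : k ^+ 2 * \det (sec_N x) = 1 by rewrite -detZ -NE.
rewrite /sec_B2 [RHS]NE; congr (_ *: _).
have -> : \det (sec_N x) = k^-1 ^+ 2.
  rewrite exprVn; apply: (mulfI (expf_neq0 2 (lt0r_neq0 k0))).
  by rewrite kN mulfV // expf_neq0 // gt_eqF.
by rewrite sqrtr_sqr gtr0_norm ?invr_gt0 // invrK.
Qed.

Lemma conj4M S T S' T' A : conj4 S T (conj4 S' T' A) = conj4 (S *m S') (T' *m T) A.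
Proof. by rewrite /conj4 /= !mulmxA. Qed.

Lemma conj4_1 A : conj4 1%:M 1%:M A = A.
Proof. by rewrite /conj4 !mul1mx !mulmx1; case: A => [[[]]]. Qed.

Lemma conj4Z k S T A : k != 0 -> conj4 (k *: S) (k^-1 *: T) A = conj4 S T A.
Proof.
move=> k0; rewrite /conj4.
have kK M : (k *: S) *m M *m (k^-1 *: T) = S *m M *m T.
  by rewrite -!scalemxAl -scalemxAr scalerA mulfV // scale1r.
by rewrite !kK.
Qed.

Lemma sl4_conj (S T : 'M[R]_2) A : S *m T = 1%:M -> sl4 A -> sl4 (conj4 S T A).
Proof.
move=> ST [d1 d2 d3 d4].
have dK M : \det (S *m M *m T) = \det M.
  by rewrite !det_mulmx mulrAC -det_mulmx ST det1 mul1r.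
by split; rewrite /= dK.
Qed.

Lemma adj2_conj (S T M : 'M[R]_2) : S *m T = 1%:M ->
  adj2 (S *m M *m T) = S *m adj2 M *m T.
Proof.
move=> ST; have TS : T *m S = 1%:M by exact: mulmx1C.
by rewrite !adj2E tr_conj // mulmxBr mulmxBl scalar_conj.
Qed.

Lemma rel4_conj (S T : 'M[R]_2) A : S *m T = 1%:M ->
  rel4 (conj4 S T A) = S *m rel4 A *m T.
Proof.
move=> ST; have TS : T *m S = 1%:M by exact: mulmx1C.
by rewrite /rel4 /= !adj2_conj // !mul_conj.
Qed.

(** Once the first matrix is diagonal, only diagonal conjugations remain, and [D] scales the upper
    right entry of the second matrix to 1. As this entry and [\det S] are positive, the total
    conjugator [V] has positive determinant and can be rescaled into SL_2(R). *)
Lemma sec_complete A (S T : 'M[R]_2) l : S *m T = 1%:M -> 0 < \det S -> 1 < l ->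
  T *m A.1.1.1 *m S = mx2 l 0 0 l^-1 -> 0 < (T *m A.1.1.2 *m S) 0 1 ->
  sl4 A -> rel4 A = 1%:M -> good (coords A) -> 0 < co_u A ->
  exists s : SL2 R, A = conj4 (val s) (adj2 (val s)) (sec (coords A)).
Proof.
move=> ST dS l1 Al b0 slA rA gA uA; set b := (T *m A.1.1.2 *m S) 0 1 in b0.
have b0' : b != 0 by rewrite gt_eqF.
have TS : T *m S = 1%:M by exact: mulmx1C.
pose D := mx2 1 0 0 b; pose D' := mx2 1 0 0 b^-1.
have DD' : D *m D' = 1%:M.
  by rewrite !mx2_simpl; congr mx2; rewrite ?mulfV //; ring.
have D'D : D' *m D = 1%:M by exact: mulmx1C.
pose U := D *m T; pose V := S *m D'.
have UV : U *m V = 1%:M by rewrite /U /V mulmxA -[D *m T *m S]mulmxA TS mulmx1.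
have VU : V *m U = 1%:M by exact: mulmx1C.
pose A' := conj4 U V A.
have cA' : coords A' = coords A by exact: coords_conj.
have A'E : A' = (mx2 l 0 0 l^-1, A'.1.1.2, A'.1.2, A'.2).
  rewrite /A' /conj4 /=; congr (_, _, _, _).
  rewrite /U /V -!mulmxA [T *m (_ *m _)]mulmxA [_ *m (S *m _)]mulmxA Al.
  have l0 : l != 0 by rewrite gt_eqF // (lt_trans ltr01).
  by rewrite !mx2_simpl; congr mx2; field; rewrite ?l0 ?b0'.
have b1 : A'.1.1.2 0 1 = 1.
  rewrite /A' /conj4 /= /U /V -!mulmxA [T *m (_ *m _)]mulmxA [_ *m (S *m _)]mulmxA.
  rewrite [X in D *m (X *m _)]mx2_eta -/b !mulmx_mx2 !mx2E.
  by rewrite mul1r !mul0r mulr0 !addr0 add0r mulfV.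
have secA' : sec (coords A') = A'.
  rewrite A'E; apply: sec_coords_normal => //; rewrite -A'E.
  - exact: sl4_conj.
  - by rewrite rel4_conj // rA mulmx1.
  - by rewrite cA'.
  - by rewrite co_u_conj.
rewrite -cA' secA'.
have dV : 0 < \det V by rewrite det_mulmx det_mx2 mul1r mul0r subr0 mulr_gt0 ?invr_gt0.
pose w := Num.sqrt (\det V); have w0 : 0 < w by rewrite sqrtr_gt0.
have w0' : w != 0 by rewrite gt_eqF.
have ww : w * w = \det V by rewrite -expr2 sqr_sqrtr // ltW.
have ds : \det (w^-1 *: V) = 1.
  by rewrite detZ -ww expr2; field.
exists (mkSL2 ds); rewrite /= adj2Z.
have UE : U = (w * w)^-1 *: adj2 V.
  rewrite ww -[adj2 V]mulmx1 -VU mulmxA mul_adj2mx mul_scalar_mx scalerA.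
  by rewrite mulVf ?scale1r // gt_eqF.
have -> : w^-1 *: adj2 V = w^-1^-1 *: U.
  by rewrite UE scalerA invrK; congr (_ *: _); field.
by rewrite conj4Z ?invr_eq0 // /A' conj4M VU conj4_1.
Qed.

End Slice.

(** * Smoothness of the slice and of the coordinates *)

Section SmoothSlice.
Context {R : realType}.

Definition lincont (E E' : normedModType R) (f : E -> E') : Prop :=
  linear f /\ continuous f.

Lemma lincont_comp (E E' E'' : normedModType R) (f : E' -> E'') (g : E -> E') :
  lincont f -> lincont g -> lincont (f \o g).
Proof.
move=> [lf cf] [lg cg]; split=> [a u v|x]; first by rewrite /= lg lf.
by apply: continuous_comp; [exact: cg|exact: cf].
Qed.

Lemma lincont_fst (E F : normedModType R) : lincont (@fst E F).
Proof. by split=> // x; exact: cvg_fst. Qed.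

Lemma lincont_snd (E F : normedModType R) : lincont (@snd E F).
Proof. by split=> // x; exact: cvg_snd. Qed.

Lemma lincont_coord (i j : 'I_2) : lincont (fun M : 'M[R]_2 => M i j).
Proof. by split=> [a u v|]; [rewrite !mxE|exact: coord_continuous]. Qed.

Lemma smooth_lin (E : normedModType R) (U : set E) (f : E -> R) : open U ->
  lincont f -> smooth_on U f.
Proof.
move=> oU [lf cf].
pose fL : {linear E -> R} := HB.pack f (GRing.isLinear.Build _ _ _ _ f lf).
exact: (@smooth_linear R E U fL oU cf).
Qed.

Section MatrixSmooth.
Context {E : normedModType R} (U : set E) (oU : open U).

Definition msmooth (M : E -> 'M[R]_2) : Prop :=
  forall i j, smooth_on U (fun x => M x i j).

Lemma msmoothM M N : msmooth M -> msmooth N -> msmooth (fun x => M x *m N x).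
Proof.
move=> sM sN i j.
rewrite (_ : (fun _ => _) = fun x => M x i 0 * N x 0 j + M x i 1 * N x 1 j).
  by apply: (smoothD oU); apply: (smoothM oU).
by apply/funext => x; rewrite mulmx2E.
Qed.

Lemma msmoothB M N : msmooth M -> msmooth N -> msmooth (fun x => M x - N x).
Proof.
move=> sM sN i j; rewrite (_ : (fun _ => _) = fun x => M x i j - N x i j).
  exact: (smoothB oU).
by apply/funext => x; rewrite !mxE.
Qed.

Lemma msmoothZ k M : smooth_on U k -> msmooth M -> msmooth (fun x => k x *: M x).
Proof.
move=> sk sM i j; rewrite (_ : (fun _ => _) = fun x => k x * M x i j).
  exact: (smoothM oU).
by apply/funext => x; rewrite !mxE.
Qed.

Lemma msmooth_mx2 f g h k : smooth_on U f -> smooth_on U g -> smooth_on U h ->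
  smooth_on U k -> msmooth (fun x => mx2 (f x) (g x) (h x) (k x)).
Proof.
move=> sf sg sh sk i j; case: (ord2P i) => ->; case: (ord2P j) => ->.
- by rewrite (_ : (fun _ => _) = f) //; apply/funext => x; rewrite mx2E.
- by rewrite (_ : (fun _ => _) = g) //; apply/funext => x; rewrite mx2E.
- by rewrite (_ : (fun _ => _) = h) //; apply/funext => x; rewrite mx2E.
- by rewrite (_ : (fun _ => _) = k) //; apply/funext => x; rewrite mx2E.
Qed.

Lemma msmooth_scalar k : smooth_on U k -> msmooth (fun x => (k x)%:M).
Proof.
move=> sk; rewrite (_ : (fun _ => _) = fun x => mx2 (k x) 0 0 (k x)).
  by apply: msmooth_mx2 => //; exact: smooth_cst.
by apply/funext => x; rewrite scalar_mx2.
Qed.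

Lemma msmooth_adj M : msmooth M -> msmooth (fun x => adj2 (M x)).
Proof.
move=> sM; apply: msmooth_mx2; try exact: sM; apply: (smoothN oU); exact: sM.
Qed.

Lemma smooth_tr M : msmooth M -> smooth_on U (fun x => \tr (M x)).
Proof.
move=> sM; rewrite (_ : (fun _ => _) = fun x => M x 0 0 + M x 1 1).
  exact: (smoothD oU).
by apply/funext => x; rewrite tr_mx2E.
Qed.

Lemma smooth_det M : msmooth M -> smooth_on U (fun x => \det (M x)).
Proof.
move=> sM; rewrite (_ : (fun _ => _) = fun x => M x 0 0 * M x 1 1 - M x 0 1 * M x 1 0).
  by apply: (smoothB oU); apply: (smoothM oU).
by apply/funext => x; rewrite det_mx2E.
Qed.

Lemma msmooth_map M : msmooth M -> smooth_map U M.
Proof. exact: smooth_map_matrix. Qed.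

End MatrixSmooth.

Lemma lincont_xl : lincont (@xl R).
Proof. exact: lincont_comp (lincont_fst R R)
  (lincont_comp (lincont_fst (R * R)%type R)
  (lincont_comp (lincont_fst (R * R * R)%type R)
  (lincont_comp (lincont_fst (R * R * R * R)%type R)
  (lincont_fst (R * R * R * R * R)%type R)))). Qed.

Lemma lincont_xa : lincont (@xa R).
Proof. exact: lincont_comp (lincont_snd R R)
  (lincont_comp (lincont_fst (R * R)%type R)
  (lincont_comp (lincont_fst (R * R * R)%type R)
  (lincont_comp (lincont_fst (R * R * R * R)%type R)
  (lincont_fst (R * R * R * R * R)%type R)))). Qed.

Lemma lincont_xc : lincont (@xc R).
Proof. exact: lincont_comp (lincont_snd (R * R)%type R)
  (lincont_comp (lincont_fst (R * R * R)%type R)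
  (lincont_comp (lincont_fst (R * R * R * R)%type R)
  (lincont_fst (R * R * R * R * R)%type R))). Qed.

Lemma lincont_xp : lincont (@xp R).
Proof. exact: lincont_comp (lincont_snd (R * R * R)%type R)
  (lincont_comp (lincont_fst (R * R * R * R)%type R)
  (lincont_fst (R * R * R * R * R)%type R)). Qed.

Lemma lincont_xr : lincont (@xr R).
Proof. exact: lincont_comp (lincont_snd (R * R * R * R)%type R)
  (lincont_fst (R * R * R * R * R)%type R). Qed.

Lemma lincont_xt : lincont (@xt R).
Proof. exact: lincont_snd (R * R * R * R * R)%type R. Qed.

Section Section6.
Variables (U : set (R6 R)) (oU : open U).

Lemma smooth_xl : smooth_on U (@xl R).
Proof. exact: smooth_lin oU lincont_xl. Qed.

Lemma smooth_xa : smooth_on U (@xa R).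
Proof. exact: smooth_lin oU lincont_xa. Qed.

Lemma smooth_xc : smooth_on U (@xc R).
Proof. exact: smooth_lin oU lincont_xc. Qed.

Lemma smooth_xp : smooth_on U (@xp R).
Proof. exact: smooth_lin oU lincont_xp. Qed.

Lemma smooth_xr : smooth_on U (@xr R).
Proof. exact: smooth_lin oU lincont_xr. Qed.

Lemma smooth_xt : smooth_on U (@xt R).
Proof. exact: smooth_lin oU lincont_xt. Qed.

Hypothesis la0 : forall x, U x -> [/\ xl x != 0, xa x != 0, xc x != 0 & sec_m x != 0].

Lemma smooth_sec_d : smooth_on U (@sec_d R).
Proof.
apply: (smooth_div oU); last by move=> x /la0[].
  by apply: (smoothD oU); [exact: smooth_cst|exact: smooth_xc].
exact: smooth_xa.
Qed.

Lemma smooth_sec_m : smooth_on U (@sec_m R).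
Proof.
apply: (smoothB oU); last exact: smooth_xr.
by apply: (smoothM oU); [exact: smooth_sec_d|exact: smooth_xp].
Qed.

Let smooth_ll : smooth_on U (fun x => xl x * xl x).
Proof. by apply: (smoothM oU); exact: smooth_xl. Qed.

Let smooth_alc : smooth_on U (fun x => xa x * (xl x * xl x) / xc x).
Proof.
apply: (smooth_div oU); [|exact: smooth_xc|by move=> x /la0[]].
by apply: (smoothM oU); [exact: smooth_xa|exact: smooth_ll].
Qed.

Lemma smooth_sec_q : smooth_on U (@sec_q R).
Proof.
apply: (smooth_div oU); [|exact: smooth_sec_m|by move=> x /la0[]].
apply: (smoothD oU).
  apply: (smoothB oU); first exact: smooth_cst.
  by apply: (smoothM oU); [exact: smooth_ll|apply: (smoothM oU); exact: smooth_xp].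
apply: (smoothM oU); first exact: smooth_alc.
by apply: (smoothM oU); [exact: smooth_xp|exact: smooth_xr].
Qed.

Lemma smooth_sec_s : smooth_on U (@sec_s R).
Proof.
apply: (smoothD oU); last by apply: (smoothM oU); [exact: smooth_sec_d|exact: smooth_sec_q].
apply: (smoothB oU); first by apply: (smoothM oU); [exact: smooth_ll|exact: smooth_xp].
by apply: (smoothM oU); [exact: smooth_alc|exact: smooth_xr].
Qed.

Lemma msmooth_sec_A1 : msmooth U (@sec_A1 R).
Proof.
apply: msmooth_mx2; [exact: smooth_xl|exact: smooth_cst|exact: smooth_cst|].
by apply: (smoothV oU); [exact: smooth_xl|move=> x /la0[]].
Qed.

Lemma msmooth_sec_B1 : msmooth U (@sec_B1 R).
Proof.
by apply: msmooth_mx2; [exact: smooth_xa|exact: smooth_cst|exact: smooth_xc|exact: smooth_sec_d].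
Qed.

Lemma msmooth_sec_A2 : msmooth U (@sec_A2 R).
Proof.
by apply: msmooth_mx2; [exact: smooth_xp|exact: smooth_sec_q|exact: smooth_xr|exact: smooth_sec_s].
Qed.

Lemma msmooth_sec_A2' : msmooth U (@sec_A2' R).
Proof.
have s1 := msmooth_sec_A1; have s2 := msmooth_sec_B1.
do 4?[apply: (msmoothM oU)] => //; try exact: (msmooth_adj oU).
exact: msmooth_sec_A2.
Qed.

Lemma msmooth_sec_N : msmooth U (@sec_N R).
Proof.
have s1 := msmooth_sec_A2; have s2 := msmooth_sec_A2'; have st := smooth_xt.
apply: msmooth_mx2; first exact: s2.
- by apply: (smoothM oU); [exact: s2|].
- apply: (smoothB oU); last exact: s2.
  by apply: (smoothD oU); [exact: s1|apply: (smoothM oU); [|exact: s1]].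
- apply: (smoothB oU); last by apply: (smoothM oU); [|exact: s2].
  by apply: (smoothD oU); [exact: s1|apply: (smoothM oU); [|exact: s1]].
Qed.

Hypothesis N0 : forall x, U x -> 0 < \det (sec_N x).

Lemma msmooth_sec_B2 : msmooth U (@sec_B2 R).
Proof.
apply: (msmoothZ oU); last exact: msmooth_sec_N.
apply: (smoothV oU).
  by apply: (smooth_sqrt oU) => //; apply: (smooth_det oU); exact: msmooth_sec_N.
by move=> x /N0 Nx; rewrite gt_eqF // sqrtr_gt0.
Qed.

Lemma msmooth_sec_gen g : msmooth U (@sec_gen R ^~ g).
Proof.
case: g; [exact: msmooth_sec_A1|exact: msmooth_sec_B1|exact: msmooth_sec_A2|
  exact: msmooth_sec_B2].
Qed.

Lemma smooth_map_sec : smooth_map U (@sec R).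
Proof.
do 3?[apply: smooth_map_pair => //]; apply: msmooth_map.
- exact: msmooth_sec_A1.
- exact: msmooth_sec_B1.
- exact: msmooth_sec_A2.
- exact: msmooth_sec_B2.
Qed.

End Section6.

Section Coords.
Variables (U : set (M4 R)) (oU : open U).

Lemma msmooth_comp1 : msmooth U (fun A : M4 R => A.1.1.1).
Proof.
move=> i j; apply: (smooth_lin oU); apply: (lincont_comp (lincont_coord i j)).
exact: (lincont_comp (lincont_fst 'M[R]_2 'M[R]_2)
  (lincont_comp (lincont_fst ('M[R]_2 * 'M[R]_2)%type 'M[R]_2)
  (lincont_fst ('M[R]_2 * 'M[R]_2 * 'M[R]_2)%type 'M[R]_2))).
Qed.

Lemma msmooth_comp2 : msmooth U (fun A : M4 R => A.1.1.2).
Proof.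
move=> i j; apply: (smooth_lin oU); apply: (lincont_comp (lincont_coord i j)).
exact: (lincont_comp (lincont_snd 'M[R]_2 'M[R]_2)
  (lincont_comp (lincont_fst ('M[R]_2 * 'M[R]_2)%type 'M[R]_2)
  (lincont_fst ('M[R]_2 * 'M[R]_2 * 'M[R]_2)%type 'M[R]_2))).
Qed.

Lemma msmooth_comp3 : msmooth U (fun A : M4 R => A.1.2).
Proof.
move=> i j; apply: (smooth_lin oU); apply: (lincont_comp (lincont_coord i j)).
exact: (lincont_comp (lincont_snd ('M[R]_2 * 'M[R]_2)%type 'M[R]_2)
  (lincont_fst ('M[R]_2 * 'M[R]_2 * 'M[R]_2)%type 'M[R]_2)).
Qed.

Lemma msmooth_comp4 : msmooth U (fun A : M4 R => A.2).
Proof.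
move=> i j; apply: (smooth_lin oU); apply: (lincont_comp (lincont_coord i j)).
exact: (lincont_snd ('M[R]_2 * 'M[R]_2 * 'M[R]_2)%type 'M[R]_2).
Qed.

Lemma smooth_co_t : smooth_on U (@co_t R).
Proof. by apply: (smooth_tr oU); exact: msmooth_comp1. Qed.

Hypothesis t2 : forall A, U A -> 0 < co_t A * co_t A - 4.

Lemma smooth_co_w : smooth_on U (@co_w R).
Proof.
apply: (smooth_sqrt oU) => //; apply: (smoothB oU); last exact: smooth_cst.
by apply: (smoothM oU); exact: smooth_co_t.
Qed.

Lemma smooth_co_l : smooth_on U (@co_l R).
Proof.
apply: (smoothM oU); last exact: smooth_cst.
by apply: (smoothD oU); [exact: smooth_co_t|exact: smooth_co_w].
Qed.

Lemma smooth_co_wV : smooth_on U (fun A => (co_w A)^-1).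
Proof.
apply: (smoothV oU); first exact: smooth_co_w.
by move=> A /t2 A2; rewrite gt_eqF // sqrtr_gt0.
Qed.

Lemma msmooth_co_E : msmooth U (@co_E R).
Proof.
apply: (msmoothZ oU smooth_co_wV); apply: (msmoothB oU); first exact: msmooth_comp1.
apply: msmooth_scalar; apply: (smoothM oU); last exact: smooth_cst.
by apply: (smoothB oU); [exact: smooth_co_t|exact: smooth_co_w].
Qed.

Lemma msmooth_co_F : msmooth U (@co_F R).
Proof.
apply: (msmoothZ oU smooth_co_wV); apply: (msmoothB oU); last exact: msmooth_comp1.
by apply: msmooth_scalar; exact: smooth_co_l.
Qed.

Lemma smooth_co_c : smooth_on U (@co_c R).
Proof.
have [[sE sF] s2] := (msmooth_co_E, msmooth_co_F, msmooth_comp2).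
by apply: (smooth_tr oU); do 3?[apply: (msmoothM oU)].
Qed.

Lemma smooth_co_u : smooth_on U (@co_u R).
Proof.
apply: (smooth_tr oU); apply: (msmoothM oU); first exact: msmooth_co_E.
exact: msmooth_comp4.
Qed.

Lemma smooth_map_coords : (forall A, U A -> co_c A != 0 /\ co_u A != 0) ->
  smooth_map U (@coords R).
Proof.
move=> cu0; have [[sE sF] s2] := (msmooth_co_E, msmooth_co_F, msmooth_comp2).
have [s3 s4] := (msmooth_comp3, msmooth_comp4).
do 5?[apply: smooth_map_pair => //]; apply: smooth_map_real.
- exact: smooth_co_l.
- by apply: (smooth_tr oU); apply: (msmoothM oU).
- exact: smooth_co_c.
- by apply: (smooth_tr oU); apply: (msmoothM oU).
- by apply: (smooth_tr oU); do 3?[apply: (msmoothM oU)].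
apply: (smooth_div oU).
- by apply: (smooth_tr oU); do 3?[apply: (msmoothM oU)].
- by apply: (smoothM oU); [exact: smooth_co_c|exact: smooth_co_u].
- by move=> A /cu0[c0 u0]; rewrite mulf_neq0.
Qed.

End Coords.
End SmoothSlice.

(** * Lifts and the topology of the moduli space *)

Section LiftsTopology.
Context {R : realType}.

Lemma psl2_1 : psl2 (1%g : SL2 R) = 1%g.
Proof. by []. Qed.

Definition psl2_hom : UMagmaMorphism.type (SL2 R) (PSL2 R) :=
  HB.pack (@psl2 R) (isMultiplicative.Build (SL2 R) (PSL2 R) (@psl2 R) psl2M)
    (Multiplicative_isUMagmaMorphism.Build (SL2 R) (PSL2 R) (@psl2 R) psl2_1).

Definition SL2_opp (s : SL2 R) : SL2 R := mkSL2 (SL2_detN s).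

Lemma psl2_opp s : psl2 (SL2_opp s) = psl2 s.
Proof. by apply/psl2_eqP; right. Qed.

Lemma open_SL2P (S : set (SL2 R)) :
  open S <-> exists2 W : set 'M[R]_2, open W & val @^-1` W = S.
Proof. by split=> -[W oW WS]; exists W. Qed.

Lemma psl2_continuous : continuous (@psl2 R).
Proof. exact: pi_continuous. Qed.

Lemma open_PSL2P (V : set (PSL2 R)) : open V <-> open (@psl2 R @^-1` V).
Proof. by []. Qed.

Lemma SL2_opp_continuous : continuous SL2_opp.
Proof.
apply/continuousP => S /open_SL2P[W oW <-]; apply/open_SL2P.
exists ((fun M : 'M[R]_2 => - M) @^-1` W) => //.
have cN : continuous (fun M : 'M[R]_2 => - M).
  exact: (@opp_continuous ('M[R]_2 : normedModType R)).
by move/continuousP: cN; apply.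
Qed.

Lemma open_psl2 (S : set (SL2 R)) : open S -> open (@psl2 R @` S).
Proof.
move=> oS; apply/open_PSL2P.
rewrite (_ : _ @^-1` _ = S `|` SL2_opp @^-1` S).
  by apply: openU => //; move/continuousP: SL2_opp_continuous; apply.
apply/seteqP; split=> [s [t St /psl2_eqP[]] e|s [Ss|Ss]].
- by left; rewrite (_ : s = t) //; apply/val_inj.
- right; rewrite /= (_ : SL2_opp s = t) //; apply/val_inj => /=.
  by rewrite e.
- by exists s.
- by exists (SL2_opp s) => //; exact: psl2_opp.
Qed.

Lemma nbhs_psl2 s (V : set (PSL2 R)) : nbhs (psl2 s) V ->
  exists2 W : set 'M[R]_2, nbhs (val s) W & forall t, W (val t) -> V (psl2 t).
Proof.
move=> /(@psl2_continuous s); rewrite nbhsE => -[S [/open_SL2P[W oW <-] Ws] SV].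
by exists W => [|t Wt]; [exact: open_nbhs_nbhs|exact: SV].
Qed.

Lemma nbhs_psl2_image (A : 'M[R]_2) (W : set 'M[R]_2) (s : SL2 R) :
  A = val s -> nbhs A W -> nbhs (psl2 s) [set psl2 t | t in val @^-1` W].
Proof.
move=> ->; rewrite nbhsE => -[W' [oW' W's] W'W].
apply: (@filterS _ _ _ [set psl2 t | t in val @^-1` W']).
  by apply: image_subset => t /= /W'W.
apply: open_nbhs_nbhs; split; last by exists s.
by apply: open_psl2; apply/open_SL2P; exists W'.
Qed.

Lemma nerep_coords_continuous :
  continuous (fun rho : nerep R => rep_coords (val rho)).
Proof.
move=> rho; apply: (@continuous_comp (nerep R) (rep R) _ val (@rep_coords R)).
  exact: initial_continuous.
exact: initial_continuous.
Qed.

Lemma open_nerepP (S : set (nerep R)) : open S <->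
  exists2 V, open V & (fun rho : nerep R => rep_coords (val rho)) @^-1` V = S.
Proof.
split=> [[S' [V oV <-] <-]|[V oV <-]]; first by exists V.
by exists (@rep_coords R @^-1` V) => //; exists V.
Qed.

(** The map [psl2] is open, so the neighbourhoods of a lift cover neighbourhoods of the
    representation. *)
Lemma lifts_rep_nbhs (rho : nerep R) (A : M4 R) (N : set (M4 R)) :
  nbhs A N -> lifts_rep A (val rho) ->
  \forall sigma \near rho, exists2 B, N B & lifts_rep B (val sigma).
Proof.
move=> nA [s1 [t1 [s2 [t2 [AE rE]]]]]; rewrite AE in nA.
case: nA => -[N123 N4] /= [[[N12 N3] /= [[[N1 N2] /= [n1 n2] N12E] n3] N123E] n4] NE.
have i1 := nbhs_psl2_image erefl n1; have i2 := nbhs_psl2_image erefl n2.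
have i3 := nbhs_psl2_image erefl n3; have i4 := nbhs_psl2_image erefl n4.
set V1 := [set psl2 t | t in val @^-1` N1] in i1.
set V2 := [set psl2 t | t in val @^-1` N2] in i2.
set V3 := [set psl2 t | t in val @^-1` N3] in i3.
set V4 := [set psl2 t | t in val @^-1` N4] in i4.
have nV : nbhs (rep_coords (val rho)) (((V1 `*` V2) `*` V3) `*` V4).
  rewrite rE; exists (((V1 `*` V2) `*` V3), V4) => //; split=> //=.
  exists ((V1 `*` V2), V3) => //; split=> //=.
  by exists (V1, V2).
have : \forall sigma \near rho, (((V1 `*` V2) `*` V3) `*` V4) (rep_coords (val sigma)).
  exact: (@nerep_coords_continuous rho _ nV).
apply: filterS => sigma /= [[[[u1 /= U1 e1] [u2 /= U2 e2]] [u3 /= U3 e3]] [u4 /= U4 e4]].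
exists (val u1, val u2, val u3, val u4).
  by apply: NE; split=> //; apply: N123E; split=> //; apply: N12E; split.
exists u1, u2, u3, u4; split=> //.
by rewrite [LHS]surjective_pairing; move: e1 e2 e3 e4; rewrite /rep_coords /= => -> -> -> ->.
Qed.

Lemma nerep_continuous (T : topologicalType) (p : T) (A : T -> M4 R)
    (G : T -> nerep R) : {for p, continuous A} ->
  (\forall x \near p, lifts_rep (A x) (val (G x))) ->
  {for p, continuous G}.
Proof.
move=> cA nl S; rewrite nbhsE => -[S' [/open_nerepP[V oV <-] Vp] SS'].
have [s1 [t1 [s2 [t2 [AE rE]]]]] := nbhs_singleton nl.
have nV : nbhs (psl2 s1, psl2 t1, psl2 s2, psl2 t2) V.
  by rewrite -rE; exact: open_nbhs_nbhs.
case: nV => -[V123 V4] /= [[[V12 V3] /= [[[V1 V2] /= [n1 n2] V12E] n3] V123E] n4] VE.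
have [W1 w1 W1V] := nbhs_psl2 n1; have [W2 w2 W2V] := nbhs_psl2 n2.
have [W3 w3 W3V] := nbhs_psl2 n3; have [W4 w4 W4V] := nbhs_psl2 n4.
have nW : \forall x \near p, (((W1 `*` W2) `*` W3) `*` W4) (A x).
  apply: cA; rewrite AE.
  exists (((W1 `*` W2) `*` W3), W4) => //; split=> //=.
  exists ((W1 `*` W2), W3) => //; split=> //=.
  by exists (W1, W2).
suff nS : \forall x \near p, S (G x) by exact: nS.
near=> x; apply: SS'; rewrite /=.
have [u1 [u2 [u3 [u4 [AxE rxE]]]]] : lifts_rep (A x) (val (G x)) by near: x.
have : (((W1 `*` W2) `*` W3) `*` W4) (A x) by near: x.
rewrite AxE => -[[[/= q1 q2] q3] q4]; rewrite rxE.
apply: VE; split=> /=; last exact: W4V.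
apply: V123E; split=> /=; last exact: W3V.
by apply: V12E; split=> /=; [exact: W1V|exact: W2V].
Unshelve. all: by end_near. Qed.

Lemma open_moduliP (V : set (moduli R)) : open V <-> open (@rep_class R @^-1` V).
Proof. by []. Qed.

End LiftsTopology.

(** * Charts of the moduli space *)

Section LiftsConjugation.
Context {R : realType}.
Implicit Types (A B : M4 R) (rho sigma : nerep R).

Definition comp4 A (g : generator) : 'M[R]_2 :=
  match g with A1 => A.1.1.1 | B1 => A.1.1.2 | A2 => A.1.2 | B2 => A.2 end.

Lemma eq_comp4 A B : (forall g, comp4 A g = comp4 B g) -> A = B.
Proof.
case: A B => [[[a1 b1] a2] b2] [[[c1 d1] c2] d2] e.
by have := (e A1, e B1, e A2, e B2) => -[[[/= -> ->] ->] ->].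
Qed.

Lemma lifts_repP A (rho : rep R) : lifts_rep A rho <->
  exists s : generator -> SL2 R, forall g, comp4 A g = val (s g) /\ rho (gen g) = psl2 (s g).
Proof.
split=> [[s1 [t1 [s2 [t2 [-> e]]]]]|[s sE]].
  exists (fun g => match g with A1 => s1 | B1 => t1 | A2 => s2 | B2 => t2 end).
  have e1 := congr1 (fun p => p.1.1.1) e; have e2 := congr1 (fun p => p.1.1.2) e.
  have e3 := congr1 (fun p => p.1.2) e; have e4 := congr1 (fun p => p.2) e.
  by case.
exists (s A1), (s B1), (s A2), (s B2); split.
  by apply: eq_comp4 => g; rewrite (sE g).1; case: g.
by rewrite /rep_coords !(sE _).2.
Qed.

Definition sign4 (eps : generator -> bool) A : M4 R :=
  ((-1) ^+ eps A1 *: A.1.1.1, (-1) ^+ eps B1 *: A.1.1.2,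
   (-1) ^+ eps A2 *: A.1.2, (-1) ^+ eps B2 *: A.2).

Lemma comp4_sign eps A g : comp4 (sign4 eps A) g = (-1) ^+ eps g *: comp4 A g.
Proof. by case: g. Qed.

Lemma comp4_conj S T A g : comp4 (conj4 S T A) g = S *m comp4 A g *m T.
Proof. by case: g. Qed.

Lemma lifts_rep_sign A B (rho : rep R) : lifts_rep A rho -> lifts_rep B rho ->
  exists eps, sign4 eps B = A.
Proof.
move=> /lifts_repP[s sE] /lifts_repP[t tE].
have /boolp.choice[eps epsE] : forall g, exists b : bool,
    val (s g) = (-1) ^+ b *: val (t g).
  move=> g; have /psl2_eqP[e|e] : psl2 (s g) = psl2 (t g) by rewrite -(sE g).2 (tE g).2.
    by exists false; rewrite scale1r.
  by exists true; rewrite scaleN1r.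
by exists eps; apply: eq_comp4 => g; rewrite comp4_sign (tE g).1 (sE g).1 epsE.
Qed.

Lemma lifts_rep_conj rho sigma A : conj_eq rho sigma -> lifts_rep A (val rho) ->
  exists s : SL2 R, lifts_rep (conj4 (val s) (adj2 (val s)) A) (val sigma).
Proof.
move=> [g gE] /lifts_repP[t tE]; exists (repr g); apply/lifts_repP.
exists (fun x => (repr g * t x * (repr g)^-1)%g) => x; split.
  by rewrite comp4_conj (tE x).1 !val_SL2M val_SL2V.
by rewrite gE (tE x).2 !psl2M psl2V psl2_surj.
Qed.

Lemma conj_lifts rho sigma A (s : SL2 R) : lifts_rep A (val rho) ->
  lifts_rep (conj4 (val s) (adj2 (val s)) A) (val sigma) -> conj_eq rho sigma.
Proof.
move=> /lifts_repP[t tE] /lifts_repP[u uE]; exists (psl2 s).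
have gE x : val sigma (gen x) = (psl2 s * val rho (gen x) * (psl2 s)^-1)%g.
  rewrite (uE x).2 (tE x).2 -psl2V -!psl2M; congr psl2; apply/val_inj.
  by rewrite -(uE x).1 comp4_conj (tE x).1 !val_SL2M val_SL2V.
elim/Gamma2_ind => [|x y IHx IHy|//|x].
- by rewrite !gmulf1 mulg1 mulgV.
- by rewrite !gmulfM IHx IHy !mulgA mulgVK.
- by rewrite !gmulfV gE !invgM invgK mulgA.
Qed.

Lemma lifts_rep_rel A (rho : rep R) : lifts_rep A rho ->
  sl4 A /\ (rel4 A = 1%:M \/ rel4 A = - 1%:M).
Proof.
move=> /lifts_repP[s sE].
have AE g : comp4 A g = val (s g) := (sE g).1.
split.
  by split; rewrite -1?[A.1.1.1]/(comp4 A A1) -1?[A.1.1.2]/(comp4 A B1)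
    -1?[A.1.2]/(comp4 A A2) -1?[A.2]/(comp4 A B2) AE SL2_det.
have e : psl2 (surface_relator (s A1) (s B1) (s A2) (s B2)) = psl2 1%g.
  have := congr1 (rho : Gamma2 -> PSL2 R) Gamma2_relation.
  rewrite gmulf1 /surface_relator /commutator !(gmulfM, gmulfV) !(sE _).2.
  by move=> e; rewrite !(psl2M, psl2V) psl2_1.
have relE : rel4 A = val (surface_relator (s A1) (s B1) (s A2) (s B2)).
  rewrite /surface_relator /commutator !(val_SL2M, val_SL2V) -!AE.
  by rewrite /rel4 /= !mulmxA.
by rewrite relE; case/psl2_eqP: e => ->; [left|right].
Qed.

Definition tr_pos A : Prop := forall g, 0 < \tr (comp4 A g).

Lemma sign4_tr_pos eps eps' A : tr_pos (sign4 eps A) -> tr_pos (sign4 eps' A) ->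
  sign4 eps A = sign4 eps' A.
Proof.
move=> p p'; apply: eq_comp4 => g; have := p g; have := p' g.
rewrite !comp4_sign !mxtraceZ.
by case: (eps g); case: (eps' g) => //; rewrite !expr1 !expr0 => h h'; exfalso; lra.
Qed.

Lemma sign4_0 A : sign4 (fun=> false) A = A.
Proof. by apply: eq_comp4 => g; rewrite comp4_sign scale1r. Qed.

End LiftsConjugation.

(** * Slice points as non-elementary representations *)

Section SliceRep.
Context {R : realType}.

Section Point.
Variables (x : R6 R) (gx : good x).

Definition sec_hom : UMagmaMorphism.type Gamma2 (SL2 R) := Gamma2_lift (sec_rel gx).

Lemma sec_hom_gen g : sec_hom (gen g) = sec_sl2 gx g.
Proof. by rewrite Gamma2_lift_gen; case: g. Qed.

Definition sec_rep : rep R :=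
  (@psl2_hom R \o sec_hom : UMagmaMorphism.type Gamma2 (PSL2 R)).

Lemma sec_rep_non_elementary : non_elementary sec_rep.
Proof.
have e : diag_prod (sec_B1 x) = 1 + xc x.
  rewrite /diag_prod !mx2E /sec_d mulrC divfK // gt_eqF // good_a //.
apply: (@zariski_dense_range R sec_hom _ (gen A1) (gen B1) (xl x)) => //.
- exact: good_l.
- by rewrite sec_hom_gen.
- by rewrite sec_hom_gen e good_d.
- by rewrite sec_hom_gen e -subr_eq0 addrAC subrr add0r good_c.
Qed.

Definition sec_nerep : nerep R := exist _ sec_rep (mem_set sec_rep_non_elementary).

Lemma lifts_sec : lifts_rep (sec x) (val sec_nerep).
Proof.
apply/lifts_repP; exists (sec_sl2 gx) => g; split; first by case: g.
by rewrite -sec_hom_gen.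
Qed.

End Point.
End SliceRep.

(** * Recovering the slice parameters from lifts *)

Section ChartTopology.
Context {R : realType}.
Implicit Types (A B : M4 R) (x : R6 R) (rho sigma : nerep R).

Lemma msmooth_cst (E : normedModType R) (U : set E) (M : 'M[R]_2) :
  msmooth U (fun=> M).
Proof. by move=> i j; exact: smooth_cst. Qed.

Lemma msmooth_comp4_gen (U : set (M4 R)) g : open U -> msmooth U (comp4 ^~ g).
Proof.
move=> oU; case: g; [exact: msmooth_comp1|exact: msmooth_comp2|
  exact: msmooth_comp3|exact: msmooth_comp4].
Qed.

Lemma smooth_map_conj4 (U : set (M4 R)) S T : open U -> smooth_map U (conj4 S T).
Proof.
move=> oU; have sM M : msmooth U M -> smooth_map U (fun A => S *m M A *m T).
  move=> sM; apply: msmooth_map; apply: (msmoothM oU); last exact: msmooth_cst.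
  by apply: (msmoothM oU) => //; exact: msmooth_cst.
by do 3?[apply: smooth_map_pair]; apply: sM; [exact: msmooth_comp1|
  exact: msmooth_comp2|exact: msmooth_comp3|exact: msmooth_comp4].
Qed.

Lemma smooth_map_sign4 (U : set (M4 R)) eps : open U -> smooth_map U (sign4 eps).
Proof.
move=> oU; have sM (k : R) M : msmooth U M -> smooth_map U (fun A => k *: M A).
  by move=> sM; apply: msmooth_map; apply: (msmoothZ oU) => //; exact: smooth_cst.
by do 3?[apply: smooth_map_pair]; apply: sM; [exact: msmooth_comp1|
  exact: msmooth_comp2|exact: msmooth_comp3|exact: msmooth_comp4].
Qed.

Definition hyp_dom : set (M4 R) := [set A | 0 < co_t A * co_t A - 4].

Lemma open_hyp_dom : open hyp_dom.
Proof.
have oT : open (setT : set (M4 R)) by exact: openT.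
have c : continuous (fun A : M4 R => co_t A * co_t A - 4).
  move=> A; apply: (smooth_continuous (U := setT)) => //.
  apply: (smoothB oT); last exact: smooth_cst.
  by apply: (smoothM oT); exact: smooth_co_t.
by apply: open_comp (@open_gt0 R) => A _; exact: c.
Qed.

Definition coords_dom : set (M4 R) :=
  hyp_dom `&` [set A | co_c A != 0 /\ co_u A != 0].

Lemma open_coords_dom : open coords_dom.
Proof.
have oH := open_hyp_dom.
rewrite openE => A [HA [c0 u0]].
have nH : \forall B \near A, hyp_dom B by exact: open_nbhs_nbhs.
have cc := smooth_continuous (smooth_co_c oH (fun _ => id)) HA.
have cu := smooth_continuous (smooth_co_u oH (fun _ => id)) HA.
have nc : \forall B \near A, co_c B != 0.
  exact: (cc _ (open_nbhs_nbhs (conj open_neq0 c0))).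
have nu : \forall B \near A, co_u B != 0.
  exact: (cu _ (open_nbhs_nbhs (conj open_neq0 u0))).
by near=> B; split; [near: B|split; near: B].
Unshelve. all: by end_near. Qed.

Lemma smooth_map_coords_dom : smooth_map coords_dom (@coords R).
Proof.
apply: (smooth_map_coords open_coords_dom) => [A []//|A [_ []//]].
Qed.

Lemma coords_dom_conj (S T : 'M[R]_2) A : S *m T = 1%:M ->
  coords_dom A -> coords_dom (conj4 S T A).
Proof.
move=> ST [HA cuA]; have TS := mulmx1C ST.
split; first by rewrite /hyp_dom /= co_t_conj.
rewrite /= co_u_conj //.
by rewrite -[co_c _]/(xc (coords (conj4 S T A))) coords_conj.
Qed.

Lemma coords_dom_sec x : good x -> coords_dom (sec x).
Proof.
move=> gx; have l1 := good_l gx; have l0 : xl x != 0.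
  by rewrite gt_eqF // (lt_trans ltr01).
split.
  rewrite /hyp_dom /= /co_t /= tr_mx2.
  rewrite (_ : _ - 4 = (xl x - (xl x)^-1) ^+ 2); last by field.
  by rewrite exprn_gt0 // diag_gap.
split; last by rewrite gt_eqF // co_u_sec.
by rewrite -[co_c _]/(xc (coords (sec x))) coords_sec // good_c.
Qed.

Lemma coords_lift x (gx : good x) rho A : conj_eq (sec_nerep gx) rho ->
  lifts_rep A (val rho) -> exists eps,
  [/\ tr_pos (sign4 eps A), coords_dom (sign4 eps A) & coords (sign4 eps A) = x].
Proof.
move=> cj lA; have [s ls] := lifts_rep_conj cj (lifts_sec gx).
have [eps eA] := lifts_rep_sign ls lA; exists eps; rewrite eA.
have ss' : val s *m adj2 (val s) = 1%:M by rewrite mulmx_adj2 SL2_det.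
have s's : adj2 (val s) *m val s = 1%:M by rewrite mul_adj2mx SL2_det.
split.
- move=> g; rewrite comp4_conj tr_conj //.
  by have := tr_sec_gen g gx; case: g.
- by apply: coords_dom_conj => //; exact: coords_dom_sec.
- by rewrite coords_conj // coords_sec.
Qed.

(** Lifts of conjugate slice points are conjugate up to signs; the positive traces remove the signs,
    and [coords] is conjugation invariant. *)
Lemma sec_nerep_inj x y (gx : good x) (gy : good y) :
  conj_eq (sec_nerep gx) (sec_nerep gy) -> x = y.
Proof.
move=> cj; have [eps [p _ <-]] := coords_lift cj (lifts_sec gy).
rewrite (@sign4_tr_pos R eps (fun=> false)) // sign4_0; last first.
  by move=> g; have := tr_sec_gen g gy; case: g.
by rewrite coords_sec.
Qed.

(* Columns are eigenvectors of the first matrix. *)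
Definition eig_mx A : 'M[R]_2 :=
  mx2 (A.1.1.1 0 0 - (co_t A - co_w A) / 2) (- A.1.1.1 0 1)
      (A.1.1.1 1 0) (co_l A - A.1.1.1 1 1).

Lemma msmooth_eig : msmooth hyp_dom eig_mx.
Proof.
have oH := open_hyp_dom; have s1 := msmooth_comp1 oH.
have sw := smooth_co_w oH (fun _ => id).
apply: msmooth_mx2; [apply: (smoothB oH)|apply: (smoothN oH)| |apply: (smoothB oH)];
  try exact: s1.
  apply: (smoothM oH); last exact: smooth_cst.
  by apply: (smoothB oH) => //; exact: smooth_co_t.
exact: (smooth_co_l oH (fun _ => id)).
Qed.

Lemma eig_mxP A : sl4 A -> 2 < co_t A -> 1 < co_l A /\
  A.1.1.1 *m eig_mx A = eig_mx A *m mx2 (co_l A) 0 0 (co_l A)^-1.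
Proof.
move=> [dA _ _ _] t2; set t := co_t A in t2; set w := co_w A.
have ww : w * w = t * t - 4.
  by rewrite -expr2 sqr_sqrtr // subr_ge0 -/t; nra.
have w0 : 0 <= w by exact: sqrtr_ge0.
have lE : co_l A = (t + w) / 2 by [].
have l1 : 1 < co_l A by rewrite lE; lra.
have l0 : co_l A != 0 by rewrite gt_eqF // (lt_trans ltr01).
have lV : (co_l A)^-1 = (t - w) / 2.
  apply: (mulfI l0); rewrite mulfV // lE.
  transitivity ((t * t - w * w) / 4); last by field.
  by rewrite ww; field.
split=> //; rewrite lV lE /eig_mx -/t -/w lE.
have trA : t = A.1.1.1 0 0 + A.1.1.1 1 1 by rewrite /t /co_t tr_mx2E.
have A1E := mx2_eta A.1.1.1; move: A1E dA trA; rewrite det_mx2E.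
set p := A.1.1.1 0 0; set q := A.1.1.1 0 1.
set r := A.1.1.1 1 0; set s := A.1.1.1 1 1 => A1E dA trA; rewrite A1E.
have sE : s = t - p by rewrite trA addrC addKr.
have qrE : q * r = p * s - 1 by rewrite -dA; ring.
rewrite !mulmx_mx2; congr mx2; rewrite ?mulr0 ?addr0 ?add0r.
- apply/eqP; rewrite -subr_eq0; apply/eqP.
  transitivity (q * r - (p * s - 1) + (t * t - 4 - w * w) / 4); last first.
    by rewrite qrE ww !subrr mul0r addr0.
  by rewrite sE; field.
- by rewrite sE; field.
- by rewrite sE; field.
- apply/eqP; rewrite -subr_eq0; apply/eqP.
  transitivity (- (q * r - (p * s - 1)) - (t * t - 4 - w * w) / 4); last first.
    by rewrite qrE ww !subrr mul0r oppr0 addr0.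
  by rewrite sE; field.
Qed.

End ChartTopology.

(** * The slice as a smooth chart *)

Section Chart.
Context {R : realType}.
Implicit Types (A B : M4 R) (x y : R6 R) (rho sigma : nerep R).

Lemma near_gt0 (U : set (M4 R)) (f : M4 R -> R) A : open U -> smooth_on U f ->
  U A -> 0 < f A -> \forall B \near A, 0 < f B.
Proof.
move=> oU sf UA fA.
exact: (smooth_continuous sf UA (open_nbhs_nbhs (conj open_gt0 fA))).
Qed.

Lemma eig_sec x : good x -> eig_mx (sec x) = (xl x - (xl x)^-1)%:M.
Proof.
move=> gx; have l1 := good_l gx.
have l0 : xl x != 0 by rewrite gt_eqF // (lt_trans ltr01).
rewrite /eig_mx /sec /sec_A1 diag_w // diag_l // /co_t /= tr_mx2 !mx2E oppr0.
by rewrite scalar_mx2; congr mx2; field.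
Qed.

Lemma rel4_sec x : good x -> rel4 (sec x) = 1%:M.
Proof.
move=> gx; have := congr1 val (sec_rel gx).
rewrite /surface_relator /commutator !(val_SL2M, val_SL2V) => e.
by rewrite -[RHS]/(val (1%g : SL2 R)) -e /rel4 /= !mulmxA.
Qed.

Lemma msmooth_rel4 (U : set (M4 R)) : open U -> msmooth U (@rel4 R).
Proof.
move=> oU; have s1 := msmooth_comp1 oU; have s2 := msmooth_comp2 oU.
have s3 := msmooth_comp3 oU; have s4 := msmooth_comp4 oU.
by do 8?[apply: (msmoothM oU)] => //; apply: (msmooth_adj oU).
Qed.

(** The hypotheses of [sec_complete] are open conditions that hold at [sec x], where the
    diagonalizing matrix [eig_mx] is a positive scalar; the trace of [rel4], close to 2, excludes
    the relation with the wrong sign. *)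
Lemma slice_near x (P : set (R6 R)) : good x -> open P -> P x ->
  (forall y, P y -> good y) ->
  \forall B \near sec x, sl4 B -> rel4 B = 1%:M \/ rel4 B = - 1%:M ->
    exists y (s : SL2 R), P y /\ B = conj4 (val s) (adj2 (val s)) (sec y).
Proof.
move=> gx oP Px gP; have l1 := good_l gx.
have gap0 := diag_gap l1; set k := xl x - (xl x)^-1 in gap0.
have oH := @open_hyp_dom R; have oC := @open_coords_dom R.
have oT : open (setT : set (M4 R)) by exact: openT.
have Cx := coords_dom_sec gx; have Hx := Cx.1.
have n1 : \forall B \near sec x, P (coords B).
  have cc := smooth_map_continuous oC (@smooth_map_coords_dom R) Cx.
  by apply: (cc P); rewrite coords_sec //; exact: open_nbhs_nbhs.
have n2 : \forall B \near sec x, 0 < \tr (rel4 B).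
  apply: (near_gt0 oT (smooth_tr oT (msmooth_rel4 oT)) I).
  by rewrite rel4_sec // mxtrace1 ltr0n.
have n3 : \forall B \near sec x, 0 < co_u B.
  apply: (near_gt0 oH _ Hx (co_u_sec gx)).
  exact: smooth_co_u oH (fun _ => id).
have n4 : \forall B \near sec x, 0 < co_t B - 2.
  apply: (near_gt0 oT _ I); first by apply: (smoothB oT); [exact: smooth_co_t|exact: smooth_cst].
  rewrite /co_t /= tr_mx2; have l0 : 0 < xl x by rewrite (lt_trans ltr01).
  rewrite (_ : _ - 2 = (xl x - 1) ^+ 2 / xl x); last by field; rewrite gt_eqF.
  by rewrite divr_gt0 // exprn_gt0 // subr_gt0.
have n5 : \forall B \near sec x, 0 < \det (eig_mx B).
  apply: (near_gt0 oH (smooth_det oH (@msmooth_eig R)) Hx).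
  by rewrite eig_sec // det_scalar exprn_gt0.
have n6 : \forall B \near sec x, 0 < (adj2 (eig_mx B) *m B.1.1.2 *m eig_mx B) 0 1.
  apply: (near_gt0 oH (f := fun B => (adj2 (eig_mx B) *m B.1.1.2 *m eig_mx B) 0 1) _ Hx).
    have se := @msmooth_eig R; have s2 := msmooth_comp2 oH.
    by apply: (msmoothM oH) => //; apply: (msmoothM oH) => //; exact: (msmooth_adj oH).
  rewrite eig_sec // scalar_mx2 adj2_mx2 /= /sec_B1 !mulmx_mx2 !mx2E.
  by rewrite -/k (_ : _ + _ = k * k) ?mulr_gt0 //; ring.
near=> B => slB relB.
have PB : P (coords B) by near: B.
have rB : rel4 B = 1%:M.
  case: relB => // rB; have : 0 < \tr (rel4 B) by near: B.
  by rewrite rB raddfN /= mxtrace1 oppr_gt0 ltrn0.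
have uB : 0 < co_u B by near: B.
have tB : 2 < co_t B by rewrite -subr_gt0; near: B.
have dB : 0 < \det (eig_mx B) by near: B.
have bB : 0 < (adj2 (eig_mx B) *m B.1.1.2 *m eig_mx B) 0 1 by near: B.
have [lB eB] := eig_mxP slB tB.
pose T := (\det (eig_mx B))^-1 *: adj2 (eig_mx B).
have TS : T *m eig_mx B = 1%:M.
  by rewrite -scalemxAl mul_adj2mx -mul_scalar_mx -scalar_mxM mulVf // gt_eqF.
have ST := mulmx1C TS.
have [s sE] : exists s : SL2 R, B = conj4 (val s) (adj2 (val s)) (sec (coords B)).
  apply: (sec_complete ST dB lB) => //; last exact: gP.
    by rewrite -mulmxA eB mulmxA TS mul1mx.
  by rewrite -!scalemxAl mxE mulr_gt0 // invr_gt0.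
by exists (coords B), s.
Unshelve. all: by end_near. Qed.

Section Ball.
Variables (b : R6 R) (e : R) (e0 : 0 < e).
Local Notation O := (ball b e).
Hypothesis gO : forall x, O x -> good x.

Let oO : open O. Proof. exact: ball_open. Qed.

Let gb : good b. Proof. exact/gO/ballxx. Qed.

(** Made total by a default value at the centre [b]; on the ball only the first branch occurs. *)
Definition slice_pt x : nerep R :=
  match pselect (good x) with left gx => sec_nerep gx | right _ => sec_nerep gb end.

Lemma slice_ptE x (gx : good x) : slice_pt x = sec_nerep gx.
Proof.
by rewrite /slice_pt; case: pselect => // g; congr sec_nerep; exact: Prop_irrelevance.
Qed.

Lemma lifts_slice x : O x -> lifts_rep (sec x) (val (slice_pt x)).
Proof. by move=> /gO gx; rewrite (slice_ptE gx); exact: lifts_sec. Qed.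

Definition chart_dom : set (moduli R) := [set rep_class (slice_pt x) | x in O].

Definition chart_map (m : moduli R) : R6 R :=
  match pselect (exists x, O x /\ rep_class (slice_pt x) = m) with
  | left h => projT1 (cid h) | right _ => 0 end.

Lemma chart_dom_inj x y : O x -> O y ->
  rep_class (slice_pt x) = rep_class (slice_pt y) -> x = y.
Proof.
move=> /gO gx /gO gy /rep_class_eqP; rewrite (slice_ptE gx) (slice_ptE gy).
exact: sec_nerep_inj.
Qed.

Lemma chart_mapK x : O x -> chart_map (rep_class (slice_pt x)) = x.
Proof.
move=> Ox; rewrite /chart_map; case: pselect => [h|[]]; last by exists x.
by case: (cid h) => y /= [Oy /chart_dom_inj]; exact.
Qed.

Lemma smooth_map_sec_ball : smooth_map O (@sec R).
Proof.
apply: smooth_map_sec => // x /gO gx; last exact: good_N.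
split; first by rewrite gt_eqF // (lt_trans ltr01) // good_l.
- by rewrite gt_eqF // good_a.
- exact: good_c.
- by rewrite gt_eqF // good_m.
Qed.

(** A representation near the class of a slice point has a lift near a conjugate of [sec x];
    conjugated back, it comes under [slice_near]. *)
Lemma open_chart_image (P : set (R6 R)) : open P -> P `<=` O ->
  open [set rep_class (slice_pt x) | x in P].
Proof.
move=> oP PO; apply/open_moduliP; rewrite openE => rho [x Px /rep_class_eqP xr].
have gx := gO (PO _ Px); rewrite (slice_ptE gx) in xr.
have [s ls] := lifts_rep_conj xr (lifts_sec gx).
have ss' : val s *m adj2 (val s) = 1%:M by rewrite mulmx_adj2 SL2_det.
have s's : adj2 (val s) *m val s = 1%:M by rewrite mul_adj2mx SL2_det.
pose T := conj4 (adj2 (val s)) (val s).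
have oT : open (setT : set (M4 R)) by exact: openT.
have cT : {for conj4 (val s) (adj2 (val s)) (sec x), continuous T}.
  exact: (smooth_map_continuous oT (smooth_map_conj4 _ _ oT)).
have TK : T (conj4 (val s) (adj2 (val s)) (sec x)) = sec x.
  by rewrite /T conj4M s's conj4_1.
have nN := slice_near gx oP Px (fun y Py => gO (PO _ Py)).
rewrite -TK in nN; have := lifts_rep_nbhs (cT _ nN) ls.
apply: filterS => sigma [B /= HB lB].
have [slB rB] := lifts_rep_rel lB.
have [||y [s' [Py TBE]]] := HB.
- exact: sl4_conj.
- rewrite rel4_conj //; case: rB => ->; [left|right].
    by rewrite mulmx1.
  by rewrite mulmxN mulNmx mulmx1 s's.
exists y => //; apply/rep_class_eqP; have gy := gO (PO _ Py).
rewrite (slice_ptE gy); apply: (conj_lifts (s := (s * s')%g) (lifts_sec gy)).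
rewrite val_SL2M adj2M -conj4M -TBE /T conj4M ss' conj4_1.
exact: lB.
Qed.

Lemma slice_pt_continuous x : O x -> {for x, continuous slice_pt}.
Proof.
move=> Ox; apply: (nerep_continuous (A := @sec R)).
  exact (@smooth_map_continuous R (R6 R) O oO (M4 R) (@sec R) x smooth_map_sec_ball Ox).
near=> y; apply: lifts_slice; near: y; exact: open_nbhs_nbhs.
Unshelve. all: by end_near. Qed.

Lemma chart_image_open (V : set (moduli R)) : V `<=` chart_dom -> open V ->
  open (chart_map @` V).
Proof.
move=> VU oV; rewrite openE => _ [m Vm <-].
have [x Ox xm] := VU _ Vm; rewrite -xm chart_mapK //.
have nV : \forall y \near x, V (rep_class (slice_pt y)).
  have oV' := (open_moduliP V).1 oV.
  have Vx : (@rep_class R @^-1` V) (slice_pt x) by rewrite /= xm.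
  exact: (slice_pt_continuous Ox (open_nbhs_nbhs (conj oV' Vx))).
have nO : \forall y \near x, O y by exact: open_nbhs_nbhs.
near=> y; exists (rep_class (slice_pt y)); first by near: y.
by rewrite chart_mapK //; near: y.
Unshelve. all: by end_near. Qed.

Lemma chart_image_dom : chart_map @` chart_dom = O.
Proof.
apply/seteqP; split=> [_ [_ [x Ox <-] <-]|x Ox]; first by rewrite chart_mapK.
by exists (rep_class (slice_pt x)); [exists x|rewrite chart_mapK].
Qed.

Lemma chart_lift rho A : chart_dom (rep_class rho) -> lifts_rep A (val rho) ->
  exists eps, [/\ tr_pos (sign4 eps A), coords_dom (sign4 eps A) &
    coords (sign4 eps A) = chart_map (rep_class rho)].
Proof.
move=> [x Ox xr] lA; rewrite -xr chart_mapK //.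
move/rep_class_eqP: xr; rewrite (slice_ptE (gO Ox)) => cj.
exact: coords_lift cj lA.
Qed.

(** On lifts the chart is [coords] after a choice of signs. The set [W] prescribes positive traces
    for the choice [eps], so one [eps] serves all lifts in it. *)
Lemma chart_smooth1 (P : set (R6 R)) (f : R6 R -> R) : P `<=` O -> open P ->
  smooth_on P f -> smooth_moduli (chart_dom `&` chart_map @^-1` P) (f \o chart_map).
Proof.
move=> PO oP sf rho A [Ur Pr] lA.
have [eps [tp cd cE]] := chart_lift Ur lA.
have oT : open (setT : set (M4 R)) by exact: openT.
have oC := @open_coords_dom R.
pose W := [set B | tr_pos (sign4 eps B) /\ coords_dom (sign4 eps B) /\
                   P (coords (sign4 eps B))].
have cS B : {for B, continuous (sign4 eps)}.
  exact: (smooth_map_continuous oT (smooth_map_sign4 _ oT)).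
have oW : open W.
  rewrite openE => B [tB [cB pB]].
  have nt g : \forall C \near B, 0 < \tr (comp4 (sign4 eps C) g).
    apply: (near_gt0 oT (f := fun C => \tr (comp4 (sign4 eps C) g)) _ I (tB g)).
    rewrite (_ : (fun _ => _) = fun C => (-1) ^+ eps g * \tr (comp4 C g)).
      apply: (smoothM oT); first exact: smooth_cst.
      by apply: (smooth_tr oT); exact: msmooth_comp4_gen.
    by apply/funext => C; rewrite comp4_sign mxtraceZ.
  have nc : \forall C \near B, coords_dom (sign4 eps C).
    exact: (cS B _ (open_nbhs_nbhs (conj oC cB))).
  have np : \forall C \near B, P (coords (sign4 eps C)).
    have cc := smooth_map_continuous oC (@smooth_map_coords_dom R) cB.
    exact: (cS B _ (cc _ (open_nbhs_nbhs (conj oP pB)))).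
  have [[[n1 n2] n3] n4] := (nt A1, nt B1, nt A2, nt B2).
  near=> C; split; last by split; near: C.
  by case; near: C.
exists W, (f \o (@coords R \o sign4 eps)); split=> //.
- by split=> //; split=> //; rewrite cE.
- have sS := smooth_map_sign4 eps oW.
  have sfc : smooth_on (coords_dom `&` (@coords R @^-1` P)) (f \o @coords R).
    have oCP : open (coords_dom `&` (@coords R @^-1` P)).
      rewrite openE => B [cB pB].
      have cc := smooth_map_continuous oC (@smooth_map_coords_dom R) cB.
      have n1 : \forall C \near B, coords_dom C by exact: open_nbhs_nbhs.
      have n2 : \forall C \near B, P (coords C).
        exact: (cc _ (open_nbhs_nbhs (conj oP pB))).
      by near=> C; split; near: C.
    apply: (smooth_comp oCP) sf; last by move=> B [].
    have [t eT sT] := @smooth_map_coords_dom R; exists t; first by move=> B [/eT].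
    by move=> p ps vs B [cB _]; exact: sT.
  by apply: (smooth_comp oW sS) sfc => B [_ [cB pB]]; split.
- move=> sigma B [Us Ps] [tB [cB pB]] lB /=.
  have [eps' [tp' _ <-]] := chart_lift Us lB.
  by rewrite (sign4_tr_pos tp' tB).
Unshelve. all: by end_near. Qed.

(** The local extension [F] to the space of lifts is pulled back along the smooth map [sec]. *)
Lemma chart_smooth2 (P : set (R6 R)) (f : R6 R -> R) : P `<=` O -> open P ->
  smooth_moduli (chart_dom `&` chart_map @^-1` P) (f \o chart_map) -> smooth_on P f.
Proof.
move=> PO oP sm vs x Px.
have Ox := PO _ Px.
have Vx y : P y -> (@rep_class R @^-1` (chart_dom `&` chart_map @^-1` P)) (slice_pt y).
  by move=> Py; split; [exists y => //; exact: PO|rewrite /= chart_mapK //; exact: PO].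
have [W [F [oW Wx sF FE]]] := sm _ _ (Vx _ Px) (lifts_slice Ox).
pose Q := P `&` (@sec R @^-1` W).
have cs y : O y -> {for y, continuous (@sec R)}.
  exact (@smooth_map_continuous R (R6 R) O oO (M4 R) (@sec R) y smooth_map_sec_ball).
have oQ : open Q.
  rewrite openE => y [Py Wy].
  have n1 : \forall z \near y, P z by exact: open_nbhs_nbhs.
  have n2 : \forall z \near y, W (sec z).
    exact: (cs _ (PO _ Py) _ (open_nbhs_nbhs (conj oW Wy))).
  by near=> z; split; near: z.
have sQ : smooth_on Q (F \o @sec R).
  apply: (smooth_comp oQ) sF; last by move=> y [].
  have [t eT sT] := smooth_map_sec_ball; exists t; first by move=> y [/PO/eT].
  by move=> p ps ws y [/PO Oy _]; exact: sT.
suff : smooth_on Q f by apply; split.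
apply: (eq_smooth oQ _ sQ) => y [Py Wy] /=.
have Oy := PO _ Py.
by rewrite -(FE (slice_pt y) (sec y) (Vx _ Py) Wy (lifts_slice Oy)) /= chart_mapK.
Unshelve. all: by end_near. Qed.

Lemma slice_chart : smooth_chart chart_dom chart_map.
Proof.
split.
- exact: open_chart_image.
- move=> _ _ /set_mem[x Ox <-] /set_mem[y Oy <-].
  by rewrite !chart_mapK // => ->.
- move=> V VU; split=> [|oV]; first exact: chart_image_open.
  have VO : chart_map @` V `<=` O by rewrite -chart_image_dom; exact: image_subset.
  have := open_chart_image oV VO.
  suff -> : [set rep_class (slice_pt x) | x in chart_map @` V] = V by [].
  apply/seteqP; split=> [_ [_ [m Vm <-] <-]|m Vm].
    by have [x Ox xm] := VU _ Vm; rewrite -xm chart_mapK // xm.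
  have [x Ox xm] := VU _ Vm.
  by exists x => //; exists m => //; rewrite -xm chart_mapK.
- move=> P f; rewrite chart_image_dom => PO oP; split.
    exact: chart_smooth1.
  exact: chart_smooth2.
Qed.

End Ball.
End Chart.

(** * Balls have positive volume *)

Section Volume.
Context {R : realType}.

Lemma product_measure_ball d (T : measurableType d) (m : {measure set T -> \bar R})
    (S : set T) (a e k : R) : 0 < e -> measurable S -> m S = k%:E ->
  (m \x @lebesgue_measure R)%E (S `*` ball a e) = (k * (e *+ 2))%:E.
Proof.
move=> e0 mS mSk; rewrite product_measure1E //; last exact: measurable_realfun.measurable_ball.
by rewrite mSk EFinM; congr (_ * _)%E; exact: lebesgue_measure_ball (ltW e0).
Qed.

(** In the product norm a ball is a box, of volume [(2 e)^6]. *)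
Lemma ball_not_negligible (b : R6 R) (e : R) : 0 < e ->
  ~ (@lebesgue6 R).-negligible (ball b e).
Proof.
move=> e0 [B [mB B0 bB]].
case: b bB => [[[[[b1 b2] b3] b4] b5] b6] bB.
pose I (a : R) : set (measurableTypeR R) := ball a e.
have mI a : measurable (I a) by exact: measurable_realfun.measurable_ball.
pose S := I b1 `*` I b2 `*` I b3 `*` I b4 `*` I b5 `*` I b6.
have mS : measurable S by do 5!(apply: measurableX => //).
have SB : S `<=` B.
  move=> [[[[[x1 x2] x3] x4] x5] x6] /= [[[[[/= h1 h2] /= h3] /= h4] /= h5] /= h6].
  by apply: bB; do 5!(split => //).
have lS : @lebesgue6 R S = ((e *+ 2) ^+ 6)%:E.
  rewrite !exprSr expr0 mul1r.
  do 4!(apply: product_measure_ball => //; first by repeat apply: measurableX).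
  apply: product_measure_ball => //.
  exact: lebesgue_measure_ball (ltW e0).
have : (@lebesgue6 R S <= @lebesgue6 R B)%E by apply: le_measure; rewrite ?inE.
rewrite B0 lS lee_fin leNgt; apply/negP; rewrite negbK.
by rewrite exprn_gt0 // mulrn_wgt0.
Qed.

End Volume.

(** * Base points *)

Section BasePoint.
Context {R : realType}.

Variables (l a c : R).
Hypotheses (l1 : 1 < l) (a0 : 0 < a) (c0 : c != 0) (c1 : 0 < 1 + c) (c3 : c < 3).

(** With [xp = xa], [xr = xc] and [xt = 0] the slice formulas give [A2 = B1] and [B2 = A1]. *)
Definition base : R6 R := (l, a, c, a, c, 0).

Let l0 : l != 0. Proof. by rewrite gt_eqF // (lt_trans ltr01). Qed.
Let a0' : a != 0. Proof. by rewrite gt_eqF. Qed.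

Lemma base_m : sec_m base = 1.
Proof. by rewrite /sec_m /sec_d /=; field. Qed.

Lemma base_q : sec_q base = 1.
Proof. by rewrite /sec_q base_m /=; field; rewrite c0. Qed.

Lemma base_s : sec_s base = sec_d base.
Proof. by rewrite /sec_s base_q /=; field; rewrite c0. Qed.

Lemma base_A2 : sec_A2 base = sec_B1 base.
Proof. by rewrite /sec_A2 /sec_B1 base_q base_s. Qed.

Lemma base_A2' : sec_A2' base = mx2 a (l * l) (c * l^-1 * l^-1) (sec_d base).
Proof.
rewrite /sec_A2' base_A2 /sec_A1 /sec_B1 !mx2_simpl /sec_d /=.
by rewrite /xl /xa /xc /=; congr mx2; field; rewrite ?l0 ?a0'.
Qed.

Lemma base_N : sec_N base = mx2 (l * l) 0 0 1.
Proof.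
rewrite /sec_N /transporter base_A2' base_A2 /sec_B1 !mx2E /=.
by rewrite /xa /xc /=; congr mx2; ring.
Qed.

Lemma base_B2 : sec_B2 base = sec_A1 base.
Proof.
rewrite /sec_B2 base_N det_mx2 mulr1 mul0r subr0 -expr2 sqrtr_sqr gtr0_norm; last first.
  exact: lt_trans l1.
by rewrite /sec_A1 scalemx_mx2 /xl /=; congr mx2; field.
Qed.

Lemma base_trB1 : 0 < \tr (sec_B1 base).
Proof. by rewrite tr_mx2 /sec_d /= addr_gt0 // divr_gt0. Qed.

Lemma base_good : good base.
Proof.
have l0' : 0 < l by exact: lt_trans l1.
split=> //; rewrite ?base_m ?base_A2' ?base_N ?base_A2 ?base_trB1 ?mx2E ?det_mx2 ?tr_mx2 //.
- by rewrite gt_eqF.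
- exact: mulr_gt0.
- by rewrite mulr1 mul0r subr0 mulr_gt0.
- by rewrite addr_gt0 // mulr_gt0.
Qed.

Definition reg_dom : set (R6 R) :=
  [set x | [/\ xl x != 0, xa x != 0, xc x != 0 & sec_m x != 0]].

Lemma open_reg_dom : open reg_dom.
Proof.
have oT : open (setT : set (R6 R)) by exact: openT.
have near0 (U : set (R6 R)) (f : R6 R -> R) x : open U -> smooth_on U f -> U x ->
    f x != 0 -> \forall y \near x, f y != 0.
  move=> oU sf Ux fx.
  exact: (smooth_continuous sf Ux (open_nbhs_nbhs (conj open_neq0 fx))).
pose U1 := [set x : R6 R | xa x != 0].
have oU1 : open U1.
  rewrite openE => x xa0; exact: near0 oT (smooth_xa oT) I xa0.
have sm : smooth_on U1 (@sec_m R).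
  apply: (smoothB oU1); last exact: smooth_xr.
  apply: (smoothM oU1); last exact: smooth_xp.
  apply: (smooth_div oU1) => //; last exact: smooth_xa.
  by apply: (smoothD oU1); [exact: smooth_cst|exact: smooth_xc].
rewrite openE => x [xl0 xa0 xc0 xm0].
have n1 := near0 _ _ _ oT (smooth_xl oT) I xl0.
have n2 := near0 _ _ _ oT (smooth_xa oT) I xa0.
have n3 := near0 _ _ _ oT (smooth_xc oT) I xc0.
have n4 := near0 _ _ _ oU1 sm xa0 xm0.
by near=> y; split; near: y.
Unshelve. all: by end_near. Qed.

Lemma good_near : \forall x \near base, good x.
Proof.
have oD := open_reg_dom; have gb := base_good.
have Db : reg_dom base by split; rewrite ?base_m ?oner_neq0.
have la0 x : reg_dom x -> [/\ xl x != 0, xa x != 0, xc x != 0 & sec_m x != 0] by [].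
have near0 (f : R6 R -> R) : smooth_on reg_dom f -> 0 < f base -> \forall y \near base, 0 < f y.
  move=> sf fb.
  exact: (smooth_continuous sf Db (open_nbhs_nbhs (conj open_gt0 fb))).
have n0 : \forall x \near base, reg_dom x by exact: open_nbhs_nbhs.
have n1 : \forall x \near base, 0 < xl x - 1.
  apply: near0; last by rewrite subr_gt0.
  by apply: (smoothB oD); [exact: smooth_xl|exact: smooth_cst].
have n2 := near0 _ (smooth_xa oD) a0.
have n4 : \forall x \near base, 0 < 1 + xc x.
  apply: near0 => //.
  by apply: (smoothD oD); [exact: smooth_cst|exact: smooth_xc].
have n5 := near0 _ (smooth_sec_m oD la0) (good_m gb).
have n6 := near0 _ (msmooth_sec_A2' oD la0 0 1) (good_q gb).
have n7 := near0 _ (smooth_det oD (msmooth_sec_N oD la0)) (good_N gb).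
have n8 := near0 _ (smooth_tr oD (msmooth_sec_B1 oD la0)) (good_tB1 gb).
have n9 := near0 _ (smooth_tr oD (msmooth_sec_A2 oD la0)) (good_tA2 gb).
have n10 := near0 _ (smooth_tr oD (msmooth_sec_N oD la0)) (good_tN gb).
near=> x; split; try by near: x.
- by rewrite -subr_gt0; near: x.
- by have [] : reg_dom x by near: x.
- by rewrite gt_eqF //; near: x.
Unshelve. all: by end_near. Qed.

(** For [sec_B1] the discriminant condition reads [(1 + c)^2 < 4 (1 + c)]; hence the bound
    [c < 3]. *)
Lemma base_rot_pos g : rot_pos (sec_gen base g).
Proof.
have pA : rot_pos (sec_A1 base).
  split; first by rewrite tr_mx2 /= addr_gt0 ?invr_gt0 // (lt_trans ltr01).
  by rewrite !mx2E /= addr0 expr0n /= mulfV // mulr1.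
have pB : rot_pos (sec_B1 base).
  split; first exact: base_trB1.
  rewrite !mx2E /sec_d /= (mulrC a) divfK // expr2 ltr_pM2r //.
  by rewrite -ltrBrDl; apply: lt_le_trans c3 _; lra.
by case: g => /=; rewrite ?base_A2 ?base_B2.
Qed.

(* Near the base point, which is invariant under the exchange of the two
   handles, the Euler class vanishes. *)
Lemma base_ball : exists2 e : R, 0 < e & forall x, ball base e x ->
  exists gx : good x, euler_class (sec_rep gx) 0.
Proof.
have /nbhs_ballP[e /= e0 gO] := good_near.
have oO : open (ball base e) by exact: ball_open.
have Ob : ball base e base by exact: ballxx.
have la0 x : ball base e x -> [/\ xl x != 0, xa x != 0, xc x != 0 & sec_m x != 0].
  move=> /gO gx; split; first by rewrite gt_eqF // (lt_trans ltr01) // good_l.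
  - by rewrite gt_eqF // good_a.
  - exact: good_c.
  - by rewrite gt_eqF // good_m.
have N0 x : ball base e x -> 0 < \det (sec_N x) by move=> /gO; exact: good_N.
have cM g i j : {for base, continuous (fun x => sec_gen x g i j)}.
  exact: (smooth_continuous (msmooth_sec_gen oO la0 N0 g i j) Ob).
have := rel_lift_near cM base_rot_pos (det_sec_gen base_good) base_A2 base_B2.
move=> nr.
have : \forall x \near base, good x /\ (forall g, rot_pos (sec_gen x g)) /\
    `|rel_lift (sec_gen x) 0| < pi.
  by near=> x; split; [near: x; exact: good_near|near: x].
move=> /nbhs_ballP[d /= d0 dO]; exists d => // x /dO[gx [px rx]].
exists gx; apply: (euler_class0 (s := sec_sl2 gx)) => //.
by move=> g; rewrite -sec_hom_gen.
Unshelve. all: by end_near. Qed.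

End BasePoint.

(** * The sign of the bracket near an integral representation *)

Section PositivePolynomial.
Context {R : realType}.
Variable J : set R.

(** Denominators are positive on [J], so that clearing them multiplies a matrix by a positive
    function. *)
Definition rational_on (f : R -> R) : Prop :=
  exists N D : {poly R}, forall t, J t -> 0 < D.[t] /\ f t = N.[t] / D.[t].

Lemma rational_poly (p : {poly R}) : rational_on (horner p).
Proof. by exists p, 1 => t _; rewrite hornerC divr1. Qed.

Lemma eq_rational f g : (forall t, J t -> f t = g t) -> rational_on f -> rational_on g.
Proof.
by move=> fg [N [D ND]]; exists N, D => t Jt; rewrite -fg //; exact: ND.
Qed.

Lemma rational_cst (k : R) : rational_on (fun=> k).
Proof. by apply: eq_rational (rational_poly k%:P) => t _; rewrite hornerC. Qed.

Lemma rationalD f g : rational_on f -> rational_on g ->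
  rational_on (fun t => f t + g t).
Proof.
move=> [N [D ND]] [N' [D' ND']]; exists (N * D' + N' * D), (D * D') => t Jt.
have [D0 ->] := ND t Jt; have [D0' ->] := ND' t Jt.
rewrite !(hornerD, hornerM) mulr_gt0 //; split=> //.
by field; rewrite !gt_eqF.
Qed.

Lemma rationalM f g : rational_on f -> rational_on g ->
  rational_on (fun t => f t * g t).
Proof.
move=> [N [D ND]] [N' [D' ND']]; exists (N * N'), (D * D') => t Jt.
have [D0 ->] := ND t Jt; have [D0' ->] := ND' t Jt.
rewrite !hornerM mulr_gt0 //; split=> //.
by field; rewrite !gt_eqF.
Qed.

Lemma rationalN f : rational_on f -> rational_on (fun t => - f t).
Proof.
move=> /(rationalM (rational_cst (-1))); apply: eq_rational => t _.
by rewrite mulN1r.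
Qed.

Lemma rationalV f : rational_on f -> (forall t, J t -> f t != 0) ->
  rational_on (fun t => (f t)^-1).
Proof.
(* The inverse is written as [D N / N^2], because [N] may be negative. *)
move=> [N [D ND]] f0; exists (D * N), (N * N) => t Jt.
have [D0 fE] := ND t Jt; have N0 : N.[t] != 0.
  by apply: contra (f0 t Jt) => /eqP N0; rewrite fE N0 mul0r.
rewrite !hornerM -expr2 exprn_even_gt0 //; split=> //.
by rewrite fE; field; rewrite N0 gt_eqF.
Qed.

Definition mrational (M : R -> 'M[R]_2) : Prop :=
  forall i j, rational_on (fun t => M t i j).

Lemma mrational_mx2 a b c d : rational_on a -> rational_on b -> rational_on c ->
  rational_on d -> mrational (fun t => mx2 (a t) (b t) (c t) (d t)).
Proof.
move=> ra rb rc rd i j; case: (ord2P i) => ->; case: (ord2P j) => ->;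
  [move: ra|move: rb|move: rc|move: rd]; apply: eq_rational => t _; by rewrite mx2E.
Qed.

Lemma mrationalM M N : mrational M -> mrational N -> mrational (fun t => M t *m N t).
Proof.
move=> rM rN i j.
apply: (@eq_rational (fun t => M t i 0 * N t 0 j + M t i 1 * N t 1 j)).
  by move=> t _; rewrite mulmx2E.
by apply: rationalD; exact: rationalM.
Qed.

Lemma mrational_adj M : mrational M -> mrational (fun t => adj2 (M t)).
Proof. by move=> rM; apply: mrational_mx2 => //; exact: rationalN. Qed.

(** [sec_B2] contains a square root, hence the factor [k]. A positive factor affects neither an
    intertwining relation nor the sign of a determinant. *)
Definition pos_poly (M : R -> 'M[R]_2) : Prop :=
  exists (P : 'M[{poly R}]_2) (k : R -> R),
    forall t, J t -> 0 < k t /\ M t = k t *: eval_mx P t.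

Lemma pos_poly_rational M : mrational M -> pos_poly M.
Proof.
move=> rM.
have [N0 [D0 e0]] := rM 0 0; have [N1 [D1 e1]] := rM 0 1.
have [N2 [D2 e2]] := rM 1 0; have [N3 [D3 e3]] := rM 1 1.
exists (mx2 (N0 * (D1 * D2 * D3)) (N1 * (D0 * D2 * D3))
            (N2 * (D0 * D1 * D3)) (N3 * (D0 * D1 * D2))).
exists (fun t => (D0.[t] * D1.[t] * D2.[t] * D3.[t])^-1) => t Jt.
have [p0 f0] := e0 t Jt; have [p1 f1] := e1 t Jt.
have [p2 f2] := e2 t Jt; have [p3 f3] := e3 t Jt.
split; first by rewrite invr_gt0 !mulr_gt0.
by apply: eq_mx2; rewrite !mxE ?f0 ?f1 ?f2 ?f3 /= /horner_eval !hornerM; field;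
  rewrite !gt_eqF.
Qed.

Lemma pos_polyZ (c : R -> R) M : (forall t, J t -> 0 < c t) -> pos_poly M ->
  pos_poly (fun t => c t *: M t).
Proof.
move=> c0 [P [k PE]]; exists P, (fun t => c t * k t) => t Jt.
have [k0 ->] := PE t Jt; split; first by rewrite mulr_gt0 // c0.
by rewrite scalerA.
Qed.

Lemma pos_polyM M N : pos_poly M -> pos_poly N -> pos_poly (fun t => M t *m N t).
Proof.
move=> [P [k PE]] [Q [l QE]]; exists (P *m Q), (fun t => k t * l t) => t Jt.
have [k0 ->] := PE t Jt; have [l0 ->] := QE t Jt; split; first exact: mulr_gt0.
by rewrite /eval_mx map_mxM -scalemxAl -scalemxAr scalerA.
Qed.

Lemma pos_poly_adj M : pos_poly M -> pos_poly (fun t => adj2 (M t)).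
Proof.
move=> [P [k PE]]; exists (adj2 P), k => t Jt.
by have [k0 ->] := PE t Jt; rewrite adj2Z /eval_mx map_adj2.
Qed.

Lemma pos_poly_brk M N : pos_poly M -> pos_poly N -> pos_poly (fun t => brk (M t) (N t)).
Proof.
move=> [P [k PE]] [Q [l QE]]; exists (brk P Q), (fun t => k t * l t) => t Jt.
have [k0 ->] := PE t Jt; have [l0 ->] := QE t Jt; split; first exact: mulr_gt0.
rewrite /brk /eval_mx map_mxB !map_mxM -!scalemxAl -!scalemxAr !scalerA.
by rewrite scalerBr (mulrC (l t)).
Qed.

Lemma pos_poly_word (G : R -> generator -> 'M[R]_2) w :
  (forall g, pos_poly (G ^~ g)) -> pos_poly (fun t => word_mx (G t) w).
Proof.
move=> pG; elim: w => [|[g s] w IH] /=.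
  by exists 1%:M, (fun=> 1) => t _; rewrite /eval_mx map_mx1 scale1r.
by apply: pos_polyM IH; case: s; [exact: pG|exact: pos_poly_adj (pG g)].
Qed.

End PositivePolynomial.

Section WordContinuous.
Context {R : realType} (T : topologicalType).

Lemma continuous_word_mx (p : T) (G : T -> generator -> 'M[R]_2) w i j :
  (forall g i j, {for p, continuous (fun x => G x g i j)}) ->
  {for p, continuous (fun x => word_mx (G x) w i j)}.
Proof.
move=> cG; elim: w i j => [|[g s] w IH] i j /=; first exact: cst_continuous.
apply: (@eq_continuous_for _ _ _ (fun x =>
    (if s then G x g else adj2 (G x g)) i 0 * word_mx (G x) w 0 j +
    (if s then G x g else adj2 (G x g)) i 1 * word_mx (G x) w 1 j)).
  by move=> x; rewrite mulmx2E.
have cs k : {for p, continuous (fun x => (if s then G x g else adj2 (G x g)) i k)}.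
  by case: s; [exact: cG|apply: continuous_adj2 => a b; exact: cG].
by apply: cvgD; apply: cvgM; [exact: cs|exact: IH|exact: cs|exact: IH].
Qed.

End WordContinuous.

(** * Irreducibility of slice representations *)

Section Irreducible.
Context {R : realType}.

Lemma val_sec_hom (x : R6 R) (gx : good x) y :
  val (sec_hom gx y) = word_mx (sec_gen x) (repr y).
Proof. by rewrite /= /Gamma2_lift_fun val_word. Qed.

(* A singular [M] intertwining a family of matrices satisfies [M Z adj2 M = 0]
   for every [Z] in the algebra generated by the family. *)
Lemma sec_irreducible (x : R6 R) (gx : good x) (f : Gamma2 -> Gamma2) (M : 'M[R]_2) :
  M != 0 -> (forall y, M *m val (sec_hom gx y) = val (sec_hom gx (f y)) *m M) ->
  \det M != 0.
Proof.
move=> M0 Mf; apply: contra M0 => /eqP dM.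
pose S (Z : 'M[R]_2) := exists Z', M *m Z = Z' *m M.
have SD Y Z : S Y -> S Z -> S (Y + Z).
  by move=> [Y' e] [Z' e']; exists (Y' + Z'); rewrite mulmxDr mulmxDl e e'.
have SM Y Z : S Y -> S Z -> S (Y *m Z).
  by move=> [Y' e] [Z' e']; exists (Y' *m Z'); rewrite mulmxA e -!mulmxA e'.
have SZ k Y : S Y -> S (k *: Y).
  by move=> [Y' e]; exists (k *: Y'); rewrite -scalemxAr e scalemxAl.
have S1 : S 1%:M by exists 1%:M; rewrite mulmx1 mul1mx.
have SA : S (sec_A1 x) by exists (val (sec_hom gx (f (gen A1)))); rewrite -Mf sec_hom_gen.
have SB : S (sec_B1 x) by exists (val (sec_hom gx (f (gen B1)))); rewrite -Mf sec_hom_gen.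
have S0 Z : S Z -> M *m Z *m adj2 M = 0.
  by move=> [Z' ->]; rewrite -mulmxA mulmx_adj2 dM -scalemx1 scale0r mulmx0.
have l1 := good_l gx; have l0 : 0 < xl x := lt_trans ltr01 l1.
have li : (xl x)^-1 < 1 by rewrite invf_lt1.
have w0 : xl x - (xl x)^-1 != 0 by rewrite gt_eqF // subr_gt0 (lt_trans li).
(* The distinct eigenvalues of [sec_A1 x] yield the diagonal matrix units, and the nonzero
   off-diagonal entries of [sec_B1 x] yield the other two. *)
have S11 : S (mx2 1 0 0 0).
  have -> : mx2 1 0 0 0 = (xl x - (xl x)^-1)^-1 *: (sec_A1 x + (- (xl x)^-1) *: 1%:M).
    rewrite /sec_A1 scalar_mx2 !mx2_simpl; congr mx2; rewrite ?mulr1 ?mulr0 ?addr0 ?mulr0 //.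
      by rewrite mulVf.
    by rewrite subrr mulr0.
  by apply/SZ/SD => //; exact: SZ.
have S22 : S (mx2 0 0 0 1).
  have -> : mx2 0 0 0 1 = 1%:M + (-1) *: mx2 1 0 0 0 :> 'M[R]_2.
    by rewrite scalar_mx2 !mx2_simpl; congr mx2; ring.
  by apply: SD => //; exact: SZ.
have S12 : S (mx2 0 1 0 0).
  have -> : mx2 0 1 0 0 = mx2 1 0 0 0 *m sec_B1 x *m mx2 0 0 0 1.
    by rewrite /sec_B1 !mx2_simpl; congr mx2; ring.
  by apply: (SM) => //; exact: (SM).
have S21 : S (mx2 0 0 1 0).
  have c0 := good_c gx.
  have -> : mx2 0 0 1 0 = (xc x)^-1 *: (mx2 0 0 0 1 *m sec_B1 x *m mx2 1 0 0 0).
    by rewrite /sec_B1 !mx2_simpl; congr mx2; field.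
  by apply: SZ; apply: (SM) => //; exact: (SM).
(* Up to sign, the square of each entry of [M] occurs in one of these two products. *)
have e1 := S0 _ S12; have e2 := S0 _ S21.
have sq (k : R) : k * k = 0 -> k = 0 by move/eqP; rewrite mulf_eq0 orbb => /eqP.
apply/eqP; move: e1 e2; rewrite /adj2 [M]mx2_eta !mx2E !mx2_simpl.
move=> /matrixP e1 /matrixP e2.
have := e1 0 1; have := e1 1 0; have := e2 0 1; have := e2 1 0.
rewrite !mx2E !mxE => h1 h2 h3 h4.
by apply: eq_mx2; rewrite !mx2E mxE; apply: sq; lra.
Qed.

End Irreducible.

(** * Segments in the slice and the sign of the bracket *)

Section Path.
Context {R : realType}.
Variables (b : R6 R) (e : R).
Hypothesis gO : forall x, ball b e x -> good x.

Section Segment.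
Variables (x : R6 R) (bx : ball b e x).

Definition segment (t : R) : R6 R := t *: (x - b) + b.

(** [intertwiner_det_sign] needs two-sided neighbourhoods of the times in [[0, 1]], the end points
    included; [J] contains such neighbourhoods. *)
Let J : set R := [set t | ball b e (segment t)].

Lemma segment_ball (t : R) : 0 <= t <= 1 -> J t.
Proof.
move=> /andP[t0 t1]; move: bx; rewrite /J /segment -ball_normE /ball_ /=.
rewrite opprD addrCA subrr addr0 normrN normrZ ger0_norm // distrC => bx'.
by apply: le_lt_trans bx'; rewrite ler_piMl.
Qed.

Lemma segment_continuous : continuous segment.
Proof.
move=> t; apply: (@cvgD _ (R6 R)); last exact: cvg_cst.
exact: scalel_continuous.
Qed.

Lemma segment_near (t : R) : 0 <= t <= 1 -> \forall u \near t, J u.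
Proof.
move=> t01; apply: (@segment_continuous t); apply: open_nbhs_nbhs.
by split; [exact: ball_open|exact: segment_ball].
Qed.

Lemma rational_coord (f : R6 R -> R) : lincont f ->
  rational_on J (fun t => f (segment t)).
Proof.
move=> [lf _].
apply: eq_rational (rational_poly J ((f b)%:P + 'X * (f (x - b))%:P)) => t _.
by rewrite !hornerE /segment lf addrC.
Qed.

Let good_J t : J t -> good (segment t). Proof. exact: gO. Qed.

Let rl : rational_on J (fun t => xl (segment t)).
Proof. exact: rational_coord (@lincont_xl R). Qed.
Let ra : rational_on J (fun t => xa (segment t)).
Proof. exact: rational_coord (@lincont_xa R). Qed.
Let rc : rational_on J (fun t => xc (segment t)).
Proof. exact: rational_coord (@lincont_xc R). Qed.
Let rp : rational_on J (fun t => xp (segment t)).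
Proof. exact: rational_coord (@lincont_xp R). Qed.
Let rr : rational_on J (fun t => xr (segment t)).
Proof. exact: rational_coord (@lincont_xr R). Qed.
Let rt : rational_on J (fun t => xt (segment t)).
Proof. exact: rational_coord (@lincont_xt R). Qed.

Let nz (f : R6 R -> R) : (forall y, good y -> f y != 0) ->
  forall t, J t -> f (segment t) != 0.
Proof. by move=> f0 t Jt; apply/f0/good_J. Qed.

Let nl : forall t, J t -> xl (segment t) != 0.
Proof. by apply: nz => y gy; rewrite gt_eqF // (lt_trans ltr01) // good_l. Qed.
Let na : forall t, J t -> xa (segment t) != 0.
Proof. by apply: nz => y gy; rewrite gt_eqF // good_a. Qed.
Let nc : forall t, J t -> xc (segment t) != 0.
Proof. by apply: nz => y gy; rewrite good_c. Qed.
Let nm : forall t, J t -> sec_m (segment t) != 0.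
Proof. by apply: nz => y gy; rewrite gt_eqF // good_m. Qed.

Let rd : rational_on J (fun t => sec_d (segment t)).
Proof.
apply: rationalM; last exact: rationalV ra na.
by apply: rationalD; [exact: rational_cst|exact: rc].
Qed.

Let rm : rational_on J (fun t => sec_m (segment t)).
Proof. by apply: rationalD; [exact: rationalM rd rp|exact: rationalN rr]. Qed.

Let rll : rational_on J (fun t => xl (segment t) * xl (segment t)).
Proof. exact: rationalM rl rl. Qed.

Let rac : rational_on J (fun t =>
  xa (segment t) * (xl (segment t) * xl (segment t)) / xc (segment t)).
Proof. by apply: rationalM; [exact: rationalM ra rll|exact: rationalV rc nc]. Qed.

Let rq : rational_on J (fun t => sec_q (segment t)).
Proof.
apply: rationalM; last exact: rationalV rm nm.
apply: rationalD; last by apply: rationalM rac _; exact: rationalM rp rr.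
apply: rationalD; first exact: rational_cst.
by apply/rationalN/rationalM; [exact: rll|exact: rationalM rp rp].
Qed.

Let rs : rational_on J (fun t => sec_s (segment t)).
Proof.
apply: rationalD; last exact: rationalM rd rq.
by apply: rationalD; [exact: rationalM rll rp|apply/rationalN; exact: rationalM rac rr].
Qed.

Let rA1 : mrational J (fun t => sec_A1 (segment t)).
Proof.
by apply: mrational_mx2; [exact: rl|exact: rational_cst|exact: rational_cst|
  exact: rationalV rl nl].
Qed.

Let rB1 : mrational J (fun t => sec_B1 (segment t)).
Proof.
by apply: mrational_mx2; [exact: ra|exact: rational_cst|exact: rc|exact: rd].
Qed.

Let rA2 : mrational J (fun t => sec_A2 (segment t)).
Proof. by apply: mrational_mx2; [exact: rp|exact: rq|exact: rr|exact: rs]. Qed.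

Let rA2' : mrational J (fun t => sec_A2' (segment t)).
Proof.
apply: mrationalM rA2; apply: mrationalM (mrational_adj rB1).
by apply: mrationalM (mrational_adj rA1); exact: mrationalM rA1 rB1.
Qed.

Let rN : mrational J (fun t => sec_N (segment t)).
Proof.
have r2 i j := rA2 i j; have r2' i j := rA2' i j.
apply: mrational_mx2; first exact: r2'.
- exact: rationalM (r2' 0 1) rt.
- apply: rationalD; last exact: rationalN.
  by apply: rationalD (r2 0 0) _; exact: rationalM rt (r2 1 0).
- apply: rationalD; last by apply: rationalN; exact: rationalM rt (r2' 0 0).
  by apply: rationalD (r2 0 1) _; exact: rationalM rt (r2 1 1).
Qed.

Lemma pos_poly_sec_gen g : pos_poly J (fun t => sec_gen (segment t) g).
Proof.
case: g; try exact: pos_poly_rational.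
apply: pos_polyZ; last exact: pos_poly_rational.
by move=> t Jt; rewrite invr_gt0 sqrtr_gt0; apply/good_N/good_J.
Qed.

Lemma sec_gen_segment_continuous (t : R) g i j : 0 <= t <= 1 ->
  {for t, continuous (fun u => sec_gen (segment u) g i j)}.
Proof.
move=> t01; have Ot := segment_ball t01.
have oO : open (ball b e) by exact: ball_open.
have la0 y : ball b e y -> [/\ xl y != 0, xa y != 0, xc y != 0 & sec_m y != 0].
  move=> /gO gy; split; first by rewrite gt_eqF // (lt_trans ltr01) // good_l.
  - by rewrite gt_eqF // good_a.
  - exact: good_c.
  - by rewrite gt_eqF // good_m.
have N0 y : ball b e y -> 0 < \det (sec_N y) by move=> /gO; exact: good_N.
apply: (@continuous_comp _ _ _ segment (fun y => sec_gen y g i j)).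
  exact: segment_continuous.
exact: (smooth_continuous (msmooth_sec_gen oO la0 N0 g i j) Ot).
Qed.

(* The bracket [g] of the images of [psi a1] and [psi b1] intertwines the
   representation and its twist by the hyperelliptic involution. *)
Lemma bracket_path (psi : UMagmaMorphism.type Gamma2 Gamma2) (psi' : Gamma2 -> Gamma2)
    (gb : good b) (gx : good x) : cancel psi' psi ->
  0 < \det (brk (val (sec_hom gx (psi (gen A1)))) (val (sec_hom gx (psi (gen B1))))) ->
  exists M : 'M[R]_2, 0 < \det M /\ forall y,
    M *m val (sec_hom gb y) = val (sec_hom gb (psi (hyp (psi' y)))) *m M.
Proof.
move=> psiK; rewrite !val_sec_hom; set u := repr _; set v := repr _ => d1.
pose W t (y : Gamma2) := word_mx (sec_gen (segment t)) (repr y).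
have s0 : segment 0 = b by rewrite /segment scale0r add0r.
have s1 : segment 1 = x by rewrite /segment scale1r subrK.
have WE t (gt : good (segment t)) y : val (sec_hom gt y) = W t y by rewrite val_sec_hom.
have [P [k PE]] := pos_poly_brk
  (pos_poly_word u pos_poly_sec_gen) (pos_poly_word v pos_poly_sec_gen).
have cW y (t : R) i j : 0 <= t <= 1 -> {for t, continuous (fun u => W u y i j)}.
  by move=> t01; apply: continuous_word_mx => g a c; exact: sec_gen_segment_continuous.
have PW y (t : R) : 0 <= t <= 1 -> \forall s \near t,
    eval_mx P s *m W s y = W s (psi (hyp (psi' y))) *m eval_mx P s.
  move=> t01; apply: filterS (segment_near t01) => s Js.
  have [k0 gE] := PE s Js; have gs := good_J Js.
  pose h : UMagmaMorphism.type Gamma2 (SL2 R) := (sec_hom gs \o psi).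
  have hE z : val (h z) = W s (psi z) := WE s gs (psi z).
  have := hyp_intertwine h (psi' y).
  rewrite /= !hE psiK gE -scalemxAl -scalemxAr.
  by move/(congr1 (fun M => (k s)^-1 *: M)); rewrite !scalerA mulVf ?gt_eqF // !scale1r.
have irr (t : R) (M : 'M[R]_2) : 0 <= t <= 1 -> M != 0 ->
    (forall y, M *m W t y = W t (psi (hyp (psi' y))) *m M) -> \det M != 0.
  move=> t01 M0 Mf; have gt := good_J (segment_ball t01).
  apply: (@sec_irreducible R _ gt (psi \o hyp \o psi') M M0) => y.
  by rewrite !(WE t gt) Mf.
have P1 : 0 < (\det P).[1].
  have [|k1 gE] := PE 1; first by apply: segment_ball; rewrite ler01 lexx.
  move: d1; rewrite s1 in gE; rewrite gE detZ det_eval_mx pmulr_rgt0 //.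
  exact: exprn_gt0.
have [M [M0 MW]] := intertwiner_det_sign (fun y t i j => @cW y t i j)
  (fun y t i j => @cW (psi (hyp (psi' y))) t i j) PW irr P1.
exists M; split=> // y.
by have := MW y; rewrite /W s0 !val_sec_hom.
Qed.

End Segment.
End Path.

(* The slice point conjugate to the integral representation [int_hom]. *)
Section IntegralPoint.
Context {R : realType}.

Let w : R := Num.sqrt 5.
Let w2 : w * w = 5. Proof. by rewrite -expr2 sqr_sqrtr. Qed.
Let w_bnd : 2 < w < 5 / 2.
Proof.
have w0 : 0 <= w by exact: sqrtr_ge0.
have e := w2; apply/andP; split; nra.
Qed.

(** The larger eigenvalue of [int_A]. In an eigenbasis of [int_A], [int_a] is the upper left entry
    of [int_B] and [int_c] the product of its off-diagonal entries. *)
Definition int_l : R := (3 + w) / 2.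
Definition int_a : R := 2 - 4 / 5 * w.
Definition int_c : R := - (1 / 5).
Definition int_point : R6 R := base int_l int_a int_c.

Lemma int_l1 : 1 < int_l. Proof. by move: w_bnd; rewrite /int_l; lra. Qed.
Lemma int_a0 : 0 < int_a. Proof. by move: w_bnd; rewrite /int_a; lra. Qed.
Lemma int_c0 : int_c != 0. Proof. by rewrite /int_c oppr_eq0 mulf_neq0 // invr_eq0. Qed.
Lemma int_c1 : 0 < 1 + int_c. Proof. by rewrite /int_c; lra. Qed.
Lemma int_c3 : int_c < 3. Proof. by rewrite /int_c; lra. Qed.

(** The columns are eigenvectors of [int_A] for [int_l] and its inverse, scaled against each other
    so that the upper right entry of [int_B] becomes 1. *)
Definition int_conj : 'M[R]_2 :=
  mx2 (1 / 2 + 3 / 10 * w) (-1) (1 / 2 + 1 / 10 * w) ((1 + w) / 2).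

Lemma det_int_conj : 0 < \det int_conj.
Proof. by rewrite det_mx2; move: w_bnd w2; nra. Qed.

Lemma int_conj_gen g :
  int_conj *m sec_gen int_point g = map_mx intr (int_gen g) *m int_conj.
Proof.
have l0 : int_l != 0 by rewrite gt_eqF // (lt_trans ltr01 int_l1).
have a0 : int_a != 0 by rewrite gt_eqF // int_a0.
have lV : int_l^-1 = (3 - w) / 2.
  apply: (mulfI l0); rewrite mulfV // /int_l; have := w2; nra.
have dE : sec_d int_point = 2 + 4 / 5 * w.
  apply: (mulfI a0); rewrite /sec_d mulrC divfK // /int_a /int_point /xc /= /int_c.
  have := w2; nra.
have eA : int_conj *m sec_A1 int_point = map_mx intr (int_gen A1) *m int_conj.
  rewrite /sec_A1 /int_conj map_mx2 /= !mx2E !mx2_simpl /xl /= lV /int_l.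
  by have e := w2; congr mx2; nra.
have eB : int_conj *m sec_B1 int_point = map_mx intr (int_gen B1) *m int_conj.
  rewrite /sec_B1 /int_conj map_mx2 /= !mx2E !mx2_simpl dE /xa /xc /= /int_a /int_c.
  by have e := w2; rewrite !rmorphN /=; congr mx2; nra.
have h1 := int_l1; have h2 := int_a0; have h3 := int_c0.
case: g => //=; first by rewrite base_A2.
by rewrite base_B2.
Qed.

Lemma int_conj_hom (g0 : good int_point) y :
  int_conj *m val (sec_hom g0 y) = val (@int_hom R y) *m int_conj.
Proof.
elim/Gamma2_ind: y => [|x y IHx IHy|g|g].
- by rewrite !gmulf1 mulmx1 mul1mx.
- by rewrite !gmulfM !val_SL2M mulmxA IHx -!mulmxA IHy.
- by rewrite sec_hom_gen Gamma2_lift_gen; exact: int_conj_gen.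
rewrite !gmulfV !val_SL2V sec_hom_gen Gamma2_lift_gen /=.
have d1 := det_sec_gen g0 g; have d2 := @det_int_gen R g.
set X := map_mx intr _ in d2 *; set Y := sec_gen _ _ in d1 *.
have XY : int_conj *m Y = X *m int_conj by exact: int_conj_gen.
rewrite -[LHS]mul1mx -d2 -mul_adj2mx -mulmxA; congr (_ *m _).
by rewrite mulmxA -XY -mulmxA mulmx_adj2 d1 mulmx1.
Qed.

(* The twist of an integral representation by the hyperelliptic involution is
   never conjugate to it by a matrix of positive determinant. *)
Lemma int_ball_bracket (e : R) (gO : forall x, ball int_point e x -> good x)
    (x : R6 R) (gx : good x) (psi : UMagmaMorphism.type Gamma2 Gamma2) :
  ball int_point e x -> bijective psi ->
  \det (brk (val (sec_hom gx (psi (gen A1)))) (val (sec_hom gx (psi (gen B1))))) <= 0.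
Proof.
move=> bx [psi' psiK psi'K]; rewrite leNgt; apply/negP => d0.
have g0 : good int_point by apply: base_good;
  [exact: int_l1|exact: int_a0|exact: int_c0|exact: int_c1].
have [M [M0 MW]] := bracket_path gO bx g0 psi'K d0.
(* [M] is carried from the slice point to [int_hom]; since [adj2] keeps the determinant, positivity
   survives. *)
apply: (@int_hom_no_intertwiner R (psi \o hyp \o psi')
  (int_conj *m M *m adj2 int_conj)) => [c cM y| |y].
- have := @hyp_additive _ (c \o psi) _ (psi' y) => /= ->; first by rewrite psi'K.
  by move=> u v; rewrite /= gmulfM cM.
- by rewrite !det_mulmx det_adj2 !mulr_gt0 // det_int_conj.
have adjE z : adj2 int_conj *m val (@int_hom R z) =
    val (sec_hom g0 z) *m adj2 int_conj.
  have u : \det int_conj != 0 by rewrite gt_eqF // det_int_conj.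
  apply: (scalerI u).
  transitivity (adj2 int_conj *m (val (@int_hom R z) *m int_conj) *m adj2 int_conj).
    by rewrite -!mulmxA mulmx_adj2 !mul_mx_scalar scalemxAr.
  by rewrite -(int_conj_hom g0) !mulmxA mul_adj2mx mul_scalar_mx scalemxAl.
by rewrite -[LHS]mulmxA adjE mulmxA -[int_conj *m M *m _]mulmxA MW mulmxA int_conj_hom -!mulmxA.
Qed.

End IntegralPoint.

(** * The invariant open set *)

Section BracketSign.
Context {R : realType}.
Implicit Types (rho sigma : nerep R) (s t : SL2 R) (A : M4 R)
  (psi : UMagmaMorphism.type Gamma2 Gamma2).

Lemma det_brk_pm s s' t t' : pm_eq s s' -> pm_eq t t' ->
  \det (brk (val s) (val t)) = \det (brk (val s') (val t')).
Proof.
have NN (M : 'M[R]_2) : \det (- M) = \det M.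
  by rewrite -scaleN1r detZ sqrrN expr1n mul1r.
rewrite /brk => -[] -> -[] ->; rewrite ?mulNmx ?mulmxN ?opprK // -?opprD ?NN //.
- by rewrite -NN opprD opprK.
- by rewrite -NN opprD opprK.
Qed.

Definition positive_bracket rho psi : Prop := exists s t,
  [/\ psl2 s = val rho (psi (gen A1)), psl2 t = val rho (psi (gen B1)) &
      0 < \det (brk (val s) (val t))].

Lemma positive_bracketP rho psi s t : psl2 s = val rho (psi (gen A1)) ->
  psl2 t = val rho (psi (gen B1)) ->
  positive_bracket rho psi <-> 0 < \det (brk (val s) (val t)).
Proof.
move=> sE tE; split=> [[s' [t' [s'E t'E]]]|d0]; last by exists s, t.
by rewrite (@det_brk_pm s' s t' t) //; apply/psl2_eqP; rewrite ?sE ?tE.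
Qed.

Lemma positive_bracket_conj rho sigma psi : conj_eq rho sigma ->
  positive_bracket rho psi -> positive_bracket sigma psi.
Proof.
move=> [g gE] [s [t [sE tE d0]]]; pose u := repr g.
exists (u * s * u^-1)%g, (u * t * u^-1)%g.
have uE : psl2 u = g by exact: psl2_surj.
split; first by rewrite gE !psl2M psl2V uE sE.
  by rewrite gE !psl2M psl2V uE tE.
have uu : adj2 (val u) *m val u = 1%:M by rewrite mul_adj2mx SL2_det.
rewrite /brk !val_SL2M !val_SL2V !mul_conj //.
by rewrite -mulmxBl -mulmxBr !det_mulmx det_adj2 SL2_det mul1r mulr1.
Qed.

Lemma rep_word (rho : rep R) (f : generator -> SL2 R) :
  (forall g, rho (gen g) = psl2 (f g)) ->
  forall y, rho y = psl2 (word_val f (repr y)).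
Proof.
move=> fE y; rewrite -[in LHS](reprK y) hom_word.
elim: (repr y) => [|[g b] w IH] /=; first by rewrite psl2_1.
by rewrite psl2M IH; case: b; rewrite ?psl2V fE.
Qed.

Definition lift_bracket psi A : 'M[R]_2 :=
  brk (word_mx (comp4 A) (repr (psi (gen A1)))) (word_mx (comp4 A) (repr (psi (gen B1)))).

Lemma positive_bracket_lift rho psi A : lifts_rep A (val rho) ->
  positive_bracket rho psi <-> 0 < \det (lift_bracket psi A).
Proof.
move=> /lifts_repP[f fE].
have rE := rep_word (fun g => (fE g).2).
rewrite (positive_bracketP (esym (rE _)) (esym (rE _))) !val_word.
rewrite /lift_bracket (_ : comp4 A = fun g => val (f g)) //.
by apply/funext => g; rewrite (fE g).1.
Qed.

Lemma lifts_rep_exists (rho : rep R) : exists A, lifts_rep A rho.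
Proof.
pose f g := repr (rho (gen g)).
exists (val (f A1), val (f B1), val (f A2), val (f B2)).
exists (f A1), (f B1), (f A2), (f B2); split=> //.
by rewrite /rep_coords /f !psl2_surj.
Qed.

Lemma positive_bracket_near rho psi : positive_bracket rho psi ->
  \forall sigma \near rho, positive_bracket sigma psi.
Proof.
have [A AE] := lifts_rep_exists (val rho).
move=> /(positive_bracket_lift psi AE) d0.
have c g i j : {for A, continuous (fun B : M4 R => comp4 B g i j)}.
  exact: (smooth_continuous (msmooth_comp4_gen g openT i j) I).
have cw w i j : {for A, continuous (fun B : M4 R => word_mx (comp4 B) w i j)}.
  exact: continuous_word_mx.
have cb i j : {for A, continuous (fun B => lift_bracket psi B i j)}.
  set u := repr (psi (gen A1)); set v := repr (psi (gen B1)).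
  apply: (@eq_continuous_for _ _ _ (fun B : M4 R =>
    (word_mx (comp4 B) u i 0 * word_mx (comp4 B) v 0 j +
     word_mx (comp4 B) u i 1 * word_mx (comp4 B) v 1 j) -
    (word_mx (comp4 B) v i 0 * word_mx (comp4 B) u 0 j +
     word_mx (comp4 B) v i 1 * word_mx (comp4 B) u 1 j))).
    by move=> B; rewrite /lift_bracket /brk !mxE -!mulmx2E !mxE.
  by apply: cvgB; apply: cvgD; apply: cvgM; exact: cw.
have cd : {for A, continuous (fun B => \det (lift_bracket psi B))}.
  apply: (@eq_continuous_for _ _ _ (fun B : M4 R =>
    lift_bracket psi B 0 0 * lift_bracket psi B 1 1 -
    lift_bracket psi B 0 1 * lift_bracket psi B 1 0)).
    by move=> B; rewrite det_mx2E.
  by apply: cvgB; apply: cvgM; exact: cb.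
have nA : nbhs A [set B | 0 < \det (lift_bracket psi B)].
  exact: (cd _ (open_nbhs_nbhs (conj open_gt0 d0))).
apply: filterS (lifts_rep_nbhs nA AE) => sigma [B B0 BE].
exact/(positive_bracket_lift psi BE).
Qed.

(** Letting [psi] run through all automorphisms makes the set invariant, as composition with an
    automorphism permutes them. *)
Definition bracket_set : set (moduli R) := [set m | exists rho psi,
  [/\ rep_class rho = m, bijective psi & positive_bracket rho psi]].

Lemma bracket_setP rho : bracket_set (rep_class rho) <->
  exists psi, bijective psi /\ positive_bracket rho psi.
Proof.
split=> [[sigma [psi [/rep_class_eqP sr bpsi p]]]|[psi [bpsi p]]]; last first.
  by exists rho, psi.
by exists psi; split=> //; exact: positive_bracket_conj sr p.
Qed.

Lemma open_bracket_set : open bracket_set.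
Proof.
apply/open_moduliP; rewrite openE => rho /bracket_setP[psi [bpsi p]].
apply: filterS (positive_bracket_near p) => sigma ps.
by apply/bracket_setP; exists psi.
Qed.

Lemma inverse_hom psi : bijective psi ->
  exists2 psi' : UMagmaMorphism.type Gamma2 Gamma2, cancel psi psi' & cancel psi' psi.
Proof.
move=> [f fK Kf].
have f1 : f 1%g = 1%g by rewrite -[RHS](fK 1%g) gmulf1.
have fM : {morph f : x y / (x * y)%g >-> (x * y)%g}.
  by move=> x y; apply: (can_inj fK); rewrite gmulfM !Kf.
pose F : UMagmaMorphism.type Gamma2 Gamma2 :=
  HB.pack f (isMultiplicative.Build Gamma2 Gamma2 f fM)
    (Multiplicative_isUMagmaMorphism.Build Gamma2 Gamma2 f f1).
by exists F.
Qed.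

Lemma bracket_set_Mod m (h : Mod) : bracket_set (Mod_act m h) <-> bracket_set m.
Proof.
have -> : m = rep_class (repr m) by rewrite /rep_class reprK.
have -> : h = \pi_Mod (repr h) by rewrite reprK.
set rho := repr m; set phi := repr h; rewrite Mod_actE !bracket_setP.
split=> -[psi [bpsi [s [t [sE tE d0]]]]].
  exists (phi \o psi : UMagmaMorphism.type Gamma2 Gamma2); split.
    exact: bij_comp (aut_bij phi) bpsi.
  by exists s, t.
have [phi' phiK phiK'] := inverse_hom (aut_bij phi).
exists (phi' \o psi : UMagmaMorphism.type Gamma2 Gamma2); split.
  by apply: bij_comp bpsi; exists phi.
by exists s, t; rewrite /= !phiK'.
Qed.

Definition bracket_fun (x : moduli0 R) : R :=
  if `[< bracket_set (set_val x) >] then 1 else 0.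

Lemma bracket_fun_measurable (B : set R) : measurable B ->
  <<s @open (moduli0 R) >> (bracket_fun @^-1` B).
Proof.
move=> _.
pose S : set (moduli0 R) := set_val @^-1` bracket_set.
have mS : <<s @open (moduli0 R) >> S.
  by apply: sub_sigma_algebra; exists bracket_set => //; exact: open_bracket_set.
have m0 : <<s @open (moduli0 R) >> set0 by exact: sigma_algebra0.
have mC Z : <<s @open (moduli0 R) >> Z -> <<s @open (moduli0 R) >> (~` Z).
  by move=> mZ; rewrite -setTD; exact: sigma_algebraCD.
have fE x : bracket_fun x = if `[< S x >] then 1 else 0 by [].
have [B1|B1] := pselect (B 1); have [B0|B0] := pselect (B 0).
- have -> : bracket_fun @^-1` B = ~` set0; last exact: mC.
  by rewrite setC0; apply/seteqP; split=> // x _; rewrite /= fE; case: ifP.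
- have -> : bracket_fun @^-1` B = S; last exact: mS.
  by apply/seteqP; split=> x; rewrite /= fE; case: asboolP.
- have -> : bracket_fun @^-1` B = ~` S; last exact: mC.
  by apply/seteqP; split=> x; rewrite /= fE; case: asboolP.
- have -> : bracket_fun @^-1` B = set0; last exact: m0.
  by apply/seteqP; split=> x; rewrite /= fE; case: ifP.
Qed.

Lemma bracket_fun_invariant x h y : @Mod_act0 R x h y -> bracket_fun y = bracket_fun x.
Proof.
by rewrite /Mod_act0 /bracket_fun => ->; rewrite (propext (bracket_set_Mod _ _)).
Qed.

End BracketSign.

(** * Non-null sets and the failure of ergodicity *)

Section NonNull.
Context {R : realType}.
Variables (b : R6 R) (e : R) (e0 : 0 < e).
Hypothesis eb : forall x, ball b e x -> exists gx : good x, euler_class (sec_rep gx) 0.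

Lemma slice_not_null (S : set (moduli0 R)) :
  (forall x (gx : good x) (m : moduli0 R), ball b e x ->
     set_val m = rep_class (sec_nerep gx) -> S m) ->
  ~ null_moduli0 S.
Proof.
move=> bS nS.
have gO x : ball b e x -> good x by move=> /eb[].
have := nS _ _ (slice_chart e0 gO).
suff -> : set_val @` S `&` chart_dom e0 gO = chart_dom e0 gO.
  by rewrite chart_image_dom; exact: ball_not_negligible.
apply/setIidPr => _ [x bx <-]; have [gx ex] := eb bx.
have mx : moduli0_set (rep_class (slice_pt e0 gO x)).
  by exists (slice_pt e0 gO x) => //; rewrite (slice_ptE e0 gO gx).
pose m : moduli0 R := exist _ (rep_class (slice_pt e0 gO x)) (mem_set mx).
exists m => //; apply: (bS x gx) => //.
by rewrite -(slice_ptE e0 gO gx).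
Qed.

End NonNull.

(** For [psi = id] the determinant of the bracket is [c (l - l^-1)^2]. *)
Lemma bracket_set_slice (R : realType) (x : R6 R) (gx : good x) : 0 < xc x ->
  bracket_set (rep_class (sec_nerep gx)).
Proof.
move=> c0; apply/bracket_setP; exists (idfun : UMagmaMorphism.type Gamma2 Gamma2).
split; first by exists idfun.
exists (sec_sl2 gx A1), (sec_sl2 gx B1); split; [by rewrite -sec_hom_gen|by rewrite -sec_hom_gen|].
rewrite /brk /= /sec_A1 /sec_B1 !mx2_simpl.
have l1 := good_l gx; have l0 : 0 < xl x := lt_trans ltr01 l1.
have li : (xl x)^-1 < 1 by rewrite invf_lt1.
rewrite [ltRHS](_ : _ = xc x * (xl x - (xl x)^-1) ^+ 2); last by ring.
by rewrite mulr_gt0 // exprn_gt0 // subr_gt0 (lt_trans li).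
Qed.

Theorem corollary1p3 (R : realType) :
  ~ ergodic R (@null_moduli0 R) (@Mod_act0 R).
Proof.
move=> /(_ _ (@bracket_fun_measurable R) (@bracket_fun_invariant R))[c].
(* The constant 1 is refuted near the integral point, where [bracket_fun] is 0; any other constant
   is refuted near [base 2 1 1], where it is 1. *)
have [->|c1] := eqVneq c 1.
  have [e e0 eb] := base_ball (@int_l1 R) (@int_a0 R) (@int_c0 R) (@int_c1 R) (@int_c3 R).
  apply: (slice_not_null e0 eb) => x gx m bx mE.
  rewrite /= /bracket_fun mE; case: asboolP => [/bracket_setP|_]; last first.
    by apply/eqP; rewrite eq_sym oner_eq0.
  move=> [psi [bpsi [s [t [sE tE]]]]]; rewrite ltNge => /negP[].
  have gO y : ball int_point e y -> good y by move=> /eb[].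
  have := int_ball_bracket gO gx bx bpsi.
  rewrite (@det_brk_pm _ s (sec_hom gx (psi (gen A1))) t (sec_hom gx (psi (gen B1)))) //;
    exact/psl2_eqP.
have h1 : 1 < 2 :> R by lra.
have h2 : 1 != 0 :> R by rewrite oner_neq0.
have h3 : 0 < 1 + 1 :> R by lra.
have h4 : 1 < 3 :> R by lra.
have [e e0 eb] := base_ball h1 ltr01 h2 h3 h4.
(* A radius of at most 1 keeps the coordinate [xc], equal to 1 at the centre, positive. *)
pose d := Num.min e 1.
have d0 : 0 < d by rewrite lt_min e0 ltr01.
have de : ball (base 2 1 1) d `<=` ball (base 2 1 1) e.
  by apply: le_ball; rewrite ge_min lexx.
apply: (slice_not_null d0 (fun x bx => eb x (de x bx))) => x gx m bx mE.
have c0 : 0 < xc x.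
  case: bx => -[[[_ bc] _] _] _; move: bc; rewrite /= /ball /= /d.
  rewrite lt_min => /andP[_]; rewrite ltr_norml => /andP[_].
  by rewrite -/(xc x); lra.
rewrite /= /bracket_fun mE; case: asboolP => [_|]; first by apply/eqP; rewrite eq_sym.
by case; exact: bracket_set_slice.
Qed.
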